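(* Let $Z\sim\mathscr{N}(0,1)$ and let $F\in\mathbb{D}$ be centred. Then $$d_W(F,Z)\le\sqrt{\frac{2}{\pi}}\;E\Big[\big|1-\langle DF,-DL^{-1}F\rangle_{\mathfrak{H}}\big|\Big]+E\Big[\sum_{k\in\mathbb{N}}\frac{1}{\sqrt{p_kq_k}}\,|D_kL^{-1}F|\,|D_kF|^2\Big].$$ In particular, if $F\in\mathscr{C}_m$ for some $m\in\mathbb{N}$, then $$E\Big[\big|1-\langle DF,-DL^{-1}F\rangle_{\mathfrak{H}}\big|\Big]\le\big|1-E[F^2]\big|+\frac1m\sqrt{\mathrm{Var}\big(\|DF\|_{\mathfrak{H}}^2\big)}$$ and $$E\Big[\sum_{k\in\mathbb{N}}\frac{1}{\sqrt{p_kq_k}}\,|D_kL^{-1}F|\,|D_kF|^2\Big]\le\sqrt{\frac{E[F^2]}{m}}\;\sqrt{\sum_{k\in\mathbb{N}}\frac{1}{p_kq_k}E\big[|D_kF|^4\big]}\,.$$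
   Context: Setting: $\mathbb{N}=\{1,2,\dots\}$. $(X_k)_{k\in\mathbb{N}}$ is a sequence of independent random variables with $P(X_k=1)=p_k$, $P(X_k=-1)=q_k$, where $p_k\in(0,1)$ and $q_k=1-p_k$ (non-symmetric, non-homogeneous Rademacher sequence). The normalised sequence is $Y_k=(X_k-p_k+q_k)/(2\sqrt{p_kq_k})$. $\mathscr{G}$ is the $\sigma$-algebra generated by $(Y_k)$, and $L^2(\Omega)=L^2(\Omega,\mathscr{G},P)$. Multiple integrals: $\mathfrak{H}=\ell^2(\mathbb{N})$, $\mathfrak{H}^{\otimes n}=\ell^2(\mathbb{N}^n)$, $\Delta_n=\{(i_1,\dots,i_n)\in\mathbb{N}^n: i_k\ne i_j \text{ for } k\neq j\}$, and $\mathfrak{H}_0^{\odot n}$ is the set of symmetric $f\in\mathfrak{H}^{\otimes n}$ vanishing off $\Delta_n$ (with $\mathfrak{H}_0^{\odot 0}=\mathbb{R}$). For $f\in\mathfrak{H}_0^{\odot n}$, $n\ge1$, $J_n(f)=\sum_{(i_1,\dots,i_n)\in\Delta_n}f(i_1,\dots,i_n)Y_{i_1}\cdots Y_{i_n}$ (in $L^2(\Omega)$), and $J_0(c)=c$ for $c\in\mathbb{R}$. The Rademacher chaos of order $m\ge1$ is $\mathscr{C}_m=\{J_m(g):g\in\mathfrak{H}_0^{\odot m}\}$. Every $F\in L^2(\Omega)$ has a decomposition $F=E[F]+\sum_{n\ge1}J_n(f_n)$ with $f_n\in\mathfrak{H}_0^{\odot n}$. Operators: $\mathbb{D}$ is the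 set of $F=E[F]+\sum_{n\ge1}J_n(f_n)\in L^2(\Omega)$ with $\sum_{n\ge1}n\,n!\,\|f_n\|^2_{\mathfrak{H}^{\otimes n}}<\infty$; for such $F$, $D_kF=\sum_{n\ge1}nJ_{n-1}(f_n(\cdot,k))$ and $DF=(D_kF)_{k\in\mathbb{N}}$. For centred $F=\sum_{n\ge1}J_n(f_n)\in L^2(\Omega)$, $L^{-1}F=-\sum_{n\ge1}\frac1nJ_n(f_n)$. The Wasserstein distance is $d_W(F,Z)=\sup|E[h(F)]-E[h(Z)]|$, the supremum being over all $1$-Lipschitz functions $h:\mathbb{R}\to\mathbb{R}$. Right-hand sides are allowed to be $+\infty$ (with $\mathrm{Var}(\|DF\|^2_{\mathfrak{H}})=+\infty$ when $\|DF\|_{\mathfrak{H}}^2\notin L^2(\Omega)$). *)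

(* Defs.v *)
From HB Require Import structures.
From mathcomp Require Import all_boot all_order all_algebra all_fingroup.
From mathcomp Require Import finmap.
From mathcomp Require Import all_classical all_reals all_analysis.
From mathcomp Require showcase.summability.

Set Implicit Arguments.
Unset Strict Implicit.
Unset Printing Implicit Defensive.

Import Order.TTheory GRing.Theory Num.Theory.
Import numFieldNormedType.Exports.

Local Open Scope classical_set_scope.
Local Open Scope ring_scope.

(* Sequences indexed by {1, 2, ...} are indexed here by [nat]. *)

Section l2.
Context {R : realType}.

(* Only meaningful when the series converges (in particular for u, v in
   ell^2); the value is an arbitrary constant otherwise. *)
Definition dot_l2 (u v : nat -> R) : R := limn (series (fun k => u k * v k)).

Definition normsq_l2 (u : nat -> R) : R := dot_l2 u u.

(* A kernel f on N^n is a function on n-tuples; [uniq i] says i is in Delta_n. *)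
Definition kernel_normsq n (f : n.-tuple nat -> R) : \bar R :=
  \esum_(i in [set: n.-tuple nat]) (f i ^+ 2)%:E.

(* For n = 0 this is the set of all functions on the one-point type
   0.-tuple nat, i.e. (a copy of) R. *)
Definition sym_kernel n (f : n.-tuple nat -> R) : Prop :=
  [/\ (kernel_normsq f < +oo)%E,
      forall (s : 'S_n) (i : n.-tuple nat),
        f [tuple tnth i (s k) | k < n] = f i
    & forall i : n.-tuple nat, ~~ uniq i -> f i = 0].

Definition slice n (f : n.+1.-tuple nat -> R) (k : nat) : n.-tuple nat -> R :=
  fun i => f [tuple of rcons i k].

End l2.

Definition mutually_independent {d} {T : measurableType d} {R : realType}
    (P : probability T R) (X : nat -> {RV P >-> R}) : Prop :=
  forall (A : {fset nat}) (B : nat -> set R),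
    (forall k, measurable (B k)) ->
    P (\bigcap_(k in [set` A]) (X k @^-1` B k)) =
    (\prod_(k <- A) P (X k @^-1` B k))%E.

Definition wasserstein {d} {T : measurableType d} {d'} {T' : measurableType d'}
    {R : realType} (P : probability T R) (F : T -> R)
    (P' : probability T' R) (Z : T' -> R) : \bar R :=
  ereal_sup [set `| 'E_P[h \o F] - 'E_P'[h \o Z] |%E
            | h in [set h : R -> R | 1.-lipschitz h]].

Definition kernel_family (R : realType) := forall n : nat, n.-tuple nat -> R.

Section rademacher.
Context {d} {T : measurableType d} {R : realType} (P : probability T R).
Variables (p : nat -> R) (X : nat -> {RV P >-> R}).

Definition Y (k : nat) : T -> R := fun w =>
  (X k w - p k + (1 - p k)) / (2 * Num.sqrt (p k * (1 - p k))).

(* The sigma-algebra generated by Y is <<s sigmaY >>. *)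
Definition sigmaY : set (set T) :=
  \bigcup_k preimage_set_system [set: T] (Y k) measurable.

(* Classes in L^2(Omega, sigma(Y), P) are handled through representatives
   that are sigma(Y)-measurable everywhere. *)
Definition L2 : set (T -> R) := [set F |
  F \in Lfun P 2%:E /\ measurable_fun [set: g_sigma_algebraType sigmaY] F].

Definition L2_cvg {I} (u : I -> T -> R) (Fil : set_system I) (F : T -> R) :=
  L2 F /\ ('N[P]_2%:E [EFin \o (u i \- F)%R])%E @[i --> Fil] --> 0%E.

(* A version of the limit in L^2; the zero function if there is none. *)
Definition L2_lim {I} (u : I -> T -> R) (Fil : set_system I) : T -> R :=
  xget (cst 0) [set F | L2_cvg u Fil F].

(* The sum over Delta_n is the unconditional one: the limit in L^2 along the
   finite sets of indices directed by inclusion.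
   For n = 0, J f is almost surely the value of f at the empty tuple. *)
Definition J n (f : n.-tuple nat -> R) : T -> R :=
  L2_lim (fun (A : {fset n.-tuple nat}) w =>
            \sum_(i <- A | uniq i) f i * \prod_(j < n) Y (tnth i j) w)
         summability.totally.

Definition chaos (m : nat) : set (T -> R) := [set F | L2 F /\
  exists2 g : m.-tuple nat -> R, sym_kernel g & F = J g %[ae P]].

(* F = E[F] + sum_(n >= 1) J_n(f_n); the component f 0 plays no role. *)
Definition chaos_decomposition (F : T -> R) (f : kernel_family R) :=
  (forall n, (0 < n)%N -> sym_kernel (f n)) /\
  L2_cvg (fun N w => fine 'E_P[F] + \sum_(1 <= n < N) J (f n) w) \oo F.

(* The kernels f_n, n >= 1, are determined by F. *)
Definition kernels (F : T -> R) : kernel_family R :=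
  xget (fun _ _ => 0) [set f | chaos_decomposition F f].

Definition domD : set (T -> R) := [set F | L2 F /\
  exists2 f, chaos_decomposition F f &
    (\sum_(1 <= n <oo) (n * n`!)%:R%:E * kernel_normsq (f n) < +oo)%E].

(* The sum over n >= 1 of n J_{n-1}(f_n(., k)), reindexed by n |-> n.+1. *)
Definition D (F : T -> R) (k : nat) : T -> R :=
  L2_lim (fun N w => \sum_(0 <= n < N)
            n.+1%:R * J (slice (@kernels F n.+1) k) w) \oo.

Definition Linv (F : T -> R) : T -> R :=
  L2_lim (fun N w => - \sum_(1 <= n < N) n%:R^-1 * J (@kernels F n) w) \oo.

End rademacher.

(* Main.v *)
Require Import Defs.
From HB Require Import structures.
From mathcomp Require Import all_boot all_order all_algebra all_fingroup.
From mathcomp Require Import finmap.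
From mathcomp Require Import all_classical all_reals all_analysis.
From mathcomp Require Import measurable_realfun ring lra.

Set Implicit Arguments.
Unset Strict Implicit.
Unset Printing Implicit Defensive.

Import Order.TTheory GRing.Theory Num.Theory.
Import numFieldNormedType.Exports.

Local Open Scope classical_set_scope.
Local Open Scope ring_scope.

(* Every function in the Hilbert space spanned by the products of the [Y k] is
   determined by its coefficients on the finite sets of indices, and [D] and
   [Linv] act on these coefficients. Write [U k] for [D F k], [G k] for
   [- D (Linv F) k] and [g] for the solution of Stein's equation
   [h - E h(Z) = g' - id * g], so that [|g'| <= sqrt (2 / pi)] and [g'] is
   2-Lipschitz. Then [F] is the sum of the [Y k * G k] and, for each [k],
   [F = a k + Y k * U k] where [a k], [U k] and [G k] do not depend on the [k]-th
   coordinate. Averaging over that coordinate alone,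
   [E (Y k * G k * g F) = E (G k * sd k * (g (a + y1 * U k) - g (a + y0 * U k)))]
   with [y1 - y0 = 1 / sd k], and the Taylor formula replaces the last factor by
   [g' F * U k] up to [U k ^+ 2 / sd k]. On the chaos of order [m] one has
   [G k = U k / m] and [E |DF|^2 = m * E F^2], and the two other bounds follow
   from the Cauchy-Schwarz inequality. *)

(** * Stein's equation for the normal distribution *)

(** A duality between [D] and its adjoint, with a chain rule for [D (g F)], would need a chaos
    decomposition of [g F]. Averaging over one coordinate at a time avoids it: the partial sums of
    [Y k * G k] converge to [F] in L^2 and are only tested against the L^2 function [g F]. The
    limits in the definitions of [J], [D] and [Linv] are chosen versions, known up to null sets,
    while their Walsh coefficients are determined. Hence not depending on the [k]-th coordinate is
    expressed by the vanishing of the coefficients at the sets that contain [k]. Exact averages are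
    computed for polynomials in finitely many signs and carried to the limit because [g] is
    Lipschitz and [Y k] is bounded. Both constants come from explicit Gaussian estimates. With [phi]
    the normal density, [|g' w| * phi w] is at most twice the product of the means of [(Z - w)^+]
    and [(w - Z)^+], which is at most [phi w * phi 0]; and [2 * phi 0 = sqrt (2 / pi)]. The
    coefficient 1 of the second term is half the Lipschitz constant 2 of [g'], as in the integral
    form of Taylor's formula. *)

Section real_derivatives.
Context {R : realType}.
Implicit Types f df : R -> R.

Lemma is_derive_continuous f df :
  (forall x : R, is_derive x 1 f (df x)) -> continuous f.
Proof.
move=> fdf x; apply/differentiable_continuous/derivable1_diffP.
by have [] := fdf x.
Qed.

Lemma MVT_all f df a b : (forall x : R, is_derive x 1 f (df x)) -> a <= b ->
  exists2 c, a <= c <= b & f b - f a = df c * (b - a).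
Proof.
move=> fdf ab; have [|c cab ->] := @MVT_segment R f df a b ab (fun x _ => fdf x).
  exact/continuous_subspaceT/(is_derive_continuous fdf).
by exists c => //; rewrite in_itv in cab.
Qed.

Lemma derive_le0_nincr f df : (forall x : R, is_derive x 1 f (df x)) ->
  (forall x, df x <= 0) -> {homo f : x y /~ x <= y}.
Proof.
move=> fdf df0 b a ab; have [c _ e] := MVT_all fdf ab.
by rewrite -subr_le0 e mulr_le0_ge0 // subr_ge0.
Qed.

Lemma derive0_cst f : (forall x : R, is_derive x 1 f 0) -> forall x y, f x = f y.
Proof.
move=> f0 x y; wlog xy : x y / x <= y.
  by move=> W; have [/W//|/ltW/W/esym] := leP x y.
by have [c _] := MVT_all f0 xy; rewrite mul0r => /subr0_eq.
Qed.

Lemma derive_bounded_lipschitz f df k : (forall x : R, is_derive x 1 f (df x)) ->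
  (forall x, `|df x| <= k) -> forall x y, `|f x - f y| <= k * `|x - y|.
Proof.
move=> fdf dfk x y; wlog xy : x y / y <= x.
  move=> W; have [/W//|/ltW/W] := leP y x.
  by rewrite distrC (distrC x).
have [c _ ->] := MVT_all fdf xy.
by rewrite normrM ler_wpM2r.
Qed.

(* The derivative of [f t - f x - df x * (t - x) -+ (t - x) ^+ 2] keeps a
   constant sign on each side of [x]; this gains a factor 2 over the mean value
   theorem. *)
Lemma lipschitz_derive_taylor f df : (forall x : R, is_derive x 1 f (df x)) ->
  (forall x y, `|df x - df y| <= 2 * `|x - y|) ->
  forall x y, `|f y - f x - df x * (y - x)| <= (y - x) ^+ 2.
Proof.
move=> fdf dfl x y.
have der (s t : R) : is_derive t 1 (fun t => f t - df x * t + s * (t - x) ^+ 2)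
    (df t - df x + s * (2 * (t - x))).
  have ? := fdf t.
  apply: is_derive_eq; rewrite /GRing.scale/= ?expr1.
  by ring.
have key (s : R) : `|s| = 1 -> exists2 c, (0 <= (c - x) * (y - x)) &
    f y - f x - df x * (y - x) + s * (y - x) ^+ 2 =
    (df c - df x + s * (2 * (c - x))) * (y - x).
  move=> s1; have [xy|/ltW yx] := leP x y.
    have [c /andP[xc _]] := MVT_all (der s) xy.
    rewrite subrr expr0n/= mulr0 addr0 => e; exists c.
      by rewrite mulr_ge0 ?subr_ge0.
    by rewrite -e; ring.
  have [c /andP[_ cx]] := MVT_all (der s) yx.
  rewrite subrr expr0n/= mulr0 addr0 => e; exists c.
    by rewrite mulr_le0 ?subr_le0.
  by rewrite -(opprB x y) [RHS]mulrN -e; ring.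
have bnd c : (0 <= (c - x) * (y - x)) ->
    `|(df c - df x) * (y - x)| <= 2 * (c - x) * (y - x).
  move=> c0; rewrite normrM -[leRHS]mulrA -(ger0_norm c0) normrM mulrA.
  by rewrite ler_wpM2r.
rewrite ler_norml; apply/andP; split.
  have [c /bnd] := key 1 (normr1 _).
  by rewrite ler_norml => /andP[] *; lra.
have [c /bnd] := key (-1) (normrN1 _).
by rewrite ler_norml => /andP[] *; lra.
Qed.

End real_derivatives.

(** * The standard normal density and its truncated moments *)

Section gaussian.
Context {R : realType}.
Notation mu := (@lebesgue_measure R).
Local Notation phi := (@normal_pdf R 0 1).
Local Notation phi0 := (@normal_peak R 1).

Lemma normal_pdf01E x : phi x = phi0 * expR (- x ^+ 2 / 2).
Proof. by rewrite normal_pdfE ?oner_neq0// /normal_fun subr0 expr1n. Qed.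

Lemma phi0E : phi0 = (Num.sqrt (pi *+ 2))^-1.
Proof. by rewrite /normal_peak expr1n mul1r. Qed.

Lemma phi0_gt0 : 0 < phi0.
Proof. by rewrite normal_peak_gt0 ?oner_neq0. Qed.

Lemma phi_gt0 x : 0 < phi x.
Proof. by rewrite normal_pdf01E mulr_gt0 ?phi0_gt0 ?expR_gt0. Qed.

Lemma phi_le x : phi x <= phi0.
Proof. by rewrite normal_pdf_ub ?oner_neq0. Qed.

Lemma phi_0 : phi 0 = phi0.
Proof. by rewrite normal_pdf01E expr0n/= oppr0 mul0r expR0 mulr1. Qed.

Lemma phiN x : phi (- x) = phi x.
Proof. by rewrite !normal_pdf01E sqrrN. Qed.

Lemma is_derive_phi (x : R) : is_derive x 1 phi (- x * phi x).
Proof.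
have -> : phi = fun x : R => phi0 * expR (- x ^+ 2 * 2^-1).
  by apply/funext => y; rewrite normal_pdf01E.
apply: is_derive_eq; rewrite !scaler1/= /GRing.scale/=.
by field.
Qed.

Lemma continuous_phi : continuous phi.
Proof. exact: is_derive_continuous is_derive_phi. Qed.

(** This is [1 + t <= expR t] at [t = x ^+ 2 / 2]. It is the only decay of the density that the
    limits at infinity require. *)
Lemma sqr_phi_le x : x ^+ 2 * phi x <= 2 * phi0.
Proof.
rewrite normal_pdf01E mulrCA mulrC ler_pM2r ?phi0_gt0//.
rewrite mulNr expRN ler_pdivrMr ?expR_gt0//.
have := @expR_ge1Dx R (x ^+ 2 / 2).
by have := sqr_ge0 x; lra.
Qed.

End gaussian.

Section gaussian.
Context {R : realType}.
Notation mu := (@lebesgue_measure R).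
Local Notation phi := (@normal_pdf R 0 1).
Local Notation phi0 := (@normal_peak R 1).

Lemma integrable_phi : mu.-integrable setT (EFin \o phi).
Proof. exact: integrable_normal_pdf. Qed.

Lemma xphi_cvg0 : phi x @[x --> +oo%R] --> (0 : R).
Proof.
apply/cvgrPdist_lt => e e0; near=> x.
have x0 : 0 < x by near: x; exact: nbhs_pinfty_gt.
rewrite sub0r normrN gtr0_norm ?phi_gt0//.
rewrite -(ltr_pM2l (exprn_gt0 2 x0)) (le_lt_trans (sqr_phi_le x))//.
rewrite -ltr_pdivrMr//.
have : Num.max 1 (2 * phi0 / e) < x by near: x; by apply: nbhs_pinfty_gt; exact: num_real.
rewrite gt_max => /andP[x1 /lt_le_trans->//].
by rewrite ler_eXnr// ltW.
Unshelve. all: by end_near. Qed.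

Lemma integral_xphi_ge0 : (\int[mu]_(x in `[0%R, +oo[) (x * phi x)%R%:E = phi0%:E)%E.
Proof.
rewrite (@ge0_continuous_FTC2y R _ (fun x => - phi x) _ 0) ?oppr0//.
- by rewrite phi_0 -EFinB opprK add0r.
- by move=> x x0; rewrite mulr_ge0 ?normal_pdf_ge0.
- apply/continuous_subspaceT => x; apply: cvgM; first exact: cvg_id.
  exact: continuous_phi.
- by rewrite -[X in _ --> X]oppr0; apply: cvgN; exact: xphi_cvg0.
- by move=> x _; apply: derivableN; have [] := is_derive_phi x.
- apply: cvg_at_right_filter; apply: cvgN; exact: continuous_phi.
- move=> x _; have ? := is_derive_phi x.
  by rewrite derive1E derive_val mulNr opprK.
Qed.

Lemma integrable_xphi : mu.-integrable setT (fun x => (x * phi x)%:E).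
Proof.
have cxphi : continuous (fun x : R => x * phi x).
  by move=> x; apply: cvgM; [exact: cvg_id|exact: continuous_phi].
apply/integrableP; split.
  by apply/measurable_EFinP; exact: continuous_measurable_fun.
under eq_integral do rewrite abse_EFin.
rewrite ge0_symfun_integralT//=.
- rewrite (_ : [set x | _] = `[0, +oo[%classic); last first.
    by apply/seteqP; split => x/=; rewrite in_itv/= andbT.
  under eq_integral => x.
    rewrite inE/= in_itv/= andbT => x0.
    rewrite ger0_norm ?mulr_ge0 ?normal_pdf_ge0//.
    over.
  by rewrite integral_xphi_ge0 -EFinM ltry.
- by move=> x; apply: cvg_norm; exact: cxphi.
- by move=> x/=; rewrite phiN mulNr normrN.
Qed.

Definition gint (h : R -> R) (w : R) : R :=
  \int[mu]_(x in `]-oo, w]) (h x * phi x).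

Definition gmean (h : R -> R) : R := \int[mu]_x (h x * phi x).

Lemma is_derive_gint (h : R -> R) (w : R) : continuous h ->
  mu.-integrable setT (fun x => (h x * phi x)%:E) ->
  is_derive w 1 (gint h) (h w * phi w).
Proof.
move=> ch ih.
have w1 : w < w + 1 by rewrite ltrDl.
have ihw : mu.-integrable `]-oo, w + 1] (EFin \o (fun x => h x * phi x)).
  exact: integrableS ih.
have cw : {for w, continuous (fun x => h x * phi x)}.
  by apply: cvgM; [exact: ch|exact: continuous_phi].
have [|dg dgE] := (fun H => continuous_FTC1 w1 ihw H cw).
  by rewrite ltNyr.
by apply: DeriveDef => //; rewrite -derive1E.
Qed.

(** The function [gint id + phi] has zero derivative, hence is constant; its value at 0 follows from
    [integral_xphi_ge0] by reflecting the half-line. *)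
Lemma gint_xphi w : gint id w = - phi w.
Proof.
have cxphi : continuous (fun x : R => x * phi x).
  by move=> x; apply: cvgM; [exact: cvg_id|exact: continuous_phi].
have der (x : R) : is_derive x 1 (fun x => gint id x + phi x) 0.
  have ? := is_derive_phi x.
  have ? := @is_derive_gint id x (fun x => cvg_id) integrable_xphi.
  by apply: is_derive_eq; rewrite mulNr subrr.
have := derive0_cst der w 0; rewrite /= phi_0.
suff -> : gint id 0 = - phi0 by rewrite addNr => /(canRL (addrK _)); rewrite add0r.
rewrite /gint /Rintegral.
have -> : (\int[mu]_(x in `]-oo, 0%R]) (id x * phi x)%R%:E =
    - \int[mu]_(x in `]-oo, (- 0)%R]) (- (x * phi x))%R%:E)%E.
  rewrite oppr0 -integral_ge0N//; last first.
    move=> x /=; rewrite in_itv/= => x0.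
    by rewrite lee_fin -mulNr mulr_ge0 ?normal_pdf_ge0// oppr_ge0.
  by apply: eq_integral => x _; rewrite -EFinN opprK.
rewrite (@ge0_integration_by_substitutionNy R (fun x => - (x * phi x)) 0); last 2 first.
- by apply/continuous_subspaceT => x; apply: cvgN; exact: cxphi.
- by move=> x; rewrite in_itv/= oppr0 => /ltW x0; rewrite -mulNr mulr_ge0 ?normal_pdf_ge0// oppr_ge0.
under eq_integral do rewrite /= phiN mulNr opprK.
by rewrite integral_xphi_ge0.
Qed.

Lemma gmean_split h w : mu.-integrable setT (fun x => (h x * phi x)%:E) ->
  gmean h - gint h w = \int[mu]_(x in `]w, +oo[) (h x * phi x).
Proof.
move=> ih; rewrite /gmean -(itv_setU_setT false w) Rintegral_setU//=.
- by rewrite addrAC subrr add0r.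
- by apply: integrableS ih => //; exact: measurableU.
- exact: (@disjoint_rays _ R false w).
Qed.

Lemma integrable_1phi : mu.-integrable setT (fun x => (cst 1 x * phi x)%:E).
Proof. by under eq_fun do rewrite mul1r; exact: integrable_phi. Qed.

Lemma gmean1 : gmean (cst 1) = 1.
Proof.
rewrite /gmean/=; under eq_Rintegral do rewrite mul1r.
by rewrite /Rintegral integral_normal_pdf.
Qed.

Lemma gint1N w : gint (cst 1) (- w) = 1 - gint (cst 1) w.
Proof.
rewrite -[X in X - _]gmean1 gmean_split; last exact: integrable_1phi.
rewrite Rintegral_itv_obnd_cbnd; last by apply: integrableS integrable_1phi.
rewrite /gint /Rintegral ge0_integration_by_substitutionNy//.
- by congr fine; apply: eq_integral => x _; rewrite /= phiN.
- apply/continuous_subspaceT => x; apply: cvgM; first exact: cvg_cst.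
  exact: continuous_phi.
- by move=> x _; rewrite mul1r; exact: normal_pdf_ge0.
Qed.

Lemma gmean_id : gmean id = 0.
Proof.
have := gmean_split 0 integrable_xphi.
rewrite gint_xphi phi_0 opprK.
rewrite Rintegral_itv_obnd_cbnd /Rintegral ?integral_xphi_ge0/=; last first.
  by apply: integrableS integrable_xphi.
by move=> /(canRL (addrK _)); rewrite subrr.
Qed.

End gaussian.

(** * Partial moments of the normal law *)

Section stein_tails.
Context {R : realType}.
Notation mu := (@lebesgue_measure R).
Local Notation phi := (@normal_pdf R 0 1).
Local Notation phi0 := (@normal_peak R 1).

Definition ncdf (w : R) : R := gint (cst 1) w.
Local Notation Phi := ncdf.

Lemma is_derive_ncdf (w : R) : is_derive w 1 Phi (phi w).
Proof.
rewrite -[phi w]mul1r; apply: is_derive_gint integrable_1phi.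
by move=> x; exact: cvg_cst.
Qed.

Lemma ncdfN w : Phi (- w) = 1 - Phi w. Proof. exact: gint1N. Qed.

Lemma ncdf_0 : Phi 0 = 1 / 2.
Proof. by have := ncdfN 0; rewrite oppr0; lra. Qed.

Lemma ncdf_ge0 w : 0 <= Phi w.
Proof.
apply: Rintegral_ge0 => x _.
by rewrite mul1r normal_pdf_ge0.
Qed.

Lemma ncdf_le1 w : Phi w <= 1.
Proof. by have := ncdf_ge0 (- w); rewrite ncdfN; lra. Qed.

(* The means of the positive parts of [Z - w] and of [w - Z], for [Z] standard
   normal. *)
Definition gtail (w : R) : R := phi w - w * (1 - Phi w).
Definition ghead (w : R) : R := phi w + w * Phi w.
Local Notation A := gtail.
Local Notation B := ghead.

Lemma gtailN w : A (- w) = B w.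
Proof. by rewrite /A /B phiN ncdfN; ring. Qed.

Lemma gheadN w : B (- w) = A w.
Proof. by rewrite /A /B phiN ncdfN; ring. Qed.

Lemma is_derive_gtail (w : R) : is_derive w 1 A (- (1 - Phi w)).
Proof.
have ? := is_derive_ncdf w; have ? := is_derive_phi w.
by apply: is_derive_eq; rewrite /GRing.scale/=; ring.
Qed.

Lemma is_derive_ghead (w : R) : is_derive w 1 B (Phi w).
Proof.
have ? := is_derive_ncdf w; have ? := is_derive_phi w.
by apply: is_derive_eq; rewrite /GRing.scale/=; ring.
Qed.

Section lipschitz.
Variable h : R -> R.
Hypothesis hl : forall x y, `|h x - h y| <= `|x - y|.

Lemma lipschitz1_continuous : continuous h.
Proof.
move=> x; apply/cvgrPdist_lt => e e0; near=> y.
rewrite (le_lt_trans (hl _ _))//.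
Unshelve. all: by end_near. Qed.

Lemma integrable_lipschitz_phi : mu.-integrable setT (fun x => (h x * phi x)%:E).
Proof.
apply: (@le_integrable _ _ _ mu setT _ _ (fun x => (`|h 0| * phi x)%:E + `|(x * phi x)%:E|)%E) => //.
- apply/measurable_EFinP; apply: continuous_measurable_fun => x.
  by apply: cvgM; [exact: lipschitz1_continuous|exact: continuous_phi].
- move=> x _; rewrite /= lee_fin !normrM !(ger0_norm (normal_pdf_ge0 _ _ _)).
  rewrite [leRHS]ger0_norm ?addr_ge0 ?mulr_ge0 ?normal_pdf_ge0// -mulrDl.
  rewrite ler_wpM2r ?normal_pdf_ge0//.
  by have := hl x 0; have := lerB_dist (h x) (h 0); rewrite subr0; lra.
- apply: integrableD => //; last exact: integrable_abse integrable_xphi.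
  by under eq_fun do rewrite EFinM; apply: integrableZl => //; exact: integrable_phi.
Qed.

(** [stein_I1] and [stein_I2] are the integrals of [h w - h x] below [w] and of [h x - h w] above
    [w] against the density. The solution of Stein's equation and its derivative are combinations of
    the two. For [h] 1-Lipschitz they are largest when [h = id], where they equal [B w] and
    [A w]. *)
Definition stein_I1 (w : R) : R := Phi w * h w - gint h w.
Definition stein_I2 (w : R) : R := gmean h - gint h w - (1 - Phi w) * h w.

Lemma Rintegral_sub_phi D c : measurable D ->
  \int[mu]_(x in D) ((h x - c) * phi x) =
  \int[mu]_(x in D) (h x * phi x) - \int[mu]_(x in D) (cst 1 x * phi x) * c.
Proof.
move=> mD; rewrite -RintegralZr//; last by apply: integrableS integrable_1phi.
rewrite -RintegralB//.
- by apply: eq_Rintegral => x _; rewrite /=; ring.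
- by apply: integrableS integrable_lipschitz_phi.
- rewrite /comp; under eq_fun do rewrite EFinM; apply: integrableZr => //.
  by apply: integrableS integrable_1phi.
Qed.

End lipschitz.

Lemma lipschitz1_id (x y : R) : `|id x - id y| <= `|x - y|.
Proof. by []. Qed.

Lemma stein_I1E h w : (forall x y, `|h x - h y| <= `|x - y|) ->
  stein_I1 h w = \int[mu]_(x in `]-oo, w]) ((h w - h x) * phi x).
Proof.
move=> hl; have -> : \int[mu]_(x in `]-oo, w]) ((h w - h x) * phi x) =
    - \int[mu]_(x in `]-oo, w]) ((h x - h w) * phi x).
  rewrite -mulN1r -RintegralZl//.
    by apply: eq_Rintegral => x _; ring.
  apply: integrableS (@integrable_lipschitz_phi (fun x => h x - h w) _) => // x y.
  by rewrite opprB addrA subrK.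
by rewrite Rintegral_sub_phi// opprB.
Qed.

Lemma stein_I2E h w : (forall x y, `|h x - h y| <= `|x - y|) ->
  stein_I2 h w = \int[mu]_(x in `]w, +oo[) ((h x - h w) * phi x).
Proof.
move=> hl; rewrite Rintegral_sub_phi// -(gmean_split w (integrable_lipschitz_phi hl)).
by have := gmean_split w integrable_1phi; rewrite gmean1 => <-.
Qed.

Lemma stein_I1_I2 h w : stein_I1 h w - stein_I2 h w = h w - gmean h.
Proof. by rewrite /stein_I1 /stein_I2; ring. Qed.

Lemma stein_I1_id w : stein_I1 id w = B w.
Proof. by rewrite /stein_I1 gint_xphi /B; ring. Qed.

Lemma stein_I2_id w : stein_I2 id w = A w.
Proof. by rewrite /stein_I2 gint_xphi gmean_id /A; ring. Qed.

Lemma normr_stein_I1 h w : (forall x y, `|h x - h y| <= `|x - y|) ->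
  `|stein_I1 h w| <= B w.
Proof.
move=> hl; rewrite -stein_I1_id !stein_I1E//.
have ih (k : R -> R) : (forall x y, `|k x - k y| <= `|x - y|) ->
    mu.-integrable `]-oo, w] (EFin \o fun x => (k w - k x) * phi x).
  move=> kl; apply: integrableS (@integrable_lipschitz_phi (fun x => k w - k x) _) => // x y.
  by rewrite opprB addrC addrA subrK distrC.
rewrite (le_trans (le_normr_Rintegral _ _))//; first exact: ih.
apply: le_Rintegral => //.
- by apply: integrable_norm => //; exact: ih.
- exact: ih.
move=> x/=; rewrite in_itv/= => xw.
rewrite normrM (ger0_norm (normal_pdf_ge0 _ _ _)) ler_wpM2r ?normal_pdf_ge0//.
by rewrite -(@ger0_norm _ (w - x)) ?subr_ge0.
Qed.

Lemma normr_stein_I2 h w : (forall x y, `|h x - h y| <= `|x - y|) ->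
  `|stein_I2 h w| <= A w.
Proof.
move=> hl; rewrite -stein_I2_id !stein_I2E//.
have ih (k : R -> R) : (forall x y, `|k x - k y| <= `|x - y|) ->
    mu.-integrable `]w, +oo[ (EFin \o fun x => (k x - k w) * phi x).
  move=> kl; apply: integrableS (@integrable_lipschitz_phi (fun x => k x - k w) _) => // x y.
  by rewrite opprB addrA subrK.
rewrite (le_trans (le_normr_Rintegral _ _))//; first exact: ih.
apply: le_Rintegral => //.
- by apply: integrable_norm => //; exact: ih.
- exact: ih.
move=> x/=; rewrite in_itv/= andbT => /ltW xw.
rewrite normrM (ger0_norm (normal_pdf_ge0 _ _ _)) ler_wpM2r ?normal_pdf_ge0//.
by rewrite -(@ger0_norm _ (x - w)) ?subr_ge0.
Qed.

Lemma gtail_ge0 w : 0 <= A w.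
Proof. exact: le_trans (normr_ge0 _) (normr_stein_I2 w lipschitz1_id). Qed.

Lemma ghead_ge0 w : 0 <= B w.
Proof. by rewrite -gtailN gtail_ge0. Qed.

Lemma gtail_le w : 0 <= w -> A w <= phi w.
Proof.
by move=> w0; rewrite /A gerBl mulr_ge0// subr_ge0 ncdf_le1.
Qed.

Lemma ghead_le w : 0 <= w -> B w <= phi w + w.
Proof. by move=> w0; rewrite /B lerD2l ler_piMr// ncdf_le1. Qed.

(* The expression is the mean of the square of the positive part of [Z - w]. *)
Lemma gtail2_ge0 w : 0 <= (1 + w ^+ 2) * (1 - Phi w) - w * phi w.
Proof.
pose Q (x : R) := (1 + x ^+ 2) * (1 - Phi x) - x * phi x.
have dQ (x : R) : is_derive x 1 Q (- 2 * A x).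
  have ? := is_derive_ncdf x; have ? := is_derive_phi x.
  by apply: is_derive_eq; rewrite /GRing.scale/= /A; ring.
have Qn : {homo Q : x y /~ x <= y}.
  by apply: derive_le0_nincr dQ _ => x; rewrite mulNr oppr_le0 mulr_ge0 ?gtail_ge0.
rewrite leNgt; apply/negP => Qw; rewrite -/(Q w) in Qw.
(* [Q] is nonincreasing, so a negative value [Q w] persists to the right of [w]; but
   [Q x >= - (x * phi x) >= - 2 * phi0 / x]. The last summand of the witness pushes [x] past the
   point where these two facts conflict. *)
have [x [wx x0 xe]] : exists x, [/\ w <= x, 0 < x & 2 * phi0 < - Q w * x].
  exists (`|w| + 1 + 2 * phi0 / - Q w); split.
  - rewrite (le_trans (ler_norm w))// -addrA lerDl addr_ge0// divr_ge0 ?oppr_ge0 ?(ltW Qw)//.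
    by rewrite mulr_ge0// ltW// phi0_gt0.
  - by rewrite ltr_wpDr ?ltr_wpDl// divr_ge0 ?oppr_ge0 ?(ltW Qw)// mulr_ge0// ltW// phi0_gt0.
  - rewrite mulrDr mulrCA divff ?oppr_eq0 ?lt_eqF// mulr1 ltrDr.
    by rewrite mulr_gt0 ?oppr_gt0// ltr_wpDl.
have Qx : - (x * phi x) <= Q x.
  rewrite /Q lerDr mulr_ge0 ?subr_ge0 ?ncdf_le1//.
  by rewrite addr_ge0// sqr_ge0.
have : - Q w * x <= 2 * phi0.
  rewrite (le_trans _ (sqr_phi_le x))// expr2 -mulrA [leRHS]mulrC ler_pM2r//.
  by have := Qn _ _ wx; lra.
by rewrite leNgt xe.
Qed.

Lemma ghead2_ge0 w : 0 <= (1 + w ^+ 2) * Phi w + w * phi w.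
Proof.
by have := gtail2_ge0 (- w); rewrite ncdfN phiN sqrrN opprB addrCA subrr addr0 mulNr opprK.
Qed.

(** The left side is the mean of [|Z - w|]. Both sides agree at 0, and its derivative
    [2 * Phi w - 1] is at most [2 * phi0 * w] because the density is bounded by [phi0]. This fixes
    the sign of the derivative used in [gtail_ghead_le]. *)
Lemma gtailDghead_le w : 0 <= w -> A w + B w <= phi0 * (2 + w ^+ 2).
Proof.
move=> w0.
have Phi_le x : 0 <= x -> Phi x <= 1 / 2 + phi0 * x.
  move=> x0; have [c _] := MVT_all is_derive_ncdf x0.
  rewrite ncdf_0 subr0 => /(canRL (subrK _)) ->.
  by rewrite addrC lerD2l ler_wpM2r// phi_le.
pose q (x : R) := A x + B x - phi0 * (2 + x ^+ 2).
have dq (x : R) : is_derive x 1 q (2 * (Phi x - 1 / 2 - phi0 * x)).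
  have ? := is_derive_gtail x; have ? := is_derive_ghead x.
  by apply: is_derive_eq; rewrite /GRing.scale/=; field.
have [c /andP[c0 _]] := MVT_all dq w0.
have -> : q 0 = 0 by rewrite /q /A /B !mul0r subr0 addr0 phi_0 expr0n/=; ring.
rewrite !subr0 -subr_le0 -/(q w) => ->.
by rewrite mulr_le0_ge0//; have := Phi_le c c0; lra.
Qed.

(* This is [E (Z - w)^+ * E (Z + w)^+ <= phi w * phi 0]. The derivative of
   [(phi x * phi0 - A x * B x) / x ^+ 2] is
   [2 * phi x * (A x + B x - phi0 * (2 + x ^+ 2)) / (2 * x ^+ 3)]. *)
Lemma gtail_ghead_le w : A w * B w <= phi w * phi0.
Proof.
wlog w0 : w / 0 <= w.
  move=> W; have [/W//|w0] := leP 0 w.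
  by have := W (- w); rewrite oppr_ge0 ltW// phiN gtailN gheadN mulrC; exact.
move: w0; rewrite le_eqVlt => /predU1P[<-|w0].
  by rewrite /A /B !mul0r subr0 addr0 phi_0.
rewrite -subr_ge0 leNgt; apply/negP => Hw.
pose H (x : R) := phi x * phi0 - A x * B x.
pose q (x : R) := H x * (x^-1) ^+ 2.
pose dq (x : R) := phi x * (A x + B x - phi0 * (2 + x ^+ 2)) / x ^+ 3.
have dqP (x : R) : 0 < x -> is_derive x 1 q (dq x).
  move=> x0; have ? := is_derive_gtail x; have ? := is_derive_ghead x.
  have ? := is_derive_phi x; have x0' : x != 0 by rewrite gt_eqF.
  have ? : is_derive x 1 (fun y : R => y^-1) (- x ^- 2 *: 1) by exact: is_deriveV.
  have ? : is_derive x 1 H (- x * phi x * phi0 + (1 - Phi x) * B x - A x * Phi x).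
    by rewrite /H; apply: is_derive_eq; rewrite /GRing.scale/=; ring.
  rewrite /q; apply: is_derive_eq; rewrite /GRing.scale/= /dq /H /A /B.
  by field.
have dq0 x : 0 < x -> dq x <= 0.
  move=> x0; rewrite /dq mulr_le0_ge0//; last by rewrite invr_ge0 exprn_ge0// ltW.
  by rewrite mulr_ge0_le0 ?normal_pdf_ge0// subr_le0 gtailDghead_le// ltW.
have qn x : w <= x -> q x <= q w.
  move=> wx.
  have dqi c : c \in `]w, x[ -> is_derive c 1 q (dq c).
    by rewrite in_itv/= => /andP[wc _]; apply: dqP; exact: lt_trans wc.
  have cq : {within `[w, x], continuous q}.
    apply: derivable_within_continuous => c; rewrite in_itv/= => /andP[wc _].
    by have [] := dqP c (lt_le_trans w0 wc).
  have [c + e] := MVT_segment wx dqi cq.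
  rewrite in_itv/= => /andP[wc _].
  rewrite -subr_le0 e mulr_le0_ge0 ?subr_ge0//.
  by apply: dq0; exact: lt_le_trans wc.
have qw : q w < 0 by rewrite /q pmulr_llt0// exprn_gt0// invr_gt0.
(* As [q] is nonincreasing, [q x <= q w < 0]. Beyond [phi0] one has [A x * B x <= phi0 * (2 * x)],
   hence [q x >= - 2 * phi0 / x]; the last summand makes [x] large enough for a contradiction. *)
pose x := w + phi0 + 2 * phi0 / - q w.
have p0 := @phi0_gt0 R.
have c0 : 0 < 2 * phi0 / - q w by rewrite divr_gt0 ?oppr_gt0// mulr_gt0.
have x0 : 0 < x by rewrite /x; lra.
have wx : w <= x by rewrite /x; lra.
have px : phi0 <= x by rewrite /x; lra.
have ABx : A x * B x <= phi0 * (2 * x).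
  rewrite ler_pM ?gtail_ge0 ?ghead_ge0//.
    by rewrite (le_trans (gtail_le (ltW x0)))// phi_le.
  by rewrite (le_trans (ghead_le (ltW x0)))//; have := phi_le x; lra.
have : - q w * x <= 2 * phi0.
  have : - (A x * B x) * (x^-1) ^+ 2 <= q w.
    rewrite (le_trans _ (qn x wx))// /q ler_wpM2r ?sqr_ge0// /H lerDr.
    by rewrite mulr_ge0 ?normal_pdf_ge0// ltW.
  rewrite -(ler_pM2r (exprn_gt0 2 x0)) -mulrA -exprMn mulVf ?gt_eqF// expr1n mulr1 => h1.
  rewrite -(ler_pM2r x0) -mulrA -expr2; lra.
rewrite leNgt => /negP; apply.
rewrite mulrDr mulrCA divff ?oppr_eq0 ?lt_eqF// mulr1 ltrDr.
by rewrite mulr_gt0 ?oppr_gt0// addr_gt0.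
Qed.

End stein_tails.

(** * The solution of Stein's equation and the bounds on its derivative *)

Section stein_solution.
Context {R : realType}.
Notation mu := (@lebesgue_measure R).
Local Notation phi := (@normal_pdf R 0 1).
Local Notation phi0 := (@normal_peak R 1).
Local Notation Phi := ncdf.
Local Notation A := gtail.
Local Notation B := ghead.

Lemma phi0_sqrt : 2 * phi0 = Num.sqrt (2 / pi).
Proof.
have pi0 := pi_gt0 R.
have <- : (2 * phi0) ^+ 2 = 2 / pi.
  rewrite exprMn phi0E exprVn sqr_sqrtr; last by rewrite mulrn_wge0// ltW.
  by move: (pi : R) pi0 => x x0; rewrite -mulr_natl; field; rewrite gt_eqF.
by rewrite sqrtr_sqr ger0_norm// mulr_ge0 ?normal_peak_ge0.
Qed.

Variable h : R -> R.
Hypothesis hl : forall x y, `|h x - h y| <= `|x - y|.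

(** The classical solution of [f' w - w * f w = h w - gmean h], obtained with the integrating factor
    [phi]. Its derivative [stein_dsol] is read off from the equation. *)
Definition stein_sol (w : R) : R := (gint h w - gmean h * Phi w) / phi w.
Local Notation f := stein_sol.
Definition stein_dsol (w : R) : R := h w - gmean h + w * f w.
Local Notation df := stein_dsol.

Lemma is_derive_stein_sol (w : R) : is_derive w 1 f (df w).
Proof.
have w0 : phi w != 0 by rewrite gt_eqF// phi_gt0.
have ? := is_derive_ncdf w; have ? := is_derive_phi w.
have ? := @is_derive_gint R h w (lipschitz1_continuous hl) (integrable_lipschitz_phi hl).
have ? : is_derive w 1 (fun y : R => (phi y)^-1) (- (phi w) ^- 2 *: (- w * phi w)).
  exact: is_deriveV.
rewrite /stein_sol /stein_dsol /stein_sol; apply: is_derive_eq; rewrite /GRing.scale/=.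
by field.
Qed.

Lemma stein_sol_phi w :
  f w * phi w = - (1 - Phi w) * stein_I1 h w - Phi w * stein_I2 h w.
Proof.
by rewrite /f divfK ?gt_eqF ?phi_gt0// /stein_I1 /stein_I2; ring.
Qed.

Lemma stein_dsol_phi w :
  df w * phi w = stein_I1 h w * A w - stein_I2 h w * B w.
Proof.
rewrite /df -stein_I1_I2 mulrDl -mulrA stein_sol_phi /A /B; ring.
Qed.

(** By [stein_dsol_phi] and the bounds on [stein_I1] and [stein_I2],
    [|df w| * phi w <= 2 * A w * B w]; then [gtail_ghead_le] bounds this by [2 * phi0 * phi w]. *)
Lemma stein_dsol_bound w : `|df w| <= Num.sqrt (2 / pi).
Proof.
rewrite -phi0_sqrt -(ler_pM2r (phi_gt0 w)) -{1}(gtr0_norm (phi_gt0 w)) -normrM stein_dsol_phi.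
rewrite (le_trans (ler_normB _ _))// !normrM.
rewrite (ger0_norm (gtail_ge0 w)) (ger0_norm (ghead_ge0 w)).
have := gtail_ghead_le w.
have := ler_wpM2r (gtail_ge0 w) (normr_stein_I1 w hl).
have := ler_wpM2r (ghead_ge0 w) (normr_stein_I2 w hl).
lra.
Qed.

(** Since [h] need not be differentiable, only [df - h = w * f - gmean h] is differentiated. The
    weights of [stein_I1] and [stein_I2] in its derivative are nonnegative by [gtail2_ge0] and
    [ghead2_ge0], and the resulting bound is exactly [phi w] after multiplication by [phi w]. So
    [df - h] is 1-Lipschitz, and [h] contributes the other 1. *)
Lemma stein_dsol_lipschitz x y : `|df x - df y| <= 2 * `|x - y|.
Proof.
pose g w := df w - h w.
have dg (w : R) : is_derive w 1 g (f w + w * df w).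
  have -> : g = fun w => w * f w - gmean h.
    by apply/funext => z; rewrite /g /stein_dsol; ring.
  have ? := is_derive_stein_sol w.
  by apply: is_derive_eq; rewrite /GRing.scale/=; ring.
have gb (w : R) : `|f w + w * df w| <= 1.
  rewrite -(ler_pM2r (phi_gt0 w)) -{1}(gtr0_norm (phi_gt0 w)) -normrM mul1r.
  rewrite mulrDl -(mulrA w) stein_sol_phi stein_dsol_phi.
  have -> : - (1 - Phi w) * stein_I1 h w - Phi w * stein_I2 h w +
      w * (stein_I1 h w * A w - stein_I2 h w * B w) =
    - (stein_I1 h w * ((1 + w ^+ 2) * (1 - Phi w) - w * phi w) +
       stein_I2 h w * ((1 + w ^+ 2) * Phi w + w * phi w)).
    by rewrite /A /B; ring.
  rewrite normrN (le_trans (ler_normD _ _))// !normrM.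
  rewrite (ger0_norm (gtail2_ge0 w)) (ger0_norm (ghead2_ge0 w)).
  have := ler_wpM2r (gtail2_ge0 w) (normr_stein_I1 w hl).
  have := ler_wpM2r (ghead2_ge0 w) (normr_stein_I2 w hl).
  suff : B w * ((1 + w ^+ 2) * (1 - Phi w) - w * phi w) +
    A w * ((1 + w ^+ 2) * Phi w + w * phi w) = phi w by lra.
  by rewrite /A /B; ring.
have := derive_bounded_lipschitz dg gb x y; rewrite mul1r /g => gl.
have -> : df x - df y = (df x - h x - (df y - h y)) + (h x - h y) by ring.
by rewrite (le_trans (ler_normD _ _))//; have := hl x y; lra.
Qed.

End stein_solution.

(** * Expectations under the normal law as integrals against its density *)

Section normal_expectation.
Context {R : realType}.
Notation mu := (@lebesgue_measure R).
Local Notation phi := (@normal_pdf R 0 1).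
Local Open Scope ereal_scope.
Local Notation nu := (@normal_prob R 0%R 1%R).

(** The Radon-Nikodym derivative of the normal law agrees almost everywhere with [phi], because both
    have the same integral over every measurable set. *)
Lemma ge0_integral_normal_prob (f : R -> \bar R) :
  measurable_fun setT f -> (forall x, 0 <= f x) ->
  \int[nu]_x f x = \int[mu]_x (f x * (phi x)%:E).
Proof.
move=> mf f0.
have numu := @normal_prob_dominates R 0%R 1%R.
have mphi : measurable_fun setT (fun x : R => (phi x)%:E).
  by apply/measurable_EFinP; exact: measurable_normal_pdf.
rewrite -(Radon_Nikodym_SigmaFinite.change_of_variables numu)//.
apply: ae_eq_integral => //.
- apply: emeasurable_funM => //.
  exact: measurable_int (Radon_Nikodym_SigmaFinite.f_integrable numu).
- exact: emeasurable_funM.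
apply: ae_eqe_mul2l.
apply: integral_ae_eq => //; first exact: Radon_Nikodym_SigmaFinite.f_integrable.
by move=> E _ mE; rewrite -Radon_Nikodym_SigmaFinite.f_integral.
Qed.

Lemma normal_expectation d (T : measurableType d) (P : probability T R)
    (Z : {RV P >-> R}) (h : R -> R) :
    (forall A : set R, measurable A -> distribution P Z A = nu A) ->
    measurable_fun setT h ->
  'E_P[h \o Z] = \int[mu]_x (h x * phi x)%:E.
Proof.
move=> hZ mh; rewrite unlock integralE [RHS]integralE.
have key (f : R -> \bar R) : measurable_fun setT f -> (forall x, 0 <= f x) ->
    \int[P]_w f (Z w) = \int[mu]_x (f x * (phi x)%:E).
  move=> mf f0; rewrite -ge0_integral_normal_prob//.
  have mZ : measurable_fun [set: T] (Z : T -> measurableTypeR R).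
    exact: (@measurable_funPT _ _ _ _ Z).
  rewrite -[LHS](@ge0_integral_pushforward _ _ T (measurableTypeR R) R _ mZ P setT f)//.
  by apply: eq_measure_integral => A mA _; exact: hZ.
have mEh : measurable_fun setT (EFin \o h) by exact/measurable_EFinP.
congr (_ - _).
- under eq_integral do rewrite funeposE.
  rewrite [LHS](key (fun x => maxe (h x)%:E 0)); last 2 first.
  + exact: measurable_maxe.
  + by move=> x; rewrite le_max lexx orbT.
  apply: eq_integral => x _; rewrite funeposE -!EFin_max -EFinM; congr EFin.
  by rewrite maxr_pMl ?mul0r// normal_pdf_ge0.
- under eq_integral do rewrite funenegE.
  rewrite [LHS](key (fun x => maxe (- (h x)%:E) 0)); last 2 first.
  + by apply: measurable_maxe => //; apply: measurableT_comp.
  + by move=> x; rewrite le_max lexx orbT.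
  apply: eq_integral => x _; rewrite funenegE -!EFin_max -EFinM; congr EFin.
  by rewrite maxr_pMl ?mul0r ?mulNr// normal_pdf_ge0.
Qed.

End normal_expectation.

(** * Measurable limits and the space L^2(P) *)

Section measurable_limits.
Context {d} {T : measurableType d} {R : realType}.

Lemma limn_esup_einf_cvg (u : (\bar R)^nat) (l : R) :
  limn_esup u = l%:E -> limn_einf u = l%:E -> fine \o u @ \oo --> l.
Proof.
move=> ul lu; apply: fine_cvg.
apply: (@squeeze_cvge _ _ _ _ (einfs u) _ (esups u)).
- near=> n; apply/andP; split.
  + by apply: ereal_inf_lbound; exists n => /=.
  + by apply: ereal_sup_ubound; exists n => /=.
- by rewrite -lu limn_einf_lim; exact: is_cvg_einfs.
- by rewrite -ul limn_esup_lim; exact: is_cvg_esups.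
Unshelve. all: by end_near. Qed.

(** [limn] of a divergent real sequence is the default value 0. The limit is therefore the upper
    limit multiplied by the indicator of the measurable set where upper and lower limits coincide
    and are finite. Measurability thus holds everywhere, as [L2] demands, and it applies to
    [dot_l2]. *)
Lemma measurable_fun_limn (v : nat -> T -> R) :
  (forall n, measurable_fun setT (v n)) ->
  measurable_fun setT (fun w => limn (fun n => v n w)).
Proof.
move=> mv.
pose ev n w := (v n w)%:E.
have mev n : measurable_fun setT (ev n) by exact/measurable_EFinP.
pose s w := limn_esup (ev^~ w).
pose i w := limn_einf (ev^~ w).
have ms : measurable_fun setT s by exact: measurable_fun_limn_esup.
have mi : measurable_fun setT i.
  have -> : i = fun w => (- limn_esup (fun n => - ev n w))%E.
    by apply/funext => w; rewrite /i /limn_einf.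
  apply: measurableT_comp => //; apply: measurable_fun_limn_esup => n.
  exact: measurableT_comp.
pose C := [set w | s w = i w] `&` ([set w | s w != +oo%E] `&` [set w | s w != -oo%E]).
have mC : measurable C.
  apply: measurableI; last apply: measurableI.
  - by rewrite -[X in measurable X]setTI; exact: measurable_eqe.
  - by rewrite -[X in measurable X]setTI; exact: emeasurable_neq.
  - by rewrite -[X in measurable X]setTI; exact: emeasurable_neq.
have -> : (fun w => limn (fun n => v n w)) = (fun w => (fine (s w) * \1_C w)).
  apply/funext => w; have [Cw|Cw] := pselect (C w).
    rewrite indicE mem_set// mulr1; apply/cvg_lim => //.
    have [si [sy sNy]] := Cw.
    have sE : s w = (fine (s w))%:E by rewrite fineK// fin_numE sy sNy.
    by apply: (@limn_esup_einf_cvg (ev^~ w)); rewrite -?sE// -si.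
  rewrite indicE memNset// mulr0 /lim /lim_in xgetPN// => l vl.
  apply: Cw; have evl : ev ^~ w @ \oo --> l%:E.
    by apply: cvg_EFin; [exact: nearW|exact: vl].
  have [il sl] := cvg_limn_einf_sup evl.
  by split; [|split] => /=; rewrite /s /i sl ?il.
apply: measurable_funM; last exact: measurable_indic.
exact: measurableT_comp.
Qed.

End measurable_limits.

Section l2_space.
Context {d} {T : measurableType d} {R : realType} (P : probability T R).
Local Notation L := (Lfun P 2%:E).

Implicit Types F G H : T -> R.

Definition ip (F G : T -> R) : R := \int[P]_w (F w * G w).
Definition nrm (F : T -> R) : R := fine ('N[P]_2%:E[EFin \o F])%E.

Lemma L_measurable F : F \in L -> measurable_fun setT F.
Proof. by rewrite inE => /andP[/[!inE]]. Qed.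

Lemma nrmE F : F \in L -> (nrm F)%:E = ('N[P]_2%:E[EFin \o F])%E.
Proof.
rewrite inE => /andP[_ /[!inE]/=]; rewrite /finite_norm => h.
by rewrite fineK// ge0_fin_numE ?Lnorm_ge0.
Qed.

Lemma nrm_ge0 F : 0 <= nrm F. Proof. by rewrite fine_ge0// Lnorm_ge0. Qed.

Lemma Lnorm2E F :
  ('N[P]_2%:E[EFin \o F] `^ 2 = \int[P]_w ((F w) ^+ 2)%R%:E)%E.
Proof.
rewrite powR_Lnorm//; apply: eq_integral => w _ /=.
by rewrite powR_mulrn// real_normK ?num_real.
Qed.

Lemma nrm_sqE F : F \in L -> ((nrm F ^+ 2)%:E = \int[P]_w ((F w) ^+ 2)%R%:E)%E.
Proof. by move=> hF; rewrite -Lnorm2E -nrmE// poweR_EFin powR_mulrn// nrm_ge0. Qed.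

Lemma nrm_sq F : F \in L -> nrm F ^+ 2 = ip F F.
Proof. by move=> hF; rewrite /ip /Rintegral -[LHS]/(fine (_%:E)) nrm_sqE. Qed.

Lemma L_lt_pinfty F : measurable_fun setT F ->
  (\int[P]_w ((F w) ^+ 2)%R%:E < +oo)%E -> F \in L.
Proof.
move=> mF iF; rewrite inE; apply/andP; split; rewrite inE//=.
rewrite /finite_norm (@lty_poweRy _ _ 2)// Lnorm2E//.
Qed.

Lemma L_integrable_mul F G : F \in L -> G \in L ->
  P.-integrable setT (fun w => (F w * G w)%:E).
Proof. by move=> hF hG; have /Lfun1_integrable := Lfun2_mul_Lfun1 hF hG. Qed.

Lemma L_integrable F : F \in L -> P.-integrable setT (EFin \o F).
Proof.
move=> hF; have := L_integrable_mul hF (Lfun_cst P 1 2).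
by apply: eq_integrable => // w _; rewrite /= mulr1.
Qed.

Lemma L_dominated F G : measurable_fun setT F -> G \in L ->
  {ae P, forall w, `|F w| <= `|G w|} -> F \in L.
Proof.
move=> mF hG FG; apply: L_lt_pinfty => //.
apply: le_lt_trans (_ : (\int[P]_w ((G w) ^+ 2)%R%:E < +oo)%E).
  apply: ae_ge0_le_integral => //.
  - by move=> w _; rewrite lee_fin sqr_ge0.
  - by apply/measurable_EFinP; exact: measurable_funX.
  - by move=> w _; rewrite lee_fin sqr_ge0.
  - by apply/measurable_EFinP; apply: measurable_funX; exact: L_measurable.
  - apply: filterS FG => w /= FG _; rewrite lee_fin.
    by rewrite -(@real_normK _ (F w)) ?num_real// -(@real_normK _ (G w)) ?num_real// lerXn2r ?nnegrE.
by rewrite -nrm_sqE// ltry.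
Qed.

Lemma L_lin a F G : F \in L -> G \in L -> (fun w => a * F w + G w) \in L.
Proof. by have [_] := @Lfun_submod_closed _ T R P 2%:E (lee1n 2); exact. Qed.

Lemma L_cst c : (fun=> c) \in L. Proof. exact: Lfun_cst. Qed.

Lemma L_add F G : F \in L -> G \in L -> (fun w => F w + G w) \in L.
Proof.
move=> hF hG; have := L_lin 1 hF hG.
by rewrite (_ : (fun w => 1 * F w + G w) = fun w => F w + G w)//; apply/funext => w; rewrite mul1r.
Qed.

Lemma L_scale a F : F \in L -> (fun w => a * F w) \in L.
Proof.
move=> hF; have := L_lin a hF (L_cst 0).
by rewrite (_ : (fun w => a * F w + 0) = fun w => a * F w)//; apply/funext => w; rewrite addr0.
Qed.

Lemma L_sub F G : F \in L -> G \in L -> (fun w => F w - G w) \in L.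
Proof.
move=> hF hG; have := L_lin (-1) hG hF.
by rewrite (_ : (fun w => -1 * G w + F w) = fun w => F w - G w)//; apply/funext => w; rewrite mulN1r addrC.
Qed.

Lemma L_sum (I : Type) (r : seq I) (Q : pred I) (F : I -> T -> R) :
  (forall i, Q i -> F i \in L) -> (fun w => \sum_(i <- r | Q i) F i w) \in L.
Proof.
move=> hF; elim: r => [|i r ih].
  rewrite (_ : (fun w => _) = fun=> 0); first exact: L_cst.
  by apply/funext => w; rewrite big_nil.
have [Qi|Qi] := boolP (Q i).
  rewrite (_ : (fun w => _) = fun w => F i w + \sum_(j <- r | Q j) F j w).
    by apply: L_add => //; exact: hF.
  by apply/funext => w; rewrite big_cons Qi.
rewrite (_ : (fun w => _) = fun w => \sum_(j <- r | Q j) F j w)//.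
by apply/funext => w; rewrite big_cons (negbTE Qi).
Qed.

Lemma ipC F G : ip F G = ip G F.
Proof. by apply: eq_Rintegral => w _; rewrite mulrC. Qed.

Lemma ipDl F G H : F \in L -> G \in L -> H \in L ->
  ip (fun w => F w + G w) H = ip F H + ip G H.
Proof.
move=> hF hG hH; rewrite /ip; under eq_Rintegral do rewrite mulrDl.
by rewrite RintegralD//; exact: L_integrable_mul.
Qed.

Lemma ipBl F G H : F \in L -> G \in L -> H \in L ->
  ip (fun w => F w - G w) H = ip F H - ip G H.
Proof.
move=> hF hG hH; rewrite /ip; under eq_Rintegral do rewrite mulrBl.
by rewrite RintegralB//; exact: L_integrable_mul.
Qed.

Lemma ipZl a F G : F \in L -> G \in L -> ip (fun w => a * F w) G = a * ip F G.
Proof.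
move=> hF hG; rewrite /ip; under eq_Rintegral do rewrite -mulrA.
by rewrite RintegralZl//; exact: L_integrable_mul.
Qed.

Lemma ip_suml (I : Type) (r : seq I) (Q : pred I) (F : I -> T -> R) (G : T -> R) :
  (forall i, Q i -> F i \in L) -> G \in L ->
  ip (fun w => \sum_(i <- r | Q i) F i w) G = \sum_(i <- r | Q i) ip (F i) G.
Proof.
move=> hF hG; elim: r => [|i r ih].
  rewrite big_nil /ip; under eq_Rintegral do rewrite big_nil mul0r.
  by rewrite Rintegral_cst// mul0r.
rewrite big_cons; case: ifP => Qi.
  rewrite -ih -ipDl//; [|exact: hF|exact: L_sum].
  by apply: eq_Rintegral => w _; rewrite big_cons Qi.
by rewrite -ih; apply: eq_Rintegral => w _; rewrite big_cons Qi.
Qed.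

Lemma ae_eq_ip F F' G G' : F = F' %[ae P] -> G = G' %[ae P] ->
  measurable_fun setT F -> measurable_fun setT F' ->
  measurable_fun setT G -> measurable_fun setT G' -> ip F G = ip F' G'.
Proof.
move=> FF' GG' mF mF' mG mG'; rewrite /ip /Rintegral; congr fine.
apply: ae_eq_integral => //.
- by apply/measurable_EFinP; exact: measurable_funM.
- by apply/measurable_EFinP; exact: measurable_funM.
- near=> w => _; congr EFin; congr (_ * _).
  + by near: w; apply: filterS FF' => w; apply.
  + by near: w; apply: filterS GG' => w; apply.
Unshelve. all: by end_near. Qed.

Lemma ip_abs_le F G : F \in L -> G \in L ->
  \int[P]_w `|F w * G w| <= nrm F * nrm G.
Proof.
move=> hF hG; rewrite -lee_fin EFinM !nrmE//.
have := @hoelder _ T R P F G 2 2 (L_measurable hF) (L_measurable hG).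
move=> H; apply: le_trans (H _ _ _) => //; last by rewrite [RHS]splitr !div1r.
rewrite Lnorm1 /Rintegral fineK; last first.
  apply: integrable_fin_num => //.
  by apply: integrable_norm => //; exact: L_integrable_mul.
by rewrite le_eqVlt; apply/orP; left; apply/eqP; apply: eq_integral => w _.
Qed.

Lemma ip_CS F G : F \in L -> G \in L -> `|ip F G| <= nrm F * nrm G.
Proof.
move=> hF hG; apply: le_trans (ip_abs_le hF hG).
by apply: le_normr_Rintegral => //; exact: L_integrable_mul.
Qed.

Lemma nrm_triangle F G : F \in L -> G \in L ->
  nrm (fun w => F w + G w) <= nrm F + nrm G.
Proof.
move=> hF hG; rewrite -lee_fin EFinD !nrmE//; last exact: L_add.
by apply: eminkowski; [exact: L_measurable|exact: L_measurable|rewrite lee1n].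
Qed.

Lemma nrm_le F G : F \in L -> G \in L -> {ae P, forall w, `|F w| <= `|G w|} ->
  nrm F <= nrm G.
Proof.
move=> hF hG FG.
rewrite -(ler_pXn2r (isT : (0 < 2)%N)) ?nnegrE ?nrm_ge0// -lee_fin !nrm_sqE//.
apply: ae_ge0_le_integral => //.
- by move=> w _; rewrite lee_fin sqr_ge0.
- by apply/measurable_EFinP; apply: measurable_funX; exact: L_measurable.
- by move=> w _; rewrite lee_fin sqr_ge0.
- by apply/measurable_EFinP; apply: measurable_funX; exact: L_measurable.
- apply: filterS FG => w /= FG _; rewrite lee_fin.
  by rewrite -(@real_normK _ (F w)) ?num_real// -(@real_normK _ (G w)) ?num_real// lerXn2r ?nnegrE.
Qed.

Lemma nrmZ a F : F \in L -> nrm (fun w => a * F w) = `|a| * nrm F.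
Proof.
move=> hF; apply/eqP; rewrite -(@eqrXn2 _ 2) ?mulr_ge0 ?nrm_ge0//.
by rewrite exprMn real_normK ?num_real// !nrm_sq ?L_scale// ipZl ?L_scale// ipC ipZl// mulrA.
Qed.

Lemma nrm_distC F G : nrm (fun w => F w - G w) = nrm (fun w => G w - F w).
Proof.
rewrite /nrm; congr fine; rewrite -(oppe_Lnorm P (EFin \o (fun w => F w - G w))); congr (Lnorm _ _ _).
by apply/funext => w; rewrite /= opprB.
Qed.

Lemma nrm_eq0 F : F \in L -> nrm F = 0 -> F = (fun=> 0) %[ae P].
Proof.
move=> hF F0; have N0 : ('N[P]_2%:E[EFin \o F] = 0)%E by rewrite -nrmE// F0.
have mF : measurable_fun setT (EFin \o F) by exact/measurable_EFinP/L_measurable.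
have := Lnorm_eq0_eq0 mF _ N0; rewrite lte_fin => /(_ (ltr0n _ 2)).
by apply: filterS => w /(_ I) [].
Qed.

(** The filter is arbitrary because [J] is a limit along finite sets of tuples, whereas the other
    limits are along the integers. *)
Definition l2cvg {I} (u : I -> T -> R) (Fil : set_system I) (F : T -> R) :=
  forall e, 0 < e -> \forall i \near Fil, nrm (fun w => u i w - F w) < e.

Lemma l2cvg_ip {I} (Fil : set_system I) {FF : Filter Fil} (u v : I -> T -> R) F G :
  (forall i, u i \in L) -> (forall i, v i \in L) -> F \in L -> G \in L ->
  l2cvg u Fil F -> l2cvg v Fil G -> ip (u i) (v i) @[i --> Fil] --> ip F G.
Proof.
move=> hu hv hF hG uF vG; apply/cvgrPdist_lt => e e0.
pose M := nrm F + nrm G + 1.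
have M0 : 0 < M by rewrite /M addrC ltr_wpDr ?addr_ge0 ?nrm_ge0.
(* The bound by 1 keeps [nrm (v i)] below [nrm G + 1]; the other bound gives [e' * M <= e / 2]. *)
pose e' := Num.min 1 (e / (2 * M)).
have e'0 : 0 < e' by rewrite lt_min ltr01 divr_gt0// mulr_gt0.
near=> i.
have ui : nrm (fun w => u i w - F w) < e' by near: i; exact: uF.
have vi : nrm (fun w => v i w - G w) < e' by near: i; exact: vG.
have -> : ip F G - ip (u i) (v i) =
    - (ip (fun w => u i w - F w) (v i) + ip F (fun w => v i w - G w)).
  rewrite (ipBl (hu i) hF (hv i)) (ipC F (fun w => v i w - G w)) (ipBl (hv i) hG hF).
  by rewrite (ipC (v i) F) (ipC G F); ring.
rewrite normrN (le_lt_trans (ler_normD _ _))//.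
have vb : nrm (v i) <= nrm G + 1.
  have : nrm (v i) <= nrm (fun w => v i w - G w) + nrm G.
    rewrite (le_trans _ (nrm_triangle (L_sub (hv i) hG) hG))//.
    by under [X in _ <= nrm X]eq_fun do rewrite subrK.
  have : e' <= 1 by rewrite ge_min lexx.
  lra.
have h1 : `|ip (fun w => u i w - F w) (v i)| <= e' * (nrm G + 1).
  rewrite (le_trans (ip_CS _ _)) ?L_sub//.
  by rewrite ler_pM ?nrm_ge0// ltW.
have h2 : `|ip F (fun w => v i w - G w)| <= nrm F * e'.
  rewrite (le_trans (ip_CS _ _)) ?L_sub//.
  by rewrite ler_wpM2l ?nrm_ge0// ltW.
have : e' * M <= e / 2.
  have : e' <= e / (2 * M) by rewrite ge_min lexx orbT.
  rewrite -(ler_pM2r M0); congr (_ <= _).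
  by field; rewrite gt_eqF.
rewrite /M; lra.
Unshelve. all: by end_near. Qed.

End l2_space.

(** * Completeness of L^2 *)

Section completeness.
Context {d} {T : measurableType d} {R : realType} (P : probability T R).
Local Notation L := (Lfun P 2%:E).
Implicit Types F G H : T -> R.

Lemma nneseries_lty_cvg (a : nat -> R) : (forall k, 0 <= a k) ->
  (\sum_(k <oo) (a k)%:E < +oo)%E -> cvgn (series a).
Proof.
move=> a0 aoo; apply: nondecreasing_is_cvgn.
  by apply: nondecreasing_series => n _ _; exact: a0.
have fs : (\sum_(k <oo) (a k)%:E)%E \is a fin_num.
  by rewrite ge0_fin_numE// nneseries_ge0// => k _ _; rewrite lee_fin.
exists (fine (\sum_(k <oo) (a k)%:E)%E) => _ [n _ <-].
rewrite -lee_fin fineK// /series/= -sumEFin.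
by apply: nneseries_lim_ge => k _ _; rewrite lee_fin.
Qed.

Lemma limn_einf_le (u : (\bar R)^nat) (c : \bar R) K :
  (forall k, (K <= k)%N -> (u k <= c)%E) -> (limn_einf u <= c)%E.
Proof.
move=> uc; rewrite limn_einf_lim; apply: lime_le; first exact: is_cvg_einfs.
apply: nearW => m; apply: (@le_trans _ _ (u (maxn m K))).
  by apply: ereal_inf_lbound; exists (maxn m K) => //=; rewrite leq_maxl.
by apply: uc; rewrite leq_maxr.
Qed.

Lemma ae_nneseries_lty (f : nat -> T -> \bar R) :
  (forall k, measurable_fun setT (f k)) -> (forall k w, (0 <= f k w)%E) ->
  (\sum_(k <oo) \int[P]_w f k w < +oo)%E ->
  {ae P, forall w, (\sum_(k <oo) f k w < +oo)%E}.
Proof.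
move=> mf f0 foo.
have ms : measurable_fun setT (fun w => \sum_(k <oo) f k w)%E.
  by apply: ge0_emeasurable_sum => //.
have : P.-integrable setT (fun w => \sum_(k <oo) f k w)%E.
  apply/integrableP; split=> //.
  under eq_integral do rewrite gee0_abs ?nneseries_ge0//.
  by rewrite integral_nneseries.
move/(integrable_ae measurableT); apply: filterS => w /(_ I).
by rewrite ge0_fin_numE// nneseries_ge0.
Qed.

Lemma integral_abs_le_nrm F : F \in L -> (\int[P]_w `|F w|%:E <= (nrm P F)%:E)%E.
Proof.
move=> hF; have h1 : nrm P (fun=> 1) = 1.
  apply/eqP; rewrite -(@eqrXn2 _ 2) ?nrm_ge0// nrm_sq ?L_cst// expr1n /ip.
  by rewrite Rintegral_cst//= probability_setT mulr1 mul1r.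
have := ip_abs_le hF (L_cst P 1); rewrite h1 mulr1 -lee_fin /Rintegral fineK.
  by under eq_integral do rewrite mulr1.
apply: integrable_fin_num => //; apply: integrable_norm => //.
exact: L_integrable_mul (L_cst P 1).
Qed.

Variable S : set (set T).

(** The Riesz-Fischer theorem, with control of measurability: the limit is [limn] of a fixed
    subsequence, so it is measurable everywhere for the sigma-algebra generated by [S], and not
    merely equal almost surely to such a function. *)
Lemma l2_complete (u : nat -> T -> R) : (forall n, u n \in L) ->
  (forall n, measurable_fun [set: g_sigma_algebraType S] (u n)) ->
  (forall e, 0 < e -> exists N, forall m n, (N <= m)%N -> (N <= n)%N ->
    nrm P (fun w => u m w - u n w) < e) ->
  exists2 F, F \in L /\ measurable_fun [set: g_sigma_algebraType S] F &
    l2cvg P u \oo F.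
Proof.
move=> uL mu cu.
pose e k : R := 1 / (2 ^ (k + 1))%:R.
have e0 k : 0 < e k by rewrite divr_gt0// ltr0n expn_gt0.
have [N hN] := choice (fun k => cu _ (e0 k)).
(* Summing the thresholds makes the subsequence nondecreasing, with [n k] above both [N k] and
   [k]. *)
pose n k := (\sum_(j < k.+1) (N j).+1)%N.
have nN k : (N k <= n k)%N by rewrite /n big_ord_recr/= (leq_trans (leqnSn _))// leq_addl.
have nn k : (n k <= n k.+1)%N by rewrite [in leqRHS]/n big_ord_recr/= leq_addr.
pose v k := u (n k).
have kn k : (k <= n k)%N.
  by elim: k => // k /leq_ltn_trans; apply; rewrite /n [ltnRHS]big_ord_recr/= -addSnnS leq_addr.
have vL k : v k \in L by exact: uL.
have vlt k : nrm P (fun w => v k.+1 w - v k w) < e k.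
  by apply: hN; [rewrite (leq_trans (nN k))|].
pose a k w := `|v k.+1 w - v k w|.
have ma k : measurable_fun setT (fun w => (a k w)%:E).
  apply/measurable_EFinP; apply: measurableT_comp => //.
  by apply: measurable_funB; exact: L_measurable (vL _).
have : (\sum_(k <oo) \int[P]_w (a k w)%:E < +oo)%E.
  apply: (@le_lt_trans _ _ (\sum_(k <oo) (e k)%:E)%E).
    apply: lee_nneseries => [k _ _|k _]; first by apply: integral_ge0 => w _; rewrite lee_fin normr_ge0.
    apply: le_trans (integral_abs_le_nrm (L_sub (vL _) (vL _))) _.
    by rewrite lee_fin ltW.
  have /(cvg_lim (@ereal_hausdorff R)) h := @cvg_geometric_eseries_half R 1 0.
  suff -> : (\sum_(k <oo) (e k)%:E)%E = (1 / 2 ^+ 0)%:E by rewrite ltry.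
  exact: h.
move/(ae_nneseries_lty ma) => /(_ (fun k w => normr_ge0 _)) aea.
have vcvg : {ae P, forall w, v ^~ w @ \oo --> limn (v ^~ w)}.
  apply: filterS aea => w aw.
  have : cvgn (series (telescope (v ^~ w))).
    by apply: normed_cvg; apply: (@nneseries_lty_cvg (fun k => a k w)) => // k; exact: normr_ge0.
  rewrite telescopeK => vc; apply/cvg_ex.
  move/cvg_ex : vc => [l vl]; exists (l + v 0%N w).
  have vE : v ^~ w = (fun k => (v k w - v 0%N w) + v 0%N w).
    by apply/funext => k; rewrite subrK.
  by rewrite vE; exact: cvgD vl (cvg_cst (v 0%N w)).
pose F w := limn (v ^~ w).
have mF : measurable_fun setT F.
  by apply: measurable_fun_limn => k; exact: L_measurable.
have mF' : measurable_fun [set: g_sigma_algebraType S] F.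
  by apply: measurable_fun_limn => k; exact: mu.
(* Fatou's lemma along the subsequence turns the Cauchy bound between [v k] and [u m] into a bound
   between the pointwise limit and [u m]. *)
have key (c : R) : 0 < c -> exists K, forall m, (K <= m)%N ->
    (\int[P]_w ((F w - u m w) ^+ 2)%R%:E <= (c ^+ 2)%:E)%E.
  move=> c0; have [K hK] := cu c c0; exists K => m Km.
  pose f k w := ((v k w - u m w) ^+ 2)%:E.
  have mf k : measurable_fun setT (f k).
    apply/measurable_EFinP; apply: measurable_funX.
    by apply: measurable_funB; exact: L_measurable.
  have f0 k w : setT w -> (0 <= f k w)%E by rewrite lee_fin sqr_ge0.
  have limf : {ae P, forall w, limn_einf (f ^~ w) = ((F w - u m w) ^+ 2)%:E}.
    apply: filterS vcvg => w vw.
    have fw : f ^~ w @ \oo --> ((F w - u m w) ^+ 2)%:E.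
      apply: cvg_EFin; first exact: nearW.
      apply: (@cvg_comp _ _ _ (fun k => v k w - u m w) (fun x => x ^+ 2)).
        by apply: cvgB; [exact: vw|exact: cvg_cst].
      exact: exprn_continuous.
    by rewrite (cvg_limn_einf_sup fw).1.
  rewrite (_ : (\int[P]_w _)%E = \int[P]_w limn_einf (f ^~ w))%E; last first.
    apply: ae_eq_integral => //.
    - apply/measurable_EFinP; apply: measurable_funX.
      by apply: measurable_funB => //; exact: L_measurable.
    - under eq_fun do rewrite /limn_einf.
      apply: measurableT_comp => //; apply: measurable_fun_limn_esup => k.
      exact: measurableT_comp.
    - by apply: filterS limf => w ->.
  apply: (le_trans (fatou P measurableT mf f0)).
  apply: (@limn_einf_le _ _ K) => k Kk.
  rewrite -nrm_sqE ?L_sub// lee_fin lerXn2r ?nnegrE ?nrm_ge0//; first exact: ltW.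
  by rewrite ltW//; apply: hK => //; exact: leq_trans (kn k).
have FuL m : (\int[P]_w ((F w - u m w) ^+ 2)%R%:E < +oo)%E -> (fun w => F w - u m w) \in L.
  by move=> h; apply: L_lt_pinfty => //; apply: measurable_funB => //; exact: L_measurable.
have FL : F \in L.
  have [K /(_ K (leqnn _)) hK] := key 1 ltr01.
  have := L_add (FuL K (le_lt_trans hK (ltry _))) (uL K).
  by under [X in X \in _]eq_fun do rewrite subrK.
exists F => // c c0.
have c20 : 0 < c / 2 by rewrite divr_gt0.
have [K hK] := key _ c20; exists K => // m /= Km.
rewrite nrm_distC; apply: (@le_lt_trans _ _ (c / 2)); last by lra.
rewrite -(ler_pXn2r (isT : (0 < 2)%N)) ?nnegrE ?nrm_ge0 ?(ltW c20)//.
by rewrite -lee_fin nrm_sqE ?L_sub//; exact: hK.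
Qed.

End completeness.

(** * Independence of the signs and the Walsh functions *)

Section rademacher_independence.
Context {d} {T : measurableType d} {R : realType} {P : probability T R}.
Variables (p : nat -> R) (X : nat -> {RV P >-> R}).
Hypothesis hp : forall k, 0 < p k < 1.
Hypothesis hX1 : forall k, P (X k @^-1` [set 1]) = (p k)%:E.
Hypothesis hXN1 : forall k, P (X k @^-1` [set -1]) = (1 - p k)%:E.
Hypothesis hXind : mutually_independent X.
Local Notation L := (Lfun P 2%:E).

(** [X k] takes the values 1 and -1 only almost surely. Recording whether it equals 1 gives a
    boolean sequence at every point, so that cylinder functions can be handled without exceptional
    sets. *)
Definition signs (w : T) : nat -> bool := fun k => X k w == 1.

Definition pr (k : nat) (c : bool) : R := if c then p k else 1 - p k.

Definition depends_on (B : {pred nat}) (Phi : (nat -> bool) -> R) :=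
  forall x y : nat -> bool, {in B, x =1 y} -> Phi x = Phi y.

Definition upd (x : nat -> bool) k c : nat -> bool :=
  fun j => if j == k then c else x j.

Definition event (k : nat) (c : bool) : set T :=
  X k @^-1` (if c then [set 1] else ~` [set 1]).

Definition events (A : {fset nat}) (s : nat -> bool) : set T :=
  \bigcap_(k in [set` A]) event k (s k).

Let m1 c : measurable (if c then [set (1 : R)] else ~` [set 1]).
Proof. by case: c => //; exact: measurableC. Qed.

Lemma eventE k c w : event k c w <-> signs w k = c.
Proof.
rewrite /event /signs; case: c => /=; first by split=> [->|/eqP//]; rewrite eqxx.
by split=> [/eqP/negbTE//|/negbT/eqP].
Qed.

Lemma measurable_event k c : measurable (event k c).
Proof. by rewrite /event -[X in measurable X]setTI; exact: measurable_funPT. Qed.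

Lemma measurable_events A s : measurable (events A s).
Proof.
rewrite /events bigcap_fset; apply: bigsetI_measurable => k _.
exact: measurable_event.
Qed.

Lemma P_event k c : P (event k c) = (pr k c)%:E.
Proof.
rewrite /event /pr; case: c; first exact: hX1.
by rewrite -preimage_setC probability_setC ?hX1.
Qed.

Lemma P_events A s : P (events A s) = (\prod_(k <- A) pr k (s k))%:E.
Proof.
rewrite /events /event hXind//.
by rewrite -prodEFin; apply: eq_bigr => k _; rewrite -P_event.
Qed.

Lemma events_fsetU1 A s k c w : k \notin A ->
  events (k |` A)%fset (upd s k c) w <-> signs w k = c /\ events A s w.
Proof.
move=> kA; split=> [h|[kc h] j /=].
  split; first by apply/eventE; have := h k; rewrite /= fset1U1 /upd eqxx; apply.
  move=> j /= jA; have := h j; rewrite /= in_fset1U jA orbT /upd.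
  by case: eqP => [jk|_]; [move: kA; rewrite -jk jA|apply].
rewrite in_fset1U /upd; case: eqP => [-> _|_ /h//].
exact/eventE.
Qed.

Lemma depends_on_cyl (B : seq nat) Phi : depends_on [in B] Phi ->
  measurable_fun setT (Phi \o signs) /\ exists M, forall x, `|Phi x| <= M.
Proof.
elim: B Phi => [|k B ih] Phi dPhi.
  have PhiE x : Phi x = Phi (fun=> true) by exact: dPhi.
  split; last by exists `|Phi (fun=> true)| => x; rewrite PhiE.
  by rewrite (_ : _ \o _ = cst (Phi (fun=> true)))//; apply/funext => w /=.
have dc c : depends_on [in B] (fun x => Phi (upd x k c)).
  move=> x y xy; apply: dPhi => j; rewrite inE /upd.
  by case: eqP => //= _; exact: xy.
have [[mt [Mt ht]] [mf [Mf hf]]] := (ih _ (dc true), ih _ (dc false)).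
have PhiE x : Phi x = if x k then Phi (upd x k true) else Phi (upd x k false).
  case xk: (x k); apply: dPhi => j _; rewrite /upd; case: eqP => // ->//.
split; last first.
  exists (Num.max Mt Mf) => x; rewrite PhiE le_max.
  by case: (x k); rewrite ?ht ?hf ?orbT.
rewrite (_ : _ \o _ = fun w => if signs w k then Phi (upd (signs w) k true)
   else Phi (upd (signs w) k false)); last by apply/funext => w /=; rewrite -PhiE.
apply: measurable_fun_ifT => //.
apply: (@measurable_fun_bool _ _ _ _ true).
rewrite setTI (_ : _ @^-1` _ = event k true); first exact: measurable_event.
by apply/seteqP; split=> w h; exact/(eventE k true).
Qed.

Lemma depends_on_integrable (B : seq nat) Phi : depends_on [in B] Phi ->
  P.-integrable setT (EFin \o (Phi \o signs)).
Proof.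
move=> /depends_on_cyl[mPhi [M hM]].
apply: (@le_integrable _ _ _ P setT measurableT _ (fun=> M%:E)).
- exact/measurable_EFinP.
- move=> w _; rewrite /= lee_fin; apply: le_trans (hM _) _; exact: ler_norm.
- exact: finite_measure_integrable_cst.
Qed.

Lemma depends_on_L (B : seq nat) Phi : depends_on [in B] Phi ->
  Phi \o signs \in L.
Proof.
move=> /depends_on_cyl[mPhi [M hM]].
apply: (L_dominated mPhi (L_cst P M)); apply: aeW => w.
by apply: le_trans (hM _) _; exact: ler_norm.
Qed.

(** Independence is given for events; induction on [B] extends it to functions. Splitting the event
    on the sign of index [k] freezes that coordinate of [Phi] and moves [k] from [B] to [A], at the
    price of a factor [pr k c]. Taking [A] empty identifies [V] as the mean of [Phi]. *)
Lemma depends_on_indep (B : seq nat) Phi : uniq B -> depends_on [in B] Phi ->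
  exists V, forall A s, (forall k, k \in A -> k \notin B) ->
  \int[P]_(w in events A s) Phi (signs w) = V * \prod_(k <- A) pr k (s k).
Proof.
elim: B Phi => [|k B ih] Phi uB dPhi.
  have PhiE x : Phi x = Phi (fun=> true) by exact: dPhi.
  exists (Phi (fun=> true)) => A s _; under eq_Rintegral do rewrite PhiE.
  rewrite Rintegral_cst; last exact: measurable_events.
  by rewrite /= P_events.
move: uB => /= /andP[kB uB].
have dc c : depends_on [in B] (fun x => Phi (upd x k c)).
  move=> x y xy; apply: dPhi => j; rewrite inE /upd.
  by case: eqP => //= _; exact: xy.
have [Vt hVt] := ih _ uB (dc true).
have [Vf hVf] := ih _ uB (dc false).
exists (Vt * p k + Vf * (1 - p k)) => A s AB.
have kA : k \notin A by apply/negP => /AB; rewrite mem_head.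
have AkB c' j : j \in (k |` A)%fset -> j \notin B.
  rewrite in_fset1U => /predU1P[->//|/AB]; rewrite inE negb_or => /andP[]//.
have prE c : \prod_(j <- (k |` A)%fset) pr j (upd s k c j) = pr k c * \prod_(j <- A) pr j (s j).
  rewrite big_fsetU1//= /upd eqxx; congr (_ * _).
  by apply: eq_big_seq => j jA; case: eqP => // jk; move: kA; rewrite -jk jA.
have -> : events A s = (events (k |` A)%fset (upd s k true) `|` events (k |` A)%fset (upd s k false))%classic.
  apply/seteqP; split=> w.
    by case wk: (signs w k) => h; [left|right]; apply/events_fsetU1.
  by case=> /(events_fsetU1 _ _ _ kA)[].
rewrite Rintegral_setU.
- have e c : \int[P]_(w in events (k |` A)%fset (upd s k c)) Phi (signs w) =
      \int[P]_(w in events (k |` A)%fset (upd s k c)) Phi (upd (signs w) k c).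
    apply: eq_Rintegral => w; rewrite inE => /(events_fsetU1 _ _ _ kA)[kc _].
    by apply: dPhi => j _; rewrite /upd; case: eqP => // ->.
  rewrite !e hVt ?hVf ?prE//; last 2 first.
  + by move=> j; exact: (AkB true).
  + by move=> j; exact: (AkB true).
  by rewrite /pr; ring.
- exact: measurable_events.
- exact: measurable_events.
- apply: integrableS (depends_on_integrable dPhi) => //.
  by apply: measurableU; exact: measurable_events.
- apply/disj_setPS => w [] /(events_fsetU1 _ _ _ kA)[+ _] /(events_fsetU1 _ _ _ kA)[+ _].
  by move=> ->.
Qed.

Lemma expectation_sign (B : seq nat) Phi k (psi : bool -> R) :
    uniq B -> k \notin B -> depends_on [in B] Phi ->
  \int[P]_w (Phi (signs w) * psi (signs w k)) =
  \int[P]_w Phi (signs w) * (p k * psi true + (1 - p k) * psi false).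
Proof.
move=> uB kB dPhi; have [V hV] := depends_on_indep uB dPhi.
have e0 s : events fset0 s = setT.
  by apply/seteqP; split=> // w _ j.
have -> : \int[P]_w Phi (signs w) = V.
  have := hV fset0 (fun=> true); rewrite e0 big_seq_fset0 mulr1; apply.
  by move=> j.
have h1 c w : events [fset k]%fset (fun=> c) w <-> signs w k = c.
  split=> [/(_ k)|wk j /=]; rewrite /= inE ?eqxx => h; first exact/eventE/h.
  by rewrite (eqP h); exact/eventE.
have TE : [set: T] = (events [fset k]%fset (fun=> true) `|` events [fset k]%fset (fun=> false))%classic.
  apply/seteqP; split=> // w _.
  by case wk: (signs w k); [left|right]; apply/h1.
have iPhi := depends_on_integrable dPhi.
have e c : \int[P]_(w in events [fset k]%fset (fun=> c)) (Phi (signs w) * psi (signs w k)) =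
    V * pr k c * psi c.
  have -> : V * pr k c = \int[P]_(w in events [fset k]%fset (fun=> c)) Phi (signs w).
    by rewrite hV ?big_seq_fset1// => j; rewrite inE => /eqP->.
  rewrite -RintegralZr//; last 2 first.
  - exact: measurable_events.
  - by apply: integrableS iPhi => //; exact: measurable_events.
  by apply: eq_Rintegral => w; rewrite inE => /h1 ->.
rewrite TE Rintegral_setU.
- by rewrite !e /pr; ring.
- exact: measurable_events.
- exact: measurable_events.
- rewrite -TE; have [mPhi [M hM]] := depends_on_cyl dPhi.
  pose Psi x := Phi x * psi (x k).
  have : depends_on [in k :: B] Psi.
    move=> x y xy; rewrite /Psi (dPhi x y) ?(xy k) ?mem_head// => j jB.
    by apply: xy; rewrite inE jB orbT.
  exact: depends_on_integrable.
- by apply/disj_setPS => w [] /h1 + /h1 => ->.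
Qed.

End rademacher_independence.

(** * The Walsh functions *)

Section walsh_basis.
Context {d} {T : measurableType d} {R : realType} {P : probability T R}.
Variables (p : nat -> R) (X : nat -> {RV P >-> R}).
Hypothesis hp : forall k, 0 < p k < 1.
Hypothesis hX1 : forall k, P (X k @^-1` [set 1]) = (p k)%:E.
Hypothesis hXN1 : forall k, P (X k @^-1` [set -1]) = (1 - p k)%:E.
Hypothesis hXind : mutually_independent X.
Local Notation L := (Lfun P 2%:E).
Local Notation sgn := (signs X).
Local Notation Y := (Y p X).

Definition sd (k : nat) : R := Num.sqrt (p k * (1 - p k)).

Lemma sd_gt0 k : 0 < sd k.
Proof.
by have /andP[p0 p1] := hp k; rewrite sqrtr_gt0 mulr_gt0// subr_gt0.
Qed.

Lemma sd_sq k : sd k ^+ 2 = p k * (1 - p k).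
Proof.
by have /andP[/ltW p0 /ltW p1] := hp k; rewrite sqr_sqrtr// mulr_ge0// subr_ge0.
Qed.

Definition yval (k : nat) (c : bool) : R :=
  if c then (1 - p k) / sd k else - p k / sd k.

Lemma yval_mean k : p k * yval k true + (1 - p k) * yval k false = 0.
Proof. by rewrite /yval; ring. Qed.

Lemma yval_var k : p k * yval k true ^+ 2 + (1 - p k) * yval k false ^+ 2 = 1.
Proof.
rewrite /yval !expr_div_n sd_sq; have /andP[p0 p1] := hp k.
by field; rewrite subr_eq0 !gt_eqF.
Qed.

Lemma yvalB k : yval k true - yval k false = (sd k)^-1.
Proof. by rewrite /yval -mulrBl opprK subrK mul1r. Qed.

(** Both products reduce to [p k * (1 - p k) / sd k] up to sign. This is why averaging a function of
    [Y k] against [Y k] produces [sd k] times a difference of two values. *)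
Lemma pr_yval k c : pr p k c * yval k c = if c then sd k else - sd k.
Proof.
have s0 := sd_gt0 k; have := sd_sq k; rewrite /pr /yval => s2.
case: c; rewrite mulrA ?mulrN -?[(1 - _) * _]mulrC -?s2 ?mulNr expr2 mulfK// gt_eqF//.
Qed.

Lemma aeY k : {ae P, forall w, Y k w = yval k (sgn w k)}.
Proof.
exists (~` ((X k @^-1` [set 1]) `|` (X k @^-1` [set -1]))).
have mX c : measurable (X k @^-1` [set c]).
  by rewrite -[Y in measurable Y]setTI; exact: measurable_funPT.
split.
- by apply: measurableC; exact: measurableU.
- rewrite probability_setC; last exact: measurableU.
  rewrite measureU//.
    by rewrite /= hX1 hXN1 -EFinD (_ : p k + (1 - p k) = 1) ?subrr//; ring.
  apply/seteqP; split=> // w [/= ->] h.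
  by have : (1 : R) = -1 := h; lra.
- move=> w /= Yw; apply: contra_not Yw.
  have := sd_gt0 k; rewrite /Defs.Y /signs -/(sd k) => s0.
  case=> /= ->; first by rewrite eqxx /yval; field; rewrite gt_eqF.
  rewrite (_ : (-1 == 1 :> R) = false) /yval; first by field; rewrite gt_eqF.
  by apply/negbTE/eqP; lra.
Qed.

Lemma ae_Y : {ae P, forall w, forall k, Y k w = yval k (sgn w k)}.
Proof. by apply: (ae_foralln (mu := P)) => k; exact: aeY. Qed.

Definition wal (S : {fset nat}) (w : T) : R := \prod_(k <- S) Y k w.
(** The counterpart of [wal] on sign sequences. It depends on the signs in [S] alone, so the
    independence lemmas apply to it; it agrees with [wal] off a null set. *)
Definition walv (S : {fset nat}) (x : nat -> bool) : R := \prod_(k <- S) yval k (x k).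

Lemma wal_fset0 w : wal fset0 w = 1.
Proof. by rewrite /wal big_seq_fset0. Qed.

Lemma ae_wal S : {ae P, forall w, wal S w = walv S (sgn w)}.
Proof.
by apply: filterS ae_Y => w Yw; apply: eq_bigr => k _; rewrite Yw.
Qed.

Lemma walv_dep S : depends_on [in S] (walv S).
Proof. by move=> x y xy; apply: eq_big_seq => k kS; rewrite xy. Qed.

End walsh_basis.

Section walsh_orthonormal.
Context {d} {T : measurableType d} {R : realType} {P : probability T R}.
Variables (p : nat -> R) (X : nat -> {RV P >-> R}).
Hypothesis hp : forall k, 0 < p k < 1.
Hypothesis hX1 : forall k, P (X k @^-1` [set 1]) = (p k)%:E.
Hypothesis hXN1 : forall k, P (X k @^-1` [set -1]) = (1 - p k)%:E.
Hypothesis hXind : mutually_independent X.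
Local Notation L := (Lfun P 2%:E).
Local Notation sgn := (signs X).
Local Notation Y := (Y p X).
Local Notation wal := (wal p X).
Local Notation walv := (walv p).
Local Notation L2 := (L2 p X).

Lemma measurable_Y_sigma k :
  measurable_fun [set: g_sigma_algebraType (sigmaY p X)] (Y k).
Proof.
move=> _ B mB; rewrite setTI; apply: sub_sigma_algebra.
by exists k => //; exists B => //; rewrite setTI.
Qed.

Lemma measurable_wal_sigma S :
  measurable_fun [set: g_sigma_algebraType (sigmaY p X)] (wal S).
Proof. by apply: measurable_prod => k _; exact: measurable_Y_sigma. Qed.

Lemma measurable_Y k : measurable_fun setT (Y k).
Proof.
apply: measurable_funM => //; apply: measurable_funD => //.
exact: measurable_funB.
Qed.

Lemma measurable_wal S : measurable_fun setT (wal S).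
Proof. by apply: measurable_prod => k _; exact: measurable_Y. Qed.

Lemma ae_eq_L F G : measurable_fun setT F -> G \in L -> F = G %[ae P] -> F \in L.
Proof.
move=> mF GL FG; apply: (L_dominated mF GL).
by apply: filterS FG => w ->.
Qed.

Lemma walv_L S : walv S \o sgn \in L.
Proof. exact: depends_on_L (@walv_dep _ p S). Qed.

Lemma wal_L S : wal S \in L.
Proof.
apply: (ae_eq_L (measurable_wal S) (walv_L S)).
by apply: filterS (ae_wal hp hX1 hXN1 S) => w /= ->.
Qed.

Lemma wal_L2 S : L2 (wal S).
Proof. by split; [exact: wal_L|exact: measurable_wal_sigma]. Qed.

Lemma walv_fsetD1 S k x : k \in S -> walv S x = yval p k (x k) * walv (S `\ k)%fset x.
Proof. by move=> kS; rewrite /walv (big_fsetD1 k). Qed.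

Lemma walv_mul_dep (S S' : {fset nat}) : depends_on [in S ++ S'] (fun x => walv S x * walv S' x).
Proof.
move=> x y xy; congr (_ * _); apply: walv_dep => j jS; apply: xy;
  by rewrite mem_cat jS ?orbT.
Qed.

Lemma depends_on_undup (B : seq nat) (Phi : (nat -> bool) -> R) :
  depends_on [in B] Phi -> depends_on [in undup B] Phi.
Proof. by move=> dPhi x y xy; apply: dPhi => j jB; apply: xy; rewrite mem_undup. Qed.

Lemma ip_walE S S' : ip P (wal S) (wal S') = \int[P]_w (walv S (sgn w) * walv S' (sgn w)).
Proof.
apply: (ae_eq_ip (F' := walv S \o sgn) (G' := walv S' \o sgn)).
- by apply: filterS (ae_wal hp hX1 hXN1 S) => w /= ->.
- by apply: filterS (ae_wal hp hX1 hXN1 S') => w /= ->.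
- exact: measurable_wal.
- exact: L_measurable (walv_L S).
- exact: measurable_wal.
- exact: L_measurable (walv_L S').
Qed.

Lemma integral_walv S S' k (psi : bool -> R) : k \notin S -> k \notin S' ->
  \int[P]_w (walv S (sgn w) * walv S' (sgn w) * psi (sgn w k)) =
  \int[P]_w (walv S (sgn w) * walv S' (sgn w)) *
    (p k * psi true + (1 - p k) * psi false).
Proof.
move=> kS kS'; have dep := depends_on_undup (@walv_mul_dep S S').
apply: (expectation_sign hX1 hXind psi (undup_uniq _) _ dep).
by rewrite mem_undup mem_cat negb_or kS.
Qed.

Lemma ip_wal_neq S S' k : k \in S -> k \notin S' -> ip P (wal S) (wal S') = 0.
Proof.
move=> kS kS'; rewrite ip_walE.
have k' : k \notin (S `\ k)%fset by rewrite !inE eqxx.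
have := integral_walv (yval p k) k' kS'; rewrite yval_mean mulr0 => <-.
by apply: eq_Rintegral => w _; rewrite (walv_fsetD1 _ kS); ring.
Qed.

(** For equal sets, indices are removed one at a time, each contributing the variance 1. For
    different sets, some index lies in only one of them and contributes the mean 0. *)
Lemma ip_wal S S' : ip P (wal S) (wal S') = (S == S')%:R.
Proof.
have [<-{S'}|SS'] := eqVneq S S'.
  elim/finSet_rect: S => S ih; have [S0|[k kS]] := fset_0Vmem S.
    rewrite ip_walE S0; under eq_Rintegral do rewrite /walv big_seq_fset0 mulr1.
    by rewrite Rintegral_cst//= probability_setT mulr1.
  have k' : k \notin (S `\ k)%fset by rewrite !inE eqxx.
  rewrite -(ih _ (fproperD1 kS)) !ip_walE.
  have := integral_walv (fun c => yval p k c ^+ 2) k' k'; rewrite yval_var// mulr1 => <-.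
  by apply: eq_Rintegral => w _; rewrite (walv_fsetD1 _ kS); ring.
have [/fsubsetPn[k kS kS']|SsS'] := boolP (~~ (S `<=` S')%fset).
  exact: ip_wal_neq kS kS'.
have /fsubsetPn[k kS' kS] : ~~ (S' `<=` S)%fset.
  by apply: contra SS' => S'S; rewrite eqEfsubset S'S andbT -[X in is_true X]negbK.
by rewrite ipC; exact: ip_wal_neq kS' kS.
Qed.

(** An almost sure bound for [|Y k|], which makes multiplication by [Y k] a bounded operator on
    L^2. *)
Definition Ybound (k : nat) : R := `|yval p k true| + `|yval p k false|.

Lemma ae_Y_le k : {ae P, forall w, `|Y k w| <= Ybound k}.
Proof.
apply: filterS (aeY hp hX1 hXN1 k) => w ->.
by rewrite /Ybound; case: (sgn w k); rewrite (lerDl, lerDr).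
Qed.

Lemma Ybound_ge0 k : 0 <= Ybound k. Proof. exact: addr_ge0. Qed.

Lemma mulY_L k F : F \in L -> (fun w => Y k w * F w) \in L.
Proof.
move=> FL; have mF := L_measurable FL.
apply: (@L_dominated _ _ _ _ _ (fun w => Ybound k * F w)).
- exact: measurable_funM (measurable_Y k) mF.
- exact: L_scale.
- apply: filterS (ae_Y_le k) => w /= Yw.
  by rewrite normrM [leRHS]normrM (ger0_norm (Ybound_ge0 k)) ler_wpM2r.
Qed.

Lemma nrm_mulY k F : F \in L -> nrm P (fun w => Y k w * F w) <= Ybound k * nrm P F.
Proof.
move=> FL; have -> : Ybound k * nrm P F = nrm P (fun w => Ybound k * F w).
  by rewrite nrmZ// ger0_norm// Ybound_ge0.
apply: nrm_le; [exact: mulY_L|exact: L_scale|].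
apply: filterS (ae_Y_le k) => w /= Yw.
by rewrite normrM [leRHS]normrM (ger0_norm (Ybound_ge0 k)) ler_wpM2r.
Qed.

End walsh_orthonormal.

(** * Walsh coefficients *)

Section esum_fset.
Context {R : realType} {I : choiceType}.

Lemma fset_le_esum (B : {fset I}) (a : I -> \bar R) : (forall i, (0 <= a i)%E) ->
  (\sum_(i <- B) a i <= \esum_(i in [set: I]) a i)%E.
Proof.
move=> a0; apply: esum_ge; exists [set` B]; first by split.
by rewrite fsbig_finite//= set_fsetK.
Qed.

Lemma esum_le_fset (a : I -> \bar R) x :
  (forall B : {fset I}, (\sum_(i <- B) a i <= x)%E) ->
  (\esum_(i in [set: I]) a i <= x)%E.
Proof.
move=> ax; apply: ge_ereal_sup => _ [A [finA _] <-].
by rewrite fsbig_finite.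
Qed.

Lemma fset_sum_le (B B' : {fset I}) (a : I -> R) : (B `<=` B')%fset ->
  (forall i, 0 <= a i) -> \sum_(i <- B) a i <= \sum_(i <- B') a i.
Proof.
move=> BB' a0; rewrite [leRHS](big_fsetID _ (mem B))/=.
have -> : [fset x in B' | x \in B]%fset = B.
  by apply/fsetP => i; rewrite !inE; case: (boolP (i \in B)) => [/(fsubsetP BB')->|]; rewrite ?andbF.
by rewrite lerDl sumr_ge0.
Qed.

End esum_fset.

Section chaos_space.
Context {d} {T : measurableType d} {R : realType} {P : probability T R}.
Variables (p : nat -> R) (X : nat -> {RV P >-> R}).
Hypothesis hp : forall k, 0 < p k < 1.
Hypothesis hX1 : forall k, P (X k @^-1` [set 1]) = (p k)%:E.
Hypothesis hXN1 : forall k, P (X k @^-1` [set -1]) = (1 - p k)%:E.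
Hypothesis hXind : mutually_independent X.
Local Notation L := (Lfun P 2%:E).
Local Notation wal := (wal p X).
Local Notation L2 := (L2 p X).
Local Notation wal_L := (wal_L hp hX1 hXN1).
Local Notation wal_L2 := (wal_L2 hp hX1 hXN1).
Local Notation ip_wal := (ip_wal hp hX1 hXN1 hXind).
Local Notation ip := (ip P).
Local Notation nrm := (nrm P).
Implicit Types (F G H : T -> R) (S : {fset nat}) (B : {fset {fset nat}}).
Implicit Types (a c : {fset nat} -> R).

Lemma L2_L F : L2 F -> F \in L. Proof. by case. Qed.

Lemma L2_add F G : L2 F -> L2 G -> L2 (fun w => F w + G w).
Proof. by move=> [? ?] [? ?]; split; [exact: L_add|exact: measurable_funD]. Qed.

Lemma L2_scale (x : R) F : L2 F -> L2 (fun w => x * F w).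
Proof. by move=> [? ?]; split; [exact: L_scale|exact: measurable_funM]. Qed.

Lemma L2_sum (I : Type) (r : seq I) (Q : pred I) (F : I -> T -> R) :
  (forall i, Q i -> L2 (F i)) -> L2 (fun w => \sum_(i <- r | Q i) F i w).
Proof.
move=> hF; split; first by apply: L_sum => i /hF[].
have [r0|] := boolP true; last by [].
elim: r => [|i r ih].
  by rewrite (_ : (fun w => _) = cst 0)//; apply/funext => w; rewrite big_nil.
have [Qi|Qi] := boolP (Q i).
  rewrite (_ : (fun w => _) = fun w => F i w + \sum_(j <- r | Q j) F j w).
    by apply: measurable_funD => //; have [] := hF i Qi.
  by apply/funext => w; rewrite big_cons Qi.
rewrite (_ : (fun w => _) = fun w => \sum_(j <- r | Q j) F j w)//.
by apply/funext => w; rewrite big_cons (negbTE Qi).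
Qed.

Definition coef F S : R := ip F (wal S).

Lemma coef_fset0 F : coef F fset0 = \int[P]_w F w.
Proof. by apply: eq_Rintegral => w _; rewrite wal_fset0 mulr1. Qed.

Definition fpoly B a (w : T) : R := \sum_(S <- B) a S * wal S w.

Lemma fpoly_L2 B a : L2 (fpoly B a).
Proof. by apply: L2_sum => S _; apply: L2_scale; exact: wal_L2. Qed.

Lemma fpoly_L B a : fpoly B a \in L. Proof. exact: L2_L (fpoly_L2 _ _). Qed.

Lemma ip_fpoly B a F : F \in L -> ip (fpoly B a) F = \sum_(S <- B) a S * coef F S.
Proof.
move=> FL; rewrite ip_suml//; last by move=> S _; apply: L_scale; exact: wal_L.
by apply: eq_bigr => S _; rewrite ipZl ?wal_L// ipC.
Qed.

Lemma coef_wal S S' : coef (wal S) S' = (S == S')%:R.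
Proof. exact: ip_wal. Qed.

Lemma coef_fpoly B a S : coef (fpoly B a) S = if S \in B then a S else 0.
Proof.
rewrite /coef ip_fpoly ?wal_L//.
under eq_bigr do rewrite coef_wal.
case: ifP => SB.
  rewrite (big_fsetD1 S)//= eqxx mulr1 big_seq big1 ?addr0// => S'.
  by rewrite !inE => /andP[S'S _]; rewrite eq_sym (negbTE S'S) mulr0.
rewrite big_seq big1// => S' S'B; case: eqP => [e|_]; rewrite ?mulr0//.
by rewrite e S'B in SB.
Qed.

Lemma nrm_fpoly B a : nrm (fpoly B a) ^+ 2 = \sum_(S <- B) a S ^+ 2.
Proof.
rewrite nrm_sq ?fpoly_L// ip_fpoly ?fpoly_L//.
by apply: eq_big_seq => S SB; rewrite coef_fpoly SB expr2.
Qed.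

Lemma coefD F G S : F \in L -> G \in L -> coef (fun w => F w + G w) S = coef F S + coef G S.
Proof. by move=> FL GL; rewrite /coef ipDl ?wal_L. Qed.

Lemma coefB F G S : F \in L -> G \in L -> coef (fun w => F w - G w) S = coef F S - coef G S.
Proof. by move=> FL GL; rewrite /coef ipBl ?wal_L. Qed.

Lemma coefZ (x : R) F S : F \in L -> coef (fun w => x * F w) S = x * coef F S.
Proof. by move=> FL; rewrite /coef ipZl ?wal_L. Qed.

Lemma coef_sum (I : Type) (r : seq I) (Q : pred I) (F : I -> T -> R) S :
  (forall i, Q i -> F i \in L) ->
  coef (fun w => \sum_(i <- r | Q i) F i w) S = \sum_(i <- r | Q i) coef (F i) S.
Proof. by move=> FL; rewrite /coef ip_suml ?wal_L. Qed.

(** Sets may be repeated in the list, so a linear combination of two such sums is a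
    concatenation. *)
Definition wsum (r : seq (R * {fset nat})) (w : T) : R := \sum_(x <- r) x.1 * wal x.2 w.

Lemma wsum_L2 r : L2 (wsum r).
Proof. by apply: L2_sum => x _; apply: L2_scale; exact: wal_L2. Qed.

Lemma fpoly_wsum B a : fpoly B a = wsum [seq (a U, U) | U <- enum_fset B].
Proof. by apply/funext => w; rewrite /wsum big_map. Qed.

(* The closed span of the Walsh functions. *)
Definition inH F := L2 F /\ forall e, 0 < e -> exists r, nrm (fun w => F w - wsum r w) < e.

Lemma inH_L2 F : inH F -> L2 F. Proof. by case. Qed.
Lemma inH_L F : inH F -> F \in L. Proof. by case=> /L2_L. Qed.

Lemma nrm_sub_self F : F \in L -> nrm (fun w => F w - F w) = 0.
Proof.
move=> FL; apply/eqP; rewrite -sqrf_eq0 nrm_sq; last exact: L_sub.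
by rewrite ipBl ?subrr//; exact: L_sub.
Qed.

Lemma inH_wsum r : inH (wsum r).
Proof.
split; first exact: wsum_L2.
by move=> e e0; exists r; rewrite nrm_sub_self//; exact: L2_L (wsum_L2 r).
Qed.

Lemma inH_fpoly B a : inH (fpoly B a).
Proof. by rewrite fpoly_wsum; exact: inH_wsum. Qed.

Lemma inH_wal S : inH (wal S).
Proof.
rewrite (_ : wal S = wsum [:: (1, S)]); first exact: inH_wsum.
by apply/funext => w; rewrite /wsum big_seq1 mul1r.
Qed.

Lemma nrm_sub_triangle F G H : F \in L -> G \in L -> H \in L ->
  nrm (fun w => F w - H w) <= nrm (fun w => F w - G w) + nrm (fun w => G w - H w).
Proof.
move=> FL GL HL; rewrite (_ : (fun w => F w - H w) = fun w => (F w - G w) + (G w - H w)).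
  by apply: nrm_triangle; exact: L_sub.
by apply/funext => w; rewrite addrA subrK.
Qed.

Lemma inH_l2cvg {I} (u : I -> T -> R) (Fil : set_system I) {FF : ProperFilter Fil} F :
  (forall i, inH (u i)) -> L2 F -> l2cvg P u Fil F -> inH F.
Proof.
move=> uH F2 uF; split=> // e e0; have e20 : 0 < e / 2 by rewrite divr_gt0.
have [i ui] := filter_ex (uF _ e20).
have [r hr] := (uH i).2 _ e20; exists r.
have := nrm_sub_triangle (L2_L F2) (inH_L (uH i)) (L2_L (wsum_L2 r)).
rewrite nrm_distC in ui; lra.
Qed.

Lemma coef_l2cvg {I} (u : I -> T -> R) (Fil : set_system I) {FF : ProperFilter Fil} F S (x : R) :
  (forall i, u i \in L) -> F \in L -> l2cvg P u Fil F ->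
  (\forall i \near Fil, coef (u i) S = x) -> coef F S = x.
Proof.
move=> uL FL uF uc.
have cW : l2cvg P (fun=> wal S) Fil (wal S).
  by move=> e e0; apply: nearW => i; rewrite nrm_sub_self// wal_L.
have FF1 : Filter Fil by apply: filter_filter.
have h := @l2cvg_ip _ _ _ _ _ _ FF1 _ _ _ _ uL (fun=> wal_L S) FL (wal_L S) uF cW.
rewrite /coef -(cvg_lim (@Rhausdorff R) h); apply/cvg_lim => //.
exact: cvg_near_cst.
Qed.

Lemma inH_comb (x : R) F G : inH F -> inH G -> inH (fun w => x * F w + G w).
Proof.
move=> hF hG; split.
  by apply: L2_add; [apply: L2_scale|]; exact: inH_L2.
move=> e e0; pose e' := e / (`|x| + 1).
have x1 : 0 < `|x| + 1 by rewrite ltr_wpDl.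
have e'0 : 0 < e' by rewrite divr_gt0.
have [r hr] := hF.2 _ e'0; have [r' hr'] := hG.2 _ e'0.
exists ([seq (x * y.1, y.2) | y <- r] ++ r').
have FL := inH_L hF; have GL := inH_L hG.
have rL := L2_L (wsum_L2 r); have r'L := L2_L (wsum_L2 r').
rewrite (_ : (fun w => _) = fun w => x * (F w - wsum r w) + (G w - wsum r' w)); last first.
  apply/funext => w; rewrite /wsum big_cat big_map/=.
  under [X in _ - (X + _)]eq_bigr do rewrite -mulrA.
  by rewrite -mulr_sumr; ring.
apply: le_lt_trans (nrm_triangle (L_scale _ (L_sub FL rL)) (L_sub GL r'L)) _.
rewrite nrmZ; last exact: L_sub.
have -> : e = `|x| * e' + e' by rewrite /e'; field; rewrite gt_eqF.
by rewrite ler_ltD// ler_wpM2l// ltW.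
Qed.

Lemma inH_sub F G : inH F -> inH G -> inH (fun w => F w - G w).
Proof.
move=> hF hG; have := inH_comb (-1) hG hF.
by rewrite (_ : (fun w => -1 * G w + F w) = fun w => F w - G w)//; apply/funext => w; ring.
Qed.

Lemma inH_cst0 : inH (fun=> 0).
Proof.
rewrite (_ : (fun=> 0) = wsum [::]); first exact: inH_wsum.
by apply/funext => w; rewrite /wsum big_nil.
Qed.

Lemma inH_scale (x : R) F : inH F -> inH (fun w => x * F w).
Proof.
move=> hF; have := inH_comb x hF inH_cst0.
by rewrite (_ : (fun w => x * F w + 0) = fun w => x * F w)//; apply/funext => w; ring.
Qed.

Lemma inH_add F G : inH F -> inH G -> inH (fun w => F w + G w).
Proof.
move=> hF hG; have := inH_comb 1 hF hG.
by rewrite (_ : (fun w => 1 * F w + G w) = fun w => F w + G w)//; apply/funext => w; ring.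
Qed.

Lemma inH_sum (I : Type) (r : seq I) (Q : pred I) (F : I -> T -> R) :
  (forall i, Q i -> inH (F i)) -> inH (fun w => \sum_(i <- r | Q i) F i w).
Proof.
move=> hF; elim: r => [|i r ih].
  by rewrite (_ : (fun w => _) = fun=> 0); [exact: inH_cst0|apply/funext => w; rewrite big_nil].
have [Qi|Qi] := boolP (Q i).
  rewrite (_ : (fun w => _) = fun w => F i w + \sum_(j <- r | Q j) F j w).
    by apply: inH_add => //; exact: hF.
  by apply/funext => w; rewrite big_cons Qi.
rewrite (_ : (fun w => _) = fun w => \sum_(j <- r | Q j) F j w)//.
by apply/funext => w; rewrite big_cons (negbTE Qi).
Qed.

Lemma nrm_pythagoras F G : F \in L -> G \in L -> ip F G = 0 ->
  nrm (fun w => F w + G w) ^+ 2 = nrm F ^+ 2 + nrm G ^+ 2.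
Proof.
move=> FL GL FG; have FGL := L_add FL GL; rewrite !nrm_sq// (ipDl FL GL FGL).
rewrite (ipC P F (fun w => F w + G w)) (ipC P G (fun w => F w + G w)).
by rewrite (ipDl FL GL FL) (ipDl FL GL GL) (ipC P G F) FG addr0 add0r.
Qed.

Lemma nrm_proj F B : F \in L ->
  nrm F ^+ 2 = nrm (fun w => F w - fpoly B (coef F) w) ^+ 2 + \sum_(S <- B) coef F S ^+ 2.
Proof.
move=> FL; have BL := fpoly_L B (coef F); rewrite -nrm_fpoly -nrm_pythagoras//.
- by congr (nrm _ ^+ 2); apply/funext => w; rewrite subrK.
- exact: L_sub.
- rewrite ipC ip_fpoly ?L_sub// big_seq big1// => S SB.
  by rewrite coefB// coef_fpoly SB subrr mulr0.
Qed.

Lemma bessel F B : F \in L -> \sum_(S <- B) coef F S ^+ 2 <= nrm F ^+ 2.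
Proof. by move=> FL; rewrite (nrm_proj B FL) lerDr sqr_ge0. Qed.

(** The orthogonal projection onto the Walsh functions that occur in an approximating [wsum r] is at
    least as close to [F] as [wsum r] itself. This is the converse half of Bessel's inequality. *)
Lemma inH_approx F e : inH F -> 0 < e ->
  exists B, nrm F ^+ 2 <= \sum_(S <- B) coef F S ^+ 2 + e.
Proof.
move=> hF e0; have se0 : 0 < Num.sqrt e by rewrite sqrtr_gt0.
have [r hr] := hF.2 _ se0; have FL := inH_L hF; have rL := L2_L (wsum_L2 r).
pose B := [fset x.2 | x in r]%fset; exists B.
rewrite (nrm_proj B FL) addrC lerD2l -(sqr_sqrtr (ltW e0)).
have BL := fpoly_L B (coef F).
pose G w := F w - fpoly B (coef F) w.
pose Q w := fpoly B (coef F) w - wsum r w.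
have GL : G \in L by exact: L_sub.
have QL : Q \in L by exact: L_sub.
have G0 S : S \in B -> coef G S = 0 by move=> SB; rewrite coefB// coef_fpoly SB subrr.
have GQ : ip G Q = 0.
  rewrite ipC ipBl// ip_fpoly// big_seq big1 ?sub0r; last by move=> S /G0->; rewrite mulr0.
  rewrite /wsum ip_suml//; last by move=> x _; apply: L_scale; exact: wal_L.
  rewrite big_seq big1 ?oppr0// => x xr; rewrite ipZl ?wal_L// ipC -/(coef _ _) G0 ?mulr0//.
  by apply/imfsetP; exists x.
have := nrm_pythagoras GL QL GQ.
rewrite (_ : (fun w => G w + Q w) = fun w => F w - wsum r w); last first.
  by apply/funext => w; rewrite /G /Q; ring.
move=> e1; apply: (@le_trans _ _ (nrm (fun w => F w - wsum r w) ^+ 2)).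
  by rewrite e1 lerDl sqr_ge0.
by rewrite lerXn2r ?nnegrE ?nrm_ge0 ?sqrtr_ge0// ltW.
Qed.

Lemma parseval F : inH F ->
  ((nrm F ^+ 2)%:E = \esum_(S in [set: {fset nat}]) (coef F S ^+ 2)%:E)%E.
Proof.
move=> hF; apply/eqP; rewrite eq_le; apply/andP; split; last first.
  apply: esum_le_fset => B; rewrite sumEFin lee_fin.
  exact/bessel/inH_L.
apply/lee_addgt0Pr => e e0; have [B hB] := inH_approx hF e0.
apply: (@le_trans _ _ (\sum_(S <- B) coef F S ^+ 2 + e)%:E); first by rewrite lee_fin.
rewrite EFinD leeD2r// -sumEFin; apply: fset_le_esum => S.
by rewrite lee_fin sqr_ge0.
Qed.

Lemma inH_eq F G : inH F -> inH G -> (forall S, coef F S = coef G S) -> F = G %[ae P].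
Proof.
move=> hF hG FG; have FL := inH_L hF; have GL := inH_L hG.
have : nrm (fun w => F w - G w) = 0.
  apply/eqP; rewrite -sqrf_eq0 -eqe parseval; last exact: inH_sub.
  apply/eqP; apply: esum1 => S _; rewrite coefB// FG subrr expr0n//.
move=> /(nrm_eq0 (L_sub FL GL)); apply: filterS => w /= /[apply].
exact: subr0_eq.
Qed.

Lemma ae_eq_coef F G S : F \in L -> G \in L -> F = G %[ae P] -> coef F S = coef G S.
Proof.
move=> FL GL FG; have mW := L_measurable (wal_L S).
apply: (ae_eq_ip FG _ (L_measurable FL) (L_measurable GL) mW mW).
exact: aeW.
Qed.

Definition l2coefs c := (\esum_(S in [set: {fset nat}]) (c S ^+ 2)%:E < +oo)%E.

(** [B] is chosen to carry all of the square sum of [c] but [e ^+ 2 / 2]; Parseval bounds [F] by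
    what remains. The estimate is uniform in [F]. *)
Lemma tail_l2coefs c e : l2coefs c -> 0 < e -> exists B, forall F, inH F ->
  (forall S, `|coef F S| <= `|c S|) -> (forall S, S \in B -> coef F S = 0) -> nrm F < e.
Proof.
move=> cfin e0; have c0 S : (0 <= (c S ^+ 2)%:E)%E by rewrite lee_fin sqr_ge0.
rewrite /l2coefs in cfin; set s := (\esum_(U in _) _)%E in cfin.
have sfin : s \is a fin_num by rewrite ge0_fin_numE// esum_ge0.
have e20 : 0 < e ^+ 2 / 2 by rewrite divr_gt0// exprn_gt0.
have [B hB] : exists B, fine s - e ^+ 2 / 2 < \sum_(S <- B) c S ^+ 2.
  apply/not_existsP => h; have : (s <= (fine s - e ^+ 2 / 2)%:E)%E.
    apply: esum_le_fset => B; rewrite sumEFin lee_fin leNgt; apply/negP; exact: h.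
  by rewrite -[X in (X <= _)%E](fineK sfin) lee_fin; lra.
exists B => F hF Fc FB.
rewrite -(ltr_pXn2r (isT : (0 < 2)%N)) ?nnegrE ?nrm_ge0 ?(ltW e0)//.
apply: (@le_lt_trans _ _ (e ^+ 2 / 2)); last by have := exprn_gt0 2 e0; lra.
rewrite -lee_fin parseval//; apply: esum_le_fset => A; rewrite sumEFin lee_fin.
have : \sum_(S <- (A `|` B)%fset) c S ^+ 2 <= fine s.
  by rewrite -lee_fin fineK// -sumEFin; exact: fset_le_esum.
pose cB S : R := if S \in B then c S ^+ 2 else 0.
pose cN S : R := if S \in B then 0 else c S ^+ 2.
have -> : \sum_(S <- (A `|` B)%fset) c S ^+ 2 =
    \sum_(S <- (A `|` B)%fset) cB S + \sum_(S <- (A `|` B)%fset) cN S.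
  rewrite -big_split; apply: eq_bigr => S _ /=.
  by rewrite /cB /cN; case: ifP; rewrite ?addr0 ?add0r.
have hBsum : \sum_(S <- B) c S ^+ 2 <= \sum_(S <- (A `|` B)%fset) cB S.
  have -> : \sum_(S <- B) c S ^+ 2 = \sum_(S <- B) cB S.
    by apply: eq_big_seq => S SB; rewrite /cB SB.
  apply: fset_sum_le; first exact: fsubsetUr.
  by move=> S; rewrite /cB; case: ifP => // _; exact: sqr_ge0.
have hAsum : \sum_(S <- A) coef F S ^+ 2 <= \sum_(S <- (A `|` B)%fset) cN S.
  apply: (@le_trans _ _ (\sum_(S <- A) cN S)).
    apply: ler_sum => S _; rewrite /cN; case: ifP => [/FB->|_]; first by rewrite expr0n.
    by rewrite -(@real_normK _ (coef F S)) ?num_real// -(@real_normK _ (c S)) ?num_real// lerXn2r ?nnegrE.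
  apply: fset_sum_le; first exact: fsubsetUl.
  by move=> S; rewrite /cN; case: ifP => // _; exact: sqr_ge0.
by lra.
Qed.

Lemma l2cvg0_coef {I} (Fil : set_system I) {FF : Filter Fil} (D : I -> T -> R) c :
  l2coefs c -> (forall i, inH (D i)) -> (forall i S, `|coef (D i) S| <= `|c S|) ->
  (forall S, \forall i \near Fil, coef (D i) S = 0) ->
  forall e, 0 < e -> \forall i \near Fil, nrm (D i) < e.
Proof.
move=> cfin hD Dc D0 e e0; have [B hB] := tail_l2coefs cfin e0.
have : \forall i \near Fil, forall S, S \in B -> coef (D i) S = 0.
  have : \forall i \near Fil, forall S, S \in enum_fset B -> coef (D i) S = 0.
    elim: (enum_fset B) => [|S0 s ih]; first by apply: nearW => i S.
    apply: filterS2 (D0 S0) ih => i h0 ih S; rewrite inE => /predU1P[->//|]; exact: ih.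
  by apply: filterS => i h S SB; exact: h.
by apply: filterS => i Di; apply: hB.
Qed.

(** A dominated convergence criterion on coefficients. Asking each coefficient to be eventually
    equal to its limit, rather than to converge, suits truncations and partial sums, whose
    coefficients become stationary. *)
Lemma l2cvg_coef {I} (Fil : set_system I) {FF : Filter Fil} (u : I -> T -> R) F c :
  l2coefs c -> inH F -> (forall i, inH (u i)) ->
  (forall i S, `|coef (u i) S - coef F S| <= `|c S|) ->
  (forall S, \forall i \near Fil, coef (u i) S = coef F S) -> l2cvg P u Fil F.
Proof.
move=> cfin hF hu uc u0; apply: (l2cvg0_coef cfin (D := fun i w => u i w - F w)).
- by move=> i; exact: inH_sub.
- by move=> i S; rewrite coefB ?inH_L.
- move=> S; apply: filterS (u0 S) => i e.
  by rewrite coefB ?inH_L// e subrr.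
Qed.

Lemma l2coefs_coef F : inH F -> l2coefs (coef F).
Proof. by move=> hF; rewrite /l2coefs -parseval// ltry. Qed.

Lemma l2coefs_le c c' : (forall S, `|c S| <= `|c' S|) -> l2coefs c' -> l2coefs c.
Proof.
move=> cc'; apply: le_lt_trans; apply: le_esum => S _; rewrite lee_fin.
by rewrite -(@real_normK _ (c S)) ?num_real// -(@real_normK _ (c' S)) ?num_real// lerXn2r ?nnegrE.
Qed.

(** All subsets of the first [N] indices: every finite set is eventually a member, and a polynomial
    over [box N] depends on the first [N] signs only. *)
Definition box N : {fset {fset nat}} := fpowerset [fset i in iota 0 N]%fset.

Lemma in_boxP N S : reflect (forall j, j \in S -> (j < N)%N) (S \in box N).
Proof.
rewrite /box fpowersetE; apply: (iffP idP) => [/fsubsetP h j /h|h].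
  by rewrite !inE mem_iota.
by apply/fsubsetP => j /h jN; rewrite !inE mem_iota.
Qed.

Lemma near_box S : \forall N \near \oo, S \in box N.
Proof.
exists (\max_(j <- S) j).+1 => // N /= SN; apply/in_boxP => j jS.
by apply: leq_ltn_trans SN; exact: (@leq_bigmax_seq _ _ xpredT id).
Qed.

(** The truncations to [box N] are Cauchy by [tail_l2coefs]. This supplies the existence of the
    limits behind [J], [D] and [Linv], and the part of [F] that is free of one coordinate. *)
Lemma inH_exists c : l2coefs c -> exists2 F, inH F & forall S, coef F S = c S.
Proof.
move=> cfin; pose u N := fpoly (box N) c.
have uL N : u N \in L by exact: fpoly_L.
have [||F [FL Fs] uF] := @l2_complete _ _ _ P (sigmaY p X) u uL.
- by move=> N; have [] := fpoly_L2 (box N) c.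
- move=> e e0; have [B hB] := tail_l2coefs cfin e0.
  have : \forall N \near \oo, forall S, S \in enum_fset B -> S \in box N.
    elim: (enum_fset B) => [|S0 s ih]; first by apply: nearW => i S.
    apply: filterS2 (near_box S0) ih => i h0 ih S; rewrite inE => /predU1P[->//|]; exact: ih.
  case=> N _ hN; exists N => m n Nm Nn; apply: hB.
  + by apply: inH_sub; exact: inH_fpoly.
  + move=> S; rewrite coefB// !coef_fpoly; case: ifP => _; case: ifP => _;
      by rewrite ?subrr ?subr0 ?sub0r ?normrN ?normr0.
  + by move=> S SB; rewrite coefB// !coef_fpoly (hN m Nm S SB) (hN n Nn S SB) subrr.
have F2 : L2 F by split.
exists F; first by apply: (inH_l2cvg (u := u)) uF => // N; exact: inH_fpoly.
move=> S; apply: (coef_l2cvg uL FL uF).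
by apply: filterS (near_box S) => N SN; rewrite coef_fpoly SN.
Qed.

Lemma fpoly_box_l2cvg F : inH F -> l2cvg P (fun N => fpoly (box N) (coef F)) \oo F.
Proof.
move=> hF; apply: (l2cvg_coef (l2coefs_coef hF)) => //.
- by move=> N; exact: inH_fpoly.
- move=> N S; rewrite coef_fpoly; case: ifP => _.
    by rewrite subrr normr0.
  by rewrite sub0r normrN.
- by move=> S; apply: filterS (near_box S) => N SN; rewrite coef_fpoly SN.
Qed.

End chaos_space.

(** * Integration by parts in one coordinate *)

Section l2cvg_theory.
Context {d} {T : measurableType d} {R : realType} (P : probability T R).
Local Notation L := (Lfun P 2%:E).
Implicit Types F G H : T -> R.
Context {I : Type} {Fil : set_system I} {FF : Filter Fil}.
Implicit Types u v : I -> T -> R.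

Lemma l2cvg_le u v F G (K : R) : 0 <= K ->
  (forall i, nrm P (fun w => v i w - G w) <= K * nrm P (fun w => u i w - F w)) ->
  l2cvg P u Fil F -> l2cvg P v Fil G.
Proof.
move=> K0 h uF e e0; have K1 : 0 < K + 1 by rewrite ltr_wpDl.
apply: filterS (uF _ (divr_gt0 e0 K1)) => i ui; apply: le_lt_trans (h i) _.
rewrite (le_lt_trans (ler_wpM2l K0 (ltW ui)))// mulrCA gtr_pMr// ltr_pdivrMr// mul1r ltrDl//.
Qed.

Lemma l2cvg_add u v F G : (forall i, u i \in L) -> (forall i, v i \in L) ->
  F \in L -> G \in L -> l2cvg P u Fil F -> l2cvg P v Fil G ->
  l2cvg P (fun i w => u i w + v i w) Fil (fun w => F w + G w).
Proof.
move=> uL vL FL GL uF vG e e0; have e20 : 0 < e / 2 by rewrite divr_gt0.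
apply: filterS2 (uF _ e20) (vG _ e20) => i ui vi.
rewrite (_ : (fun w => _) = fun w => (u i w - F w) + (v i w - G w)); last first.
  by apply/funext => w; ring.
by have := nrm_triangle (L_sub (uL i) FL) (L_sub (vL i) GL); lra.
Qed.

Lemma l2cvg_scale (x : R) u F : (forall i, u i \in L) -> F \in L ->
  l2cvg P u Fil F -> l2cvg P (fun i w => x * u i w) Fil (fun w => x * F w).
Proof.
move=> uL FL; apply: (l2cvg_le (normr_ge0 x)) => i.
rewrite (_ : (fun w => _) = fun w => x * (u i w - F w)); last first.
  by apply/funext => w; ring.
by rewrite nrmZ// L_sub.
Qed.

Lemma l2cvg_sub u v F G : (forall i, u i \in L) -> (forall i, v i \in L) ->
  F \in L -> G \in L -> l2cvg P u Fil F -> l2cvg P v Fil G ->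
  l2cvg P (fun i w => u i w - v i w) Fil (fun w => F w - G w).
Proof.
move=> uL vL FL GL uF vG e e0; have e20 : 0 < e / 2 by rewrite divr_gt0.
apply: filterS2 (uF _ e20) (vG _ e20) => i ui vi.
rewrite (_ : (fun w => _) = fun w => (u i w - F w) + (G w - v i w)); last first.
  by apply/funext => w; ring.
have := nrm_triangle (L_sub (uL i) FL) (L_sub GL (vL i)).
by rewrite (nrm_distC P G); lra.
Qed.

Section lipschitz.
Variables (g : R -> R) (K : R).
Hypothesis K0 : 0 <= K.
Hypothesis gK : forall x y, `|g x - g y| <= K * `|x - y|.

Lemma lipschitz_continuous : continuous g.
Proof.
move=> x; apply/cvgrPdist_lt => e e0.
have K1 : 0 < K + 1 by rewrite ltr_wpDl.
have : \forall y \near x, `|x - y| < e / (K + 1).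
  have /cvgrPdist_lt := @cvg_id _ (nbhs x).
  by apply; exact: divr_gt0.
apply: filterS => y; rewrite ltr_pdivlMr// => h.
rewrite (le_lt_trans (gK _ _))//; apply: le_lt_trans h.
by rewrite mulrC ler_wpM2l// lerDl.
Qed.

Lemma L_lipschitz F : F \in L -> (fun w => g (F w)) \in L.
Proof.
move=> FL; apply: (@L_dominated _ _ _ P _ (fun w => `|g 0| + K * `|F w|)).
- have mg : measurable_fun setT g.
    by apply: continuous_measurable_fun; exact: lipschitz_continuous.
  exact: measurableT_comp mg (L_measurable FL).
- apply: L_add; first exact: L_cst.
  apply: L_scale; apply: (@L_dominated _ _ _ P _ F) => //.
    by apply: measurableT_comp => //; exact: L_measurable FL.
  by apply: aeW => w; rewrite normr_id.
- apply: aeW => w; rewrite [leRHS]ger0_norm ?addr_ge0 ?mulr_ge0//.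
  by have := gK (F w) 0; have := lerB_dist (g (F w)) (g 0); rewrite subr0; lra.
Qed.

Lemma nrm_lipschitz F G : F \in L -> G \in L ->
  nrm P (fun w => g (F w) - g (G w)) <= K * nrm P (fun w => F w - G w).
Proof.
move=> FL GL; rewrite -[X in X * _](ger0_norm K0) -nrmZ ?L_sub//.
apply: nrm_le; first by apply: L_sub; exact: L_lipschitz.
  by apply: L_scale; exact: L_sub.
by apply: aeW => w; rewrite normrM (ger0_norm K0); exact: gK.
Qed.

Lemma l2cvg_lipschitz u F : (forall i, u i \in L) -> F \in L -> l2cvg P u Fil F ->
  l2cvg P (fun i w => g (u i w)) Fil (fun w => g (F w)).
Proof. by move=> uL FL; apply: (l2cvg_le K0) => i; exact: nrm_lipschitz. Qed.

End lipschitz.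
End l2cvg_theory.

Lemma ae_eq_Rintegral {d} {T : measurableType d} {R : realType} (P : probability T R)
    (F G : T -> R) : measurable_fun setT F -> measurable_fun setT G ->
  {ae P, forall w, F w = G w} -> \int[P]_w F w = \int[P]_w G w.
Proof.
move=> mF mG FG; rewrite /Rintegral; congr fine; apply: ae_eq_integral => //.
- exact/measurable_EFinP.
- exact/measurable_EFinP.
- by apply: filterS FG => w ->.
Qed.

Section stein_identity.
Context {d} {T : measurableType d} {R : realType} {P : probability T R}.
Variables (p : nat -> R) (X : nat -> {RV P >-> R}).
Hypothesis hp : forall k, 0 < p k < 1.
Hypothesis hX1 : forall k, P (X k @^-1` [set 1]) = (p k)%:E.
Hypothesis hXN1 : forall k, P (X k @^-1` [set -1]) = (1 - p k)%:E.
Hypothesis hXind : mutually_independent X.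
Local Notation L := (Lfun P 2%:E).
Local Notation Y := (Y p X).
Local Notation wal := (wal p X).
Local Notation walv := (walv p).
Local Notation sgn := (signs X).
Local Notation coef := (coef p X).
Local Notation inH := (inH p X).
Local Notation fpoly := (fpoly p X).
Local Notation wal_L := (wal_L hp hX1 hXN1).
Local Notation fpoly_L := (fpoly_L hp hX1 hXN1).
Local Notation mulY_L := (mulY_L hp hX1 hXN1).
Local Notation fpoly_box_l2cvg := (fpoly_box_l2cvg hp hX1 hXN1 hXind).
Implicit Types (F G H U : T -> R) (S : {fset nat}).

Lemma l2cvg_mulY {I} (Fil : set_system I) {FF : Filter Fil} k (u : I -> T -> R) F :
  (forall i, u i \in L) -> F \in L ->
  l2cvg P u Fil F -> l2cvg P (fun i w => Y k w * u i w) Fil (fun w => Y k w * F w).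
Proof.
move=> uL FL; apply: (l2cvg_le (Ybound_ge0 p k)) => i.
rewrite (_ : (fun w => _) = fun w => Y k w * (u i w - F w)); last first.
  by apply/funext => w; ring.
by apply: (nrm_mulY hp hX1 hXN1); exact: L_sub.
Qed.

(** The two values of [Y k] have product -1, so both are roots of [x ^+ 2 = 1 + (y1 + y0) * x],
    where [y1] and [y0] are these values. *)
Lemma ae_Y_sq k : {ae P, forall w,
  Y k w * Y k w = 1 + (yval p k true + yval p k false) * Y k w}.
Proof.
apply: filterS (aeY hp hX1 hXN1 k) => w ->.
have yy : yval p k true * yval p k false = -1.
  rewrite /yval mulrACA -invfM -expr2 (sd_sq hp); have /andP[p0 p1] := hp k.
  by field; rewrite subr_eq0 !gt_eqF.
by case: (sgn w k); move: (yval p k true) (yval p k false) yy => a b ab; lra.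
Qed.

Lemma Y_wal k S w : k \notin S -> Y k w * wal S w = wal (k |` S)%fset w.
Proof. by move=> kS; rewrite /wal big_fsetU1. Qed.

Lemma inH_mulY k U : inH U -> (forall S, k \in S -> coef U S = 0) ->
  inH (fun w => Y k w * U w).
Proof.
move=> hU U0; have UL := inH_L hU.
pose u N := fpoly (box N) (coef U).
apply: (inH_l2cvg hp hX1 hXN1 (u := fun N w => Y k w * u N w) (Fil := \oo)).
- move=> N; rewrite (_ : (fun w => _) = fun w => \sum_(S <- box N) coef U S * (Y k w * wal S w)).
    apply: (inH_sum hp hX1 hXN1) => S _.
    have [kS|kS] := boolP (k \in S).
      rewrite (_ : (fun w => _) = fun=> 0); first exact: inH_cst0.
      by apply/funext => w; rewrite U0// mul0r.
    under eq_fun do rewrite Y_wal//.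
    by apply: (inH_scale hp hX1 hXN1); exact: inH_wal.
  by apply/funext => w; rewrite /u /fpoly mulr_sumr; apply: eq_bigr => S _; rewrite mulrCA.
- split; first exact: mulY_L.
  have [[_ mU] _] := hU.
  by apply: measurable_funM => //; exact: measurable_Y_sigma.
- apply: l2cvg_mulY => //; first by move=> N; exact: fpoly_L.
  exact: fpoly_box_l2cvg.
Qed.

(** [Y k] is moved onto [wal S]. If [k] is not in [S] this gives [wal] of a set containing [k],
    where [U] has no coefficient. Otherwise [ae_Y_sq] reduces the square of [Y k]: the term 1 leaves
    the coefficient at [S] without [k], and the linear term is again a coefficient at a set
    containing [k]. *)
Lemma coef_mulY k U S : inH U -> (forall S, k \in S -> coef U S = 0) ->
  coef (fun w => Y k w * U w) S = if k \in S then coef U (S `\ k)%fset else 0.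
Proof.
move=> hU U0; have UL := inH_L hU.
have e : coef (fun w => Y k w * U w) S = ip P U (fun w => Y k w * wal S w).
  by apply: eq_Rintegral => w _; ring.
rewrite e; case: ifP => [kS|/negbT kS]; last first.
  rewrite (_ : (fun w => _) = wal (k |` S)%fset); first by apply: U0; rewrite fset1U1.
  by apply/funext => w; exact: Y_wal.
pose al := yval p k true + yval p k false.
have k' : k \notin (S `\ k)%fset by rewrite !inE eqxx.
have SE w : wal S w = Y k w * wal (S `\ k)%fset w by rewrite Y_wal// fsetD1K.
transitivity (ip P U (fun w => wal (S `\ k)%fset w + al * wal S w)).
  have mU := L_measurable UL; have mW := L_measurable (wal_L S).
  apply: (ae_eq_ip _ _ mU mU (L_measurable (mulY_L k (wal_L S)))
    (L_measurable (L_add (wal_L _) (L_scale al (wal_L _))))); first exact: aeW.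
  apply: filterS (ae_Y_sq k) => w /= Yw _.
  by rewrite SE mulrA Yw -/al; ring.
rewrite ipC (ipDl (wal_L _) (L_scale al (wal_L S)) UL) (ipZl al (wal_L S) UL).
rewrite (ipC P (wal (S `\ k)%fset)) (ipC P (wal S)).
by rewrite [X in al * X](U0 S)// mulr0 addr0.
Qed.

(** The average over the [k]-th coordinate alone: [Phi c] is the integrand with that sign frozen at
    [c]. It is split by the indicators of the two signs, to which [expectation_sign] applies. *)
Lemma expectation_sign2 (B : seq nat) (Phi : bool -> (nat -> bool) -> R) k :
    uniq B -> k \notin B -> (forall c, depends_on [in B] (Phi c)) ->
  \int[P]_w Phi (sgn w k) (sgn w) =
  \int[P]_w (p k * Phi true (sgn w) + (1 - p k) * Phi false (sgn w)).
Proof.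
move=> uB kB dPhi.
have iPhi c := depends_on_integrable X (dPhi c).
have iZ (x : R) c : P.-integrable setT (fun w => (x * Phi c (sgn w))%:E).
  by under eq_fun do rewrite EFinM; apply: integrableZl => //; exact: iPhi.
rewrite (RintegralD measurableT (iZ (p k) true) (iZ (1 - p k) false)).
rewrite (RintegralZl _ measurableT (iPhi true)) (RintegralZl _ measurableT (iPhi false)).
pose psi (c0 c : bool) : R := (c == c0)%:R.
have e c0 := expectation_sign hX1 hXind (psi c0) uB kB (dPhi c0).
have ips c0 : P.-integrable setT (fun w => (Phi c0 (sgn w) * psi c0 (sgn w k))%:E).
  have : depends_on [in k :: B] (fun x => Phi c0 x * psi c0 (x k)).
    move=> x y xy; rewrite (dPhi c0 x y) ?(xy k) ?mem_head// => j jB.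
    by apply: xy; rewrite inE jB orbT.
  by move=> /(depends_on_integrable X).
transitivity (\int[P]_w (Phi true (sgn w) * psi true (sgn w k) + Phi false (sgn w) * psi false (sgn w k))).
  by apply: eq_Rintegral => w _; rewrite /psi; case: (sgn w k) => /=; ring.
by rewrite (RintegralD measurableT (ips true) (ips false)) !e /psi/=; ring.
Qed.

Section approx.
Variables (k N : nat).

Definition vpoly (c : {fset nat} -> R) (x : nat -> bool) : R :=
  \sum_(S <- box N) c S * walv S x.

Lemma vpoly_dep c : (forall S, k \in S -> c S = 0) ->
  depends_on [in rem k (iota 0 N)] (vpoly c).
Proof.
move=> c0 x y xy; apply: eq_big_seq => S /in_boxP SN.
have [/c0->|kS] := boolP (k \in S); first by rewrite !mul0r.
congr (_ * _); apply: walv_dep => j jS; apply: xy.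
have jk : j != k by apply: contraNneq kS => <-.
by rewrite mem_rem_uniq ?iota_uniq//; apply/andP; split=> //=; rewrite mem_iota add0n SN.
Qed.

Lemma ae_fpoly c : {ae P, forall w, fpoly (box N) c w = vpoly c (sgn w)}.
Proof.
apply: filterS (ae_Y hp hX1 hXN1) => w Yw; apply: eq_bigr => S _.
by congr (_ * _); apply: eq_bigr => j _; rewrite Yw.
Qed.

End approx.

Section gradient.
Variables (g : R -> R) (K : R).
Hypothesis K0 : 0 <= K.
Hypothesis gK : forall x y, `|g x - g y| <= K * `|x - y|.

(* [stein_Y] and [stein_gradient] have the same inner product with [G] as soon
   as [a], [U] and [G] are functions of the coordinates other than [k]. *)
Definition stein_Y k (a U : T -> R) w : R := Y k w * g (a w + Y k w * U w).

Definition stein_gradient k (a U : T -> R) w : R :=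
  sd p k * (g (a w + yval p k true * U w) - g (a w + yval p k false * U w)).

Lemma stein_Y_L k a U : a \in L -> U \in L -> stein_Y k a U \in L.
Proof.
by move=> aL UL; apply: mulY_L; apply: (L_lipschitz K0 gK); apply: L_add => //; exact: mulY_L.
Qed.

Lemma stein_gradient_L k a U : a \in L -> U \in L -> stein_gradient k a U \in L.
Proof.
move=> aL UL; apply: L_scale; apply: L_sub; apply: (L_lipschitz K0 gK);
  by apply: L_add => //; exact: L_scale.
Qed.

Lemma ip_stein_fpoly k N c c1 c2 :
  (forall S, k \in S -> c S = 0) -> (forall S, k \in S -> c1 S = 0) ->
  (forall S, k \in S -> c2 S = 0) ->
  ip P (fpoly (box N) c) (stein_Y k (fpoly (box N) c1) (fpoly (box N) c2)) =
  ip P (fpoly (box N) c) (stein_gradient k (fpoly (box N) c1) (fpoly (box N) c2)).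
Proof.
move=> c0 c10 c20.
pose Phi b x := vpoly N c x * (yval p k b * g (vpoly N c1 x + yval p k b * vpoly N c2 x)).
have dPhi b : depends_on [in rem k (iota 0 N)] (Phi b).
  move=> x y xy; rewrite /Phi.
  by rewrite (vpoly_dep c0 xy) (vpoly_dep c10 xy) (vpoly_dep c20 xy).
have := expectation_sign2 (rem_uniq k (iota_uniq 0 N)) _ dPhi.
move=> /(_ k); rewrite mem_rem_uniqF ?iota_uniq// => /(_ isT) key.
have L0 := fpoly_L (box N) c; have L1 := fpoly_L (box N) c1; have L2 := fpoly_L (box N) c2.
have mPhi : measurable_fun setT (fun w => Phi (sgn w k) (sgn w)).
  have dP : depends_on [in k :: rem k (iota 0 N)] (fun x => Phi (x k) x).
    move=> x y xy; rewrite (xy k) ?mem_head//; apply: dPhi => j jB.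
    by apply: xy; rewrite inE jB orbT.
  by have [] := depends_on_cyl X dP.
have aeE : {ae P, forall w, [/\ Y k w = yval p k (sgn w k),
    fpoly (box N) c w = vpoly N c (sgn w), fpoly (box N) c1 w = vpoly N c1 (sgn w) &
    fpoly (box N) c2 w = vpoly N c2 (sgn w)]}.
  have h1 := aeY hp hX1 hXN1 k; have h2 := ae_fpoly N c.
  have h3 := ae_fpoly N c1; have h4 := ae_fpoly N c2.
  by apply: filterS2 (filterI h1 h2) (filterI h3 h4) => w [e1 e2] [e3 e4].
transitivity (\int[P]_w Phi (sgn w k) (sgn w)).
  apply: ae_eq_Rintegral => //.
  - apply: measurable_funM; first exact: L_measurable L0.
    exact: L_measurable (stein_Y_L k L1 L2).
  - by apply: filterS aeE => w [e0 e1 e2 e3]; rewrite /stein_Y /Phi e0 e1 e2 e3.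
rewrite key; apply/esym/ae_eq_Rintegral.
- apply: measurable_funM; first exact: L_measurable L0.
  exact: L_measurable (stein_gradient_L k L1 L2).
- apply: measurable_funD; apply: measurable_funM => //.
  + by have [] := depends_on_cyl X (dPhi true).
  + by have [] := depends_on_cyl X (dPhi false).
- apply: filterS aeE => w [e0 e1 e2 e3]; rewrite /stein_gradient /Phi e1 e2 e3.
  have pt : p k * yval p k true = sd p k := pr_yval hp k true.
  have pf : (1 - p k) * yval p k false = - sd p k := pr_yval hp k false.
  set gt := g (_ + yval p k true * _); set gf := g (_ + yval p k false * _).
  move: (yval p k true) (yval p k false) pt pf gt gf => yt yf pt pf gt gf.
  transitivity (vpoly N c (sgn w) * ((p k * yt) * gt + ((1 - p k) * yf) * gf)); last by ring.
  by rewrite pt pf; ring.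
Qed.

(** Both sides are continuous in L^2 as functions of [G], [a] and [U], because [g] is Lipschitz and
    [Y k] bounded; the truncations to [box N] keep the vanishing coefficients, so [ip_stein_fpoly]
    passes to the limit. *)
Lemma stein_ip k G a U : inH G -> inH a -> inH U ->
  (forall S, k \in S -> coef G S = 0) -> (forall S, k \in S -> coef a S = 0) ->
  (forall S, k \in S -> coef U S = 0) ->
  ip P G (stein_Y k a U) = ip P G (stein_gradient k a U).
Proof.
move=> hG ha hU G0 a0 U0.
have GL := inH_L hG; have aL := inH_L ha; have UL := inH_L hU.
pose ap F N := fpoly (box N) (coef F).
have apL F N : ap F N \in L by exact: fpoly_L.
have apG := fpoly_box_l2cvg hG; have apa := fpoly_box_l2cvg ha; have apU := fpoly_box_l2cvg hU.
have lipcvg (Q : nat -> T -> R) (Q0 : T -> R) : (forall N, Q N \in L) -> Q0 \in L ->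
    l2cvg P Q \oo Q0 -> l2cvg P (fun N w => g (ap a N w + Q N w)) \oo (fun w => g (a w + Q0 w)).
  move=> QL Q0L QQ; apply: (l2cvg_lipschitz K0 gK (u := fun N w => ap a N w + Q N w) (F := fun w => a w + Q0 w)).
  - by move=> N; exact: L_add.
  - exact: L_add.
  - exact: l2cvg_add.
have c1 : l2cvg P (fun N => stein_Y k (ap a N) (ap U N)) \oo (stein_Y k a U).
  apply: l2cvg_mulY.
  - by move=> N; apply: (L_lipschitz K0 gK); apply: L_add => //; exact: mulY_L.
  - by apply: (L_lipschitz K0 gK); apply: L_add => //; exact: mulY_L.
  - apply: lipcvg; [by move=> N; exact: mulY_L|exact: mulY_L|].
    exact: l2cvg_mulY.
have c2 : l2cvg P (fun N => stein_gradient k (ap a N) (ap U N)) \oo (stein_gradient k a U).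
  have gL b N : (fun w => g (ap a N w + yval p k b * ap U N w)) \in L.
    by apply: (L_lipschitz K0 gK); apply: L_add => //; exact: L_scale.
  have gL0 b : (fun w => g (a w + yval p k b * U w)) \in L.
    by apply: (L_lipschitz K0 gK); apply: L_add => //; exact: L_scale.
  have cb b : l2cvg P (fun N w => g (ap a N w + yval p k b * ap U N w)) \oo
      (fun w => g (a w + yval p k b * U w)).
    by apply: lipcvg; [move=> N; exact: L_scale|exact: L_scale|exact: l2cvg_scale].
  apply: l2cvg_scale; [by move=> N; exact: L_sub|exact: L_sub|].
  exact: (l2cvg_sub (gL true) (gL false) (gL0 true) (gL0 false) (cb true) (cb false)).
have i1 : ip P (ap G N) (stein_Y k (ap a N) (ap U N)) @[N --> \oo] --> ip P G (stein_Y k a U).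
  by apply: l2cvg_ip => // [N|]; exact: stein_Y_L.
have i2 : ip P (ap G N) (stein_gradient k (ap a N) (ap U N)) @[N --> \oo] -->
    ip P G (stein_gradient k a U).
  by apply: l2cvg_ip => // [N|]; exact: stein_gradient_L.
have e : (fun N => ip P (ap G N) (stein_Y k (ap a N) (ap U N))) =
    (fun N => ip P (ap G N) (stein_gradient k (ap a N) (ap U N))).
  by apply/funext => N; exact: ip_stein_fpoly.
rewrite e in i1.
by rewrite -(cvg_lim (@Rhausdorff R) i1) (cvg_lim (@Rhausdorff R) i2).
Qed.

End gradient.
End stein_identity.

(** * Symmetric kernels and multiple integrals *)

Section tuple_orderings.
Variable n : nat.
Implicit Types (i : n.-tuple nat) (S : {fset nat}).

Definition tset i : {fset nat} := [fset x in (i : seq nat)]%fset.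

(** The indices in Delta_n whose product of [Y] values is [wal S]. There are [n!] of them if [S] has
    [n] elements and none otherwise. *)
Definition orderings S : {fset n.-tuple nat} :=
  [fset i in pmap (insub : seq nat -> option (n.-tuple nat)) (permutations (enum_fset S))]%fset.

Lemma orderingsP i S : reflect (uniq i /\ tset i = S) (i \in orderings S).
Proof.
rewrite in_fset /= mem_pmap_sub mem_permutations; apply: (iffP idP) => [h|[ui <-]].
  split; first by rewrite (perm_uniq h) fset_uniq.
  by apply/fsetP => x; rewrite in_fset /= (perm_mem h).
apply: uniq_perm => //; first exact: fset_uniq.
by move=> x; rewrite in_fset.
Qed.

Lemma card_orderings S : #|` orderings S|%fset = if #|` S|%fset == n then n`! else 0%N.
Proof.
rewrite card_fseq undup_id; last by apply: pmap_sub_uniq; exact: permutations_uniq.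
rewrite size_pmap_sub; case: eqP => [Sn|Sn].
  rewrite -[in RHS]Sn -(size_permutations (fset_uniq S)) -(@count_predT _ (permutations _)).
  apply: eq_in_count => s; rewrite mem_permutations => /perm_size /= ->.
  by rewrite Sn eqxx.
rewrite -(@count_pred0 _ (permutations (enum_fset S))).
apply: eq_in_count => s; rewrite mem_permutations => /perm_size /= ->.
exact/eqP.
Qed.

Lemma tset_card i : uniq i -> #|` tset i|%fset = n.
Proof. by move=> ui; rewrite /tset card_fseq undup_id// size_tuple. Qed.

Lemma big_tset (R : Type) (idx : R) (op : Monoid.com_law idx) i (F : nat -> R) : uniq i ->
  \big[op/idx]_(j < n) F (tnth i j) = \big[op/idx]_(k <- tset i) F k.
Proof.
move=> ui; rewrite -(big_tuple _ _ i xpredT F); apply: perm_big; apply: uniq_perm => //; first exact: fset_uniq.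
by move=> x; rewrite in_fset.
Qed.

End tuple_orderings.

Section symmetric_kernels.
Context {R : realType}.
Variable n : nat.
Implicit Types (f : n.-tuple nat -> R) (i : n.-tuple nat) (S : {fset nat}).

(* For a symmetric kernel the choice of the ordering [enum_fset S] is immaterial;
   the value is 0 when [S] does not have [n] elements. *)
Definition kval f S : R :=
  if insub (enum_fset S) is Some t then f t else 0.

Lemma kvalE f i : sym_kernel f -> uniq i -> kval f (tset i) = f i.
Proof.
move=> [_ fsym _] ui; rewrite /kval.
have sz : size (enum_fset (tset i)) == n by apply/eqP; exact: tset_card.
rewrite insubT /=.
have : perm_eq (enum_fset (tset i)) i.
  apply: uniq_perm => //.
  by move=> x; rewrite in_fset.
case/tuple_permP => s e; rewrite -(fsym s i); congr f.
by apply: val_inj; rewrite /= e.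
Qed.

Lemma kval0 f S : #|` S|%fset != n -> kval f S = 0.
Proof. by move=> Sn; rewrite /kval insubF//; exact: negbTE. Qed.

Lemma kval_ordering f i S : sym_kernel f -> i \in orderings n S -> f i = kval f S.
Proof. by move=> fs /orderingsP[ui <-]; rewrite kvalE. Qed.

(** The Walsh coefficient of [J f] at [S]: all [n!] orderings of [S] contribute the same kernel
    value. *)
Definition kcoef f S : R := n`!%:R * kval f S.

Lemma sum_orderings f S (F : R -> R) : sym_kernel f -> #|` S|%fset = n ->
  \sum_(i <- orderings n S) F (f i) = n`!%:R * F (kval f S).
Proof.
move=> fs Sn.
rewrite (eq_big_seq (fun=> F (kval f S))); last by move=> i /(kval_ordering fs)->.
by rewrite big_const_seq count_predT iter_addr_0 card_orderings Sn eqxx mulr_natl.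
Qed.

(** One inequality of the isometry between [J f] and the kernel. The square of [n! * v] is [n!]
    times the sum of [v ^+ 2] over the [n!] orderings of a set, and different sets have disjoint
    orderings. *)
Lemma sum_kcoef_le f (B : {fset {fset nat}}) : sym_kernel f ->
  (\sum_(S <- B) (kcoef f S ^+ 2)%:E <= n`!%:R%:E * kernel_normsq f)%E.
Proof.
move=> fs; pose B' := [fset S in B | #|` S|%fset == n]%fset.
have -> : (\sum_(S <- B) (kcoef f S ^+ 2)%:E = \sum_(S <- B') (kcoef f S ^+ 2)%:E)%E.
  apply/esym/big_fset_incl; first by apply/fsubsetP => S; rewrite !inE => /andP[].
  by move=> S SB; rewrite !inE SB /= => Sn; rewrite /kcoef kval0// mulr0 expr0n.
have -> : (\sum_(S <- B') (kcoef f S ^+ 2)%:E =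
    n`!%:R%:E * \sum_(S <- B') \sum_(i <- orderings n S) (f i ^+ 2)%:E)%E.
  rewrite ge0_sume_distrr; last first.
    by move=> S _; apply: sume_ge0 => i _; rewrite lee_fin sqr_ge0.
  apply: eq_big_seq => S; rewrite !inE => /andP[_ /eqP Sn].
  by rewrite sumEFin (sum_orderings (fun x => x ^+ 2) fs Sn) -EFinM /kcoef; congr EFin; ring.
apply: lee_wpmul2l; first by rewrite lee_fin.
rewrite -partition_disjoint_bigfcup; last first.
  move=> S S' _ _ SS'; rewrite -fsetI_eq0; apply/eqP/fsetP => i; rewrite in_fsetI in_fset0.
  apply/negP => /andP[/orderingsP[_ e] /orderingsP[_ e']].
  by rewrite -e e' eqxx in SS'.
by apply: fset_le_esum => i; rewrite lee_fin sqr_ge0.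
Qed.

Lemma l2coefs_kcoef f : sym_kernel f -> l2coefs (kcoef f).
Proof.
move=> fs; have [fn _ _] := fs.
apply: (@le_lt_trans _ _ (n`!%:R%:E * kernel_normsq f)%E).
  by apply: esum_le_fset => B; exact: sum_kcoef_le.
by rewrite lte_mul_pinfty// lee_fin.
Qed.

Lemma sym_kernel_scale (x : R) f : sym_kernel f -> sym_kernel (fun i => x * f i).
Proof.
move=> [fn fsym f0]; split.
- apply: (@le_lt_trans _ _ ((x ^+ 2)%:E * kernel_normsq f)%E).
    apply: esum_le_fset => B.
    under eq_bigr do rewrite exprMn EFinM.
    rewrite -ge0_sume_distrr; last by move=> i _; rewrite lee_fin sqr_ge0.
    apply: lee_wpmul2l; first by rewrite lee_fin sqr_ge0.
    by apply: fset_le_esum => i; rewrite lee_fin sqr_ge0.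
  by rewrite lte_mul_pinfty// lee_fin sqr_ge0.
- by move=> s i; rewrite fsym.
- by move=> i /f0->; rewrite mulr0.
Qed.

Lemma kval_scale (x : R) f S : kval (fun i => x * f i) S = x * kval f S.
Proof. by rewrite /kval; case: insub => [//|]; rewrite mulr0. Qed.

End symmetric_kernels.

Section slices.
Context {R : realType}.
Variable n : nat.

Lemma kernel_perm m (f : m.-tuple nat -> R) (i i' : m.-tuple nat) :
  sym_kernel f -> perm_eq i i' -> f i = f i'.
Proof.
move=> [_ fsym _] /tuple_permP[s e]; rewrite -(fsym s i'); congr f.
by apply: val_inj; rewrite /= e.
Qed.

Variable f : n.+1.-tuple nat -> R.
Hypothesis fs : sym_kernel f.
Variable k : nat.

Lemma sym_kernel_slice : sym_kernel (slice f k).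
Proof.
have [fn fsym f0] := fs; split.
- apply: (@le_lt_trans _ _ (kernel_normsq f)) => //.
  apply: esum_le_fset => B; rewrite /slice.
  pose h (i : n.-tuple nat) : n.+1.-tuple nat := [tuple of rcons i k].
  have hi : {in B &, injective h}.
    by move=> i i' _ _ /(congr1 val) /= /rcons_inj[] ?; exact: val_inj.
  rewrite -(big_imfset _ imfset_key (fun j => (f j ^+ 2)%:E) hi)/=.
  by apply: fset_le_esum => i; rewrite lee_fin sqr_ge0.
- move=> s i; rewrite /slice; apply: (kernel_perm fs).
  change (perm_eq (rcons [tuple tnth i (s j) | j < n] k) (rcons i k)).
  by rewrite -!cats1 perm_cat2r; apply/tuple_permP; exists s.
- move=> i ui; apply: f0; rewrite /= rcons_uniq; apply: contra ui => /andP[]//.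
Qed.

Lemma kval_slice S : #|` S|%fset = n ->
  kval (slice f k) S = if k \in S then 0 else kval f (k |` S)%fset.
Proof.
move=> Sn; have sz : size (enum_fset S) == n by apply/eqP.
pose i : n.-tuple nat := Tuple sz.
have ui : uniq i by rewrite /= fset_uniq.
have iS : tset i = S by apply/fsetP => x; rewrite in_fset.
rewrite -{1}iS (kvalE sym_kernel_slice ui) /slice.
case: ifP => [kS|/negbT kS]; first by have [_ _ ->] := fs; rewrite //= rcons_uniq kS.
rewrite -(kvalE fs); last by rewrite /= rcons_uniq kS ui.
by congr kval; apply/fsetP => x; rewrite in_fset /= mem_rcons !inE.
Qed.

(** The factor [n.+1] in the definition of [D] turns [n!] into [n.+1!], so that on coefficients [D]
    is a shift without weights. *)
Lemma kcoef_slice S : n.+1%:R * kcoef (slice f k) S =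
  if k \in S then 0 else kcoef f (k |` S)%fset.
Proof.
rewrite /kcoef; have [Sn|Sn] := eqVneq (#|` S|%fset) n.
  rewrite kval_slice//; case: ifP => _; first by rewrite !mulr0.
  by rewrite mulrA -natrM factS.
rewrite kval0//; case: ifP => [_|/negbT kS]; first by rewrite !mulr0.
by rewrite kval0 ?mulr0// cardfsU1 kS.
Qed.

End slices.

(** * Multiple integrals and chaos decompositions in terms of Walsh coefficients *)

Section multiple_integral.
Context {d} {T : measurableType d} {R : realType} {P : probability T R}.
Variables (p : nat -> R) (X : nat -> {RV P >-> R}).
Hypothesis hp : forall k, 0 < p k < 1.
Hypothesis hX1 : forall k, P (X k @^-1` [set 1]) = (p k)%:E.
Hypothesis hXN1 : forall k, P (X k @^-1` [set -1]) = (1 - p k)%:E.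
Hypothesis hXind : mutually_independent X.
Local Notation L := (Lfun P 2%:E).
Local Notation wal := (wal p X).
Local Notation coef := (coef p X).
Local Notation inH := (inH p X).
Local Notation wal_L := (wal_L hp hX1 hXN1).

Lemma L2_cvgP {I} (u : I -> T -> R) (Fil : set_system I) {FF : Filter Fil} (F : T -> R) :
  (forall i, u i \in L) -> L2_cvg p X u Fil F <-> L2 p X F /\ l2cvg P u Fil F.
Proof.
move=> uL; split=> [] [F2 uF]; split=> //; have FL := F2.1.
- move=> e e0.
  have h : (nrm P (fun w => u i w - F w))%:E @[i --> Fil] --> (0 : R)%:E.
    have <- : (fun i => 'N[P]_2%:E[EFin \o (u i \- F)%R])%E =
      (fun i => (nrm P (fun w => u i w - F w))%:E); last exact: uF.
    by apply/funext => i; rewrite nrmE// L_sub.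
  have /cvgrPdist_lt H : nrm P (fun w => u i w - F w) @[i --> Fil] --> (0 : R).
    exact: fine_cvg h.
  by apply: filterS (H _ e0) => i; rewrite /= sub0r normrN ger0_norm ?nrm_ge0.
- have h : (nrm P (fun w => u i w - F w))%:E @[i --> Fil] --> (0 : R)%:E.
    apply: cvg_EFin; first exact: nearW.
    apply/cvgrPdist_lt => e e0; apply: filterS (uF _ e0) => i.
    by rewrite /= sub0r normrN ger0_norm ?nrm_ge0.
  move: h; have <- : (fun i => 'N[P]_2%:E[EFin \o (u i \- F)%R])%E =
      (fun i => (nrm P (fun w => u i w - F w))%:E); last by [].
  by apply/funext => i; rewrite nrmE// L_sub.
Qed.

Lemma L2_limP {I} (u : I -> T -> R) (Fil : set_system I) {FF : Filter Fil} (F : T -> R) :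
  (forall i, u i \in L) -> L2 p X F -> l2cvg P u Fil F ->
  L2 p X (L2_lim p X u Fil) /\ l2cvg P u Fil (L2_lim p X u Fil).
Proof.
move=> uL F2 uF; apply/(L2_cvgP _ uL).
apply: (@xgetPex _ (cst 0) [set F | L2_cvg p X u Fil F]).
by exists F; apply/(L2_cvgP _ uL).
Qed.

(** [L2_lim] picks a limit by choice, so the existence of one has to be shown beforehand, through
    [inH_exists]. The coefficients of the chosen version are then forced. *)
Lemma L2_lim_coef {I} (u : I -> T -> R) (Fil : set_system I) {FF : ProperFilter Fil} c :
  l2coefs c -> (forall i, inH (u i)) ->
  (forall i S, `|coef (u i) S - c S| <= `|c S|) ->
  (forall S, \forall i \near Fil, coef (u i) S = c S) ->
  [/\ inH (L2_lim p X u Fil), forall S, coef (L2_lim p X u Fil) S = c S &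
      l2cvg P u Fil (L2_lim p X u Fil)].
Proof.
move=> cfin hu uc u0; have [F hF FE] := inH_exists hp hX1 hXN1 hXind cfin.
have uL i : u i \in L := inH_L (hu i).
have uF : l2cvg P u Fil F.
  apply: (l2cvg_coef hp hX1 hXN1 hXind cfin hF hu) => [i S|S]; first by rewrite FE.
  by apply: filterS (u0 S) => i ->.
have [G2 uG] := L2_limP uL hF.1 uF.
have hG : inH (L2_lim p X u Fil) by exact: (inH_l2cvg hp hX1 hXN1 hu G2 uG).
split=> // S; exact: (coef_l2cvg hp hX1 hXN1 uL (inH_L hG) uG).
Qed.

(** The partial sum over a finite set [A] of tuples has at [S] the coefficient [kval f S] times the
    number of orderings of [S] in [A]. It never exceeds the full value in modulus and reaches it
    once [A] contains all the orderings. *)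
Lemma J_spec n (f : n.-tuple nat -> R) : sym_kernel f ->
  inH (J p X f) /\ forall S, coef (J p X f) S = kcoef f S.
Proof.
move=> fs; pose u (A : {fset n.-tuple nat}) w :=
  \sum_(i <- A | uniq i) f i * \prod_(j < n) Y p X (tnth i j) w.
have uE A : u A = fun w => \sum_(i <- A | uniq i) f i * wal (tset i) w.
  by apply/funext => w; apply: eq_bigr => i ui; rewrite (big_tset _ (fun k => Y p X k w)).
have hu A : inH (u A).
  rewrite uE; apply: (inH_sum hp hX1 hXN1) => i _.
  by apply: (inH_scale hp hX1 hXN1); exact: inH_wal.
have cu A S : coef (u A) S = (#|` A `&` orderings n S|%fset)%:R * kval f S.
  rewrite uE (coef_sum hp hX1 hXN1); last first.
    by move=> i _; apply: L_scale; exact: wal_L.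
  under eq_bigr do rewrite (coefZ hp hX1 hXN1) ?wal_L// (coef_wal hp hX1 hXN1 hXind).
  rewrite card_fset_sum1 natr_sum mulr_suml.
  have -> : (A `&` orderings n S = [fset i in A | i \in orderings n S])%fset.
    by apply/fsetP => i; rewrite !in_fsetE /= !inE.
  rewrite -big_fset_condE /= big_mkcond [RHS]big_mkcond /=; apply: eq_bigr => i _.
  rewrite mul1r; case: (boolP (i \in orderings n S)) => [iS|].
    by rewrite -(kval_ordering fs iS); case/orderingsP : iS => -> ->; rewrite eqxx mulr1.
  case: ifP => // ui; case: eqP => [e /orderingsP[]//|_ _]; last by rewrite mulr0.
have card_le A S : (#|` A `&` orderings n S|%fset <= n`!)%N.
  apply: leq_trans (fsubset_leq_card (fsubsetIr _ _)) _.
  by rewrite card_orderings; case: ifP.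
have uc A S : `|coef (u A) S - kcoef f S| <= `|kcoef f S|.
  rewrite cu /kcoef -mulrBl !normrM ler_wpM2r// distrC.
  by rewrite !ger0_norm ?subr_ge0 ?ler_nat// gerBl.
have u0 S : \forall A \near summability.totally, coef (u A) S = kcoef f S.
  exists (orderings n S) => // A /= SA; rewrite cu /kcoef.
  have [Sn|Sn] := eqVneq (#|` S|%fset) n; last by rewrite kval0// !mulr0.
  by have /fsetIidPr -> := SA; rewrite card_orderings Sn eqxx.
have FT := @summability.totally_filter (n.-tuple nat).
by have [hJ cJ _] := @L2_lim_coef _ _ _ FT _ (l2coefs_kcoef fs) hu uc u0.
Qed.

Lemma kcoef0 n (f : n.-tuple nat -> R) S : #|` S|%fset != n -> kcoef f S = 0.
Proof. by move=> Sn; rewrite /kcoef kval0// mulr0. Qed.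

Lemma chaos_decomposition_spec F f : chaos_decomposition p X F f ->
  inH F /\ forall S, S != fset0 -> coef F S = kcoef (f #|` S|%fset) S.
Proof.
move=> [fs].
pose u N w := fine 'E_P[F] + \sum_(1 <= n < N) J p X (f n) w.
have hJ n : (0 < n)%N -> inH (J p X (f n)) by move=> /fs/J_spec[].
pose c0 : T -> R := fun=> fine 'E_P[F].
have c0E : c0 = fun w => fine 'E_P[F] * wal fset0 w.
  by apply/funext => w; rewrite /wal /c0 big_seq_fset0 mulr1.
have hc0 : inH c0 by rewrite c0E; apply: (inH_scale hp hX1 hXN1); exact: inH_wal.
have hs N : inH (fun w => \sum_(1 <= n < N) J p X (f n) w).
  rewrite (_ : (fun w => _) = fun w => \sum_(n <- index_iota 1 N | (0 < n)%N) J p X (f n) w).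
    by apply: (inH_sum hp hX1 hXN1).
  apply/funext => w; rewrite [RHS]big_mkcond; apply: eq_big_nat => n /andP[n1 _].
  by rewrite n1.
have hu N : inH (u N) by apply: (inH_add hp hX1 hXN1).
have uL N : u N \in L := inH_L (hu N).
move=> /(L2_cvgP _ uL)[F2 uF].
have hF : inH F by exact: (inH_l2cvg hp hX1 hXN1 hu F2 uF).
split=> [|S S0]; first exact: hF.
apply: (coef_l2cvg hp hX1 hXN1 uL (inH_L hF) uF).
exists (#|` S|%fset).+1 => // N /= SN.
have SN0 : (0 < #|` S|%fset)%N by rewrite cardfs_gt0.
rewrite (coefD hp hX1 hXN1 _ (inH_L hc0) (inH_L (hs N))).
have -> : coef c0 S = 0.
  rewrite c0E (coefZ hp hX1 hXN1) ?wal_L// (coef_wal hp hX1 hXN1 hXind).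
  by rewrite eq_sym (negbTE S0) mulr0.
rewrite add0r.
transitivity (\sum_(n <- index_iota 1 N | (0 < n)%N) coef (J p X (f n)) S).
  rewrite -(coef_sum hp hX1 hXN1); last by move=> n n0; exact: inH_L (hJ n n0).
  congr (coef _ S); apply/funext => w; rewrite [RHS]big_mkcond.
  by apply: eq_big_nat => n /andP[n1 _]; rewrite n1.
rewrite big_mkcond (bigD1_seq (#|` S|%fset)) ?iota_uniq//=; last first.
  by rewrite mem_index_iota SN0.
rewrite SN0 (J_spec (fs _ SN0)).2 big1 ?addr0// => n nS.
case: ifP => // n0; rewrite (J_spec (fs _ n0)).2 kcoef0// eq_sym//.
Qed.

End multiple_integral.

(** * Walsh coefficients of D and of the inverse of L *)

Section operators.
Context {d} {T : measurableType d} {R : realType} {P : probability T R}.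
Variables (p : nat -> R) (X : nat -> {RV P >-> R}).
Hypothesis hp : forall k, 0 < p k < 1.
Hypothesis hX1 : forall k, P (X k @^-1` [set 1]) = (p k)%:E.
Hypothesis hXN1 : forall k, P (X k @^-1` [set -1]) = (1 - p k)%:E.
Hypothesis hXind : mutually_independent X.
Local Notation L := (Lfun P 2%:E).
Local Notation wal := (wal p X).
Local Notation coef := (coef p X).
Local Notation inH := (inH p X).
Local Notation wal_L := (wal_L hp hX1 hXN1).
Local Notation J_spec := (J_spec hp hX1 hXN1 hXind).
Local Notation chaos_decomposition := (chaos_decomposition p X).
Implicit Types (F G : T -> R) (S : {fset nat}) (f : kernel_family R).

Lemma J_sum_spec f (r : seq nat) (a : nat -> R) : uniq r ->
  (forall n, n \in r -> sym_kernel (f n)) ->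
  inH (fun w => \sum_(n <- r) a n * J p X (f n) w) /\
  forall S, coef (fun w => \sum_(n <- r) a n * J p X (f n) w) S =
    if (#|` S|%fset) \in r then a #|` S|%fset * kcoef (f #|` S|%fset) S else 0.
Proof.
move=> ur fs.
have E : (fun w => \sum_(n <- r) a n * J p X (f n) w) =
    (fun w => \sum_(n <- r | n \in r) a n * J p X (f n) w).
  by apply/funext => w; rewrite big_seq.
rewrite E; split=> [|S].
  apply: (inH_sum hp hX1 hXN1) => n nr; apply: (inH_scale hp hX1 hXN1).
  exact: (J_spec (fs n nr)).1.
rewrite (coef_sum hp hX1 hXN1); last first.
  by move=> n nr; apply: L_scale; exact: inH_L (J_spec (fs n nr)).1.
rewrite -big_seq; case: ifP => [Sr|/negbT Sr].
  rewrite (bigD1_seq (#|` S|%fset))//= big_seq_cond big1 ?addr0.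
    by rewrite (coefZ hp hX1 hXN1) ?(J_spec (fs _ Sr)).2//; exact: inH_L (J_spec (fs _ Sr)).1.
  move=> n /andP[nr nS]; rewrite (coefZ hp hX1 hXN1); last exact: inH_L (J_spec (fs n nr)).1.
  by rewrite (J_spec (fs n nr)).2 kcoef0 ?mulr0// eq_sym.
rewrite big_seq big1// => n nr; rewrite (coefZ hp hX1 hXN1); last exact: inH_L (J_spec (fs n nr)).1.
by rewrite (J_spec (fs n nr)).2 kcoef0 ?mulr0//; apply: contraNneq Sr => ->.
Qed.

Lemma coef_expectation F : fine 'E_P[F] = coef F fset0.
Proof.
by rewrite (coef_fset0 p X) unlock.
Qed.

(** Used for [Linv F]: [D] can be evaluated there only after a decomposition is exhibited, since
    [kernels] is defined by choice. *)
Lemma chaos_decomposition_intro F f : inH F ->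
  (forall n, (0 < n)%N -> sym_kernel (f n)) ->
  (forall S, S != fset0 -> coef F S = kcoef (f #|` S|%fset) S) ->
  chaos_decomposition F f.
Proof.
move=> hF fs Ff; split=> //.
pose s N w := \sum_(n <- index_iota 1 N) 1 * J p X (f n) w.
have fs' N n : n \in index_iota 1 N -> sym_kernel (f n).
  by rewrite mem_index_iota => /andP[/fs].
have sP N := J_sum_spec (fun=> 1) (iota_uniq _ _) (fs' N).
pose c0 w := coef F fset0 * wal fset0 w.
have hc0 : inH c0 by apply: (inH_scale hp hX1 hXN1); exact: inH_wal.
pose u N w := c0 w + s N w.
have hu N : inH (u N) by apply: (inH_add hp hX1 hXN1) => //; exact: (sP N).1.
have -> : (fun N w => fine 'E_P[F] + \sum_(1 <= n < N) J p X (f n) w) = u.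
  apply/funext => N; apply/funext => w; rewrite /u /c0 /s coef_expectation.
  rewrite wal_fset0 mulr1; congr (_ + _).
  by apply: eq_bigr => n _; rewrite mul1r.
have cu N S : coef (u N) S = if (#|` S|%fset < N)%N || (S == fset0) then coef F S else 0.
  rewrite (coefD hp hX1 hXN1 _ (inH_L hc0) (inH_L (sP N).1)) (sP N).2.
  rewrite (coefZ hp hX1 hXN1) ?wal_L// (coef_wal hp hX1 hXN1 hXind) mem_index_iota cardfs_gt0.
  rewrite eq_sym; have [->|S0] := eqVneq S fset0; first by rewrite orbT mulr1 addr0.
  by rewrite orbF mulr0 add0r /=; case: ifP => // _; rewrite mul1r Ff.
apply/(L2_cvgP p X _ (fun N => inH_L (hu N))); split; first exact: inH_L2.
apply: (l2cvg_coef hp hX1 hXN1 hXind (l2coefs_coef hp hX1 hXN1 hXind hF)) => //.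
- move=> N S; rewrite cu; case: ifP => _; first by rewrite subrr normr0.
  by rewrite sub0r normrN.
- by move=> S; exists (#|` S|%fset).+1 => // N /= SN; rewrite cu SN.
Qed.

Section decomposed.
Variable F : T -> R.
Hypothesis hdec : exists f, chaos_decomposition F f.

Lemma kernels_decomposition : chaos_decomposition F (kernels p X F).
Proof.
have H : [set f | chaos_decomposition F f] (kernels p X F) by apply: xgetPex; exact: hdec.
exact: H.
Qed.

Lemma decomposed_inH : inH F.
Proof. by have [] := chaos_decomposition_spec hp hX1 hXN1 hXind kernels_decomposition. Qed.

Lemma coef_kernels S : S != fset0 -> coef F S = kcoef (@kernels _ _ _ _ p X F #|` S|%fset) S.
Proof.
by have [_] := chaos_decomposition_spec hp hX1 hXN1 hXind kernels_decomposition; exact.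
Qed.

Lemma sym_kernels n : (0 < n)%N -> sym_kernel (@kernels _ _ _ _ p X F n).
Proof. by have [fs _] := kernels_decomposition; exact: fs. Qed.

Lemma l2coefs_shift (c : {fset nat} -> R) k : l2coefs c ->
  l2coefs (fun S => if k \in S then 0 else c (k |` S)%fset).
Proof.
apply: le_lt_trans; apply: esum_le_fset => B.
pose B' := [fset S in B | k \notin S]%fset.
have -> : (\sum_(S <- B) ((if k \in S then 0 else c (k |` S)%fset) ^+ 2)%:E =
    \sum_(S <- B') (c (k |` S)%fset ^+ 2)%:E)%E.
  rewrite -(big_fset_incl _ (A := B')).
  - by apply: eq_big_seq => S; rewrite !inE => /andP[_ /negbTE->].
  - by apply/fsubsetP => S; rewrite !inE => /andP[].
  - by move=> S SB; rewrite !inE SB /= negbK => ->; rewrite expr0n.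
have inj : {in B' &, injective (fun S : {fset nat} => (k |` S)%fset)}.
  move=> S S'; rewrite !inE => /andP[_ kS] /andP[_ kS'] e.
  by rewrite -(fsetU1K kS) e fsetU1K.
rewrite -(big_imfset _ imfset_key (fun S => (c S ^+ 2)%:E) inj).
by apply: fset_le_esum => S; rewrite lee_fin sqr_ge0.
Qed.

(** For a fixed [k] the shifted coefficients are a subfamily of those of [F], hence square summable.
    The domain condition intervenes in the sum over [k], through [energy]. *)
Lemma D_spec k : inH (D p X F k) /\
  forall S, coef (D p X F k) S = if k \in S then 0 else coef F (k |` S)%fset.
Proof.
pose c S := if k \in S then 0 else coef F (k |` S)%fset.
have cfin : l2coefs c.
  exact: l2coefs_shift (l2coefs_coef hp hX1 hXN1 hXind decomposed_inH).
pose f : kernel_family R := fun n => slice (@kernels _ _ _ _ p X F n.+1) k.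
have fs N n : n \in index_iota 0 N -> sym_kernel (f n).
  by move=> _; apply: sym_kernel_slice; exact: sym_kernels.
have uP N := J_sum_spec (fun n => n.+1%:R) (iota_uniq _ _) (fs N).
have cu N S : coef (fun w => \sum_(0 <= n < N) n.+1%:R * J p X (f n) w) S =
    if (#|` S|%fset < N)%N then c S else 0.
  rewrite (uP N).2 mem_index_iota /=; case: ifP => // _.
  rewrite kcoef_slice; last exact: sym_kernels.
  rewrite /c; case: ifP => // /negbT kS; rewrite coef_kernels.
    by rewrite cardfsU1 kS.
  by apply/fset0Pn; exists k; rewrite fset1U1.
have [||h1 h2 _] := L2_lim_coef hp hX1 hXN1 hXind (Fil := \oo) cfin (fun N => (uP N).1).
- by move=> N S; rewrite cu; case: ifP => _; [rewrite subrr normr0|rewrite sub0r normrN].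
- by move=> S; exists (#|` S|%fset).+1 => // N /= SN; rewrite cu SN.
by split.
Qed.

Lemma Linv_spec : inH (Linv p X F) /\
  forall S, coef (Linv p X F) S = - (#|` S|%fset%:R^-1 * coef F S).
Proof.
pose c S := - (#|` S|%fset%:R^-1 * coef F S).
have cle S : `|c S| <= `|coef F S|.
  rewrite normrN normrM ler_piMl// normfV normr_nat.
  have [->|n0] := eqVneq (#|` S|%fset) 0%N; first by rewrite invr0.
  by rewrite invf_le1 ?ltr0n ?lt0n// ler1n lt0n.
have cfin : l2coefs c.
  exact: l2coefs_le cle (l2coefs_coef hp hX1 hXN1 hXind decomposed_inH).
have fs N n : n \in index_iota 1 N -> sym_kernel (@kernels _ _ _ _ p X F n).
  by rewrite mem_index_iota => /andP[/sym_kernels].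
have uP N := J_sum_spec (fun n => n%:R^-1) (iota_uniq _ _) (fs N).
pose u N w := - \sum_(1 <= n < N) n%:R^-1 * J p X (@kernels _ _ _ _ p X F n) w.
have uE N : u N = fun w => -1 * \sum_(n <- index_iota 1 N) n%:R^-1 * J p X (@kernels _ _ _ _ p X F n) w.
  by apply/funext => w; rewrite mulN1r.
have hu N : inH (u N).
  by rewrite uE; apply: (inH_scale hp hX1 hXN1); exact: (uP N).1.
have cu N S : coef (u N) S = if (#|` S|%fset < N)%N then c S else 0.
  rewrite uE (coefZ hp hX1 hXN1) ?(inH_L (uP N).1)// (uP N).2 mem_index_iota cardfs_gt0.
  (* At the empty set the weight is the inverse of 0, which is 0; this agrees with the sum that
     starts at [n = 1]. *)
  have [->|S0] := eqVneq S fset0; first by rewrite /= /c cardfs0 invr0 mul0r mulr0 oppr0; case: ifP.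
  by rewrite /= /c (coef_kernels S0); case: ifP => _; [rewrite mulN1r|rewrite mulr0].
have [||h1 h2 _] := L2_lim_coef hp hX1 hXN1 hXind (Fil := \oo) cfin hu.
- by move=> N S; rewrite cu; case: ifP => _; [rewrite subrr normr0|rewrite sub0r normrN].
- by move=> S; exists (#|` S|%fset).+1 => // N /= SN; rewrite cu SN.
by split.
Qed.

Lemma Linv_decomposed : exists f, chaos_decomposition (Linv p X F) f.
Proof.
have [hL cL] := Linv_spec.
exists (fun n i => - n%:R^-1 * @kernels _ _ _ _ p X F n i).
apply: chaos_decomposition_intro => //.
  by move=> n n0; apply: sym_kernel_scale; exact: sym_kernels.
by move=> S S0; rewrite cL coef_kernels// /kcoef kval_scale; ring.
Qed.

End decomposed.

Lemma DLinv_spec F k : (exists f, chaos_decomposition F f) ->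
  inH (D p X (Linv p X F) k) /\
  forall S, coef (D p X (Linv p X F) k) S =
    if k \in S then 0 else - ((#|` S|%fset).+1%:R^-1 * coef F (k |` S)%fset).
Proof.
move=> hdec; have [hD cD] := D_spec (Linv_decomposed hdec) k.
split=> // S; rewrite cD; case: ifP => // /negbT kS.
by rewrite (Linv_spec hdec).2 cardfsU1 kS.
Qed.

End operators.

(** * Energy of the gradient *)

Lemma exchange_esum {R : realType} {I J : choiceType} (a : I -> J -> \bar R) :
  (forall i j, (0 <= a i j)%E) ->
  \esum_(i in [set: I]) \esum_(j in [set: J]) a i j =
  \esum_(j in [set: J]) \esum_(i in [set: I]) a i j.
Proof.
move=> a0; rewrite !esum_esum//.
pose Q : set (I * J) := [set: I] `*`` (fun=> [set: J]).
pose Q' : set (J * I) := [set: J] `*`` (fun=> [set: I]).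
rewrite (@reindex_esum _ _ _ Q' Q (fun x => (x.2, x.1)))//.
split=> //.
- by move=> [j i] [j' i'] _ _ [-> ->].
- by move=> [i j] _; exists (j, i).
Qed.

Lemma sum_cst_fset {R : realType} {I : choiceType} (A : {fset I}) (x : R) :
  \sum_(i <- A) x = #|` A|%fset%:R * x.
Proof. by rewrite card_fset_sum1 natr_sum mulr_suml; apply: eq_bigr => i _; rewrite mul1r. Qed.

Lemma esum_cst_fset {R : realType} {I : choiceType} (A : {fset I}) (x : R) :
  0 <= x ->
  \esum_(i in [set: I]) (if i \in A then x else 0)%:E = (#|` A|%fset%:R * x)%:E.
Proof.
move=> x0; have a0 i : 0 <= (if i \in A then x else 0) by case: ifP.
apply/eqP; rewrite eq_le; apply/andP; split.
  apply: esum_le_fset => B; rewrite sumEFin lee_fin -sum_cst_fset.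
  apply: le_trans (fset_sum_le (fsubsetUl B A) a0) _.
  rewrite -(big_fset_incl _ (fsubsetUr B A)).
    by rewrite big_seq [leRHS]big_seq; apply: ler_sum => i ->.
  by move=> i _ /negbTE->.
apply: le_trans (fset_le_esum A _); last by move=> i; rewrite lee_fin.
rewrite sumEFin lee_fin -sum_cst_fset big_seq [leRHS]big_seq.
by apply: ler_sum => i ->.
Qed.

Section energy.
Context {d} {T : measurableType d} {R : realType} {P : probability T R}.
Variables (p : nat -> R) (X : nat -> {RV P >-> R}).
Hypothesis hp : forall k, 0 < p k < 1.
Hypothesis hX1 : forall k, P (X k @^-1` [set 1]) = (p k)%:E.
Hypothesis hXN1 : forall k, P (X k @^-1` [set -1]) = (1 - p k)%:E.
Hypothesis hXind : mutually_independent X.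
Local Notation L := (Lfun P 2%:E).
Local Notation coef := (coef p X).
Local Notation inH := (inH p X).
Implicit Types (F : T -> R) (c : {fset nat} -> R) (S : {fset nat}).

(** For the coefficients of [F] this is the sum of [n * n! * |f_n|^2] over the orders, and also the
    mean of the squared norm of [D F]. *)
Definition energy c : \bar R :=
  \esum_(S in [set: {fset nat}]) (#|` S|%fset%:R * c S ^+ 2)%:E.

Definition dcoef c k S : R := if k \in S then 0 else c (k |` S)%fset.

Lemma domD_energy F : domD p X F -> (energy (coef F) < +oo)%E.
Proof.
move=> [_ [f fdec]]; apply: le_lt_trans; apply: esum_le_fset => B.
have [_ cF] := chaos_decomposition_spec hp hX1 hXN1 hXind fdec.
have fs := fdec.1.
pose N := (\max_(S <- B) #|` S|%fset).+1.
have SN S : S \in B -> (#|` S|%fset < N)%N.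
  by move=> SB; rewrite ltnS (leq_bigmax_seq _ SB).
have E S : S \in B -> (#|` S|%fset%:R * coef F S ^+ 2)%:E =
    (\sum_(1 <= n < N) n%:R%:E * (kcoef (f n) S ^+ 2)%:E)%E.
  move=> SB; have [S0|S0] := eqVneq S fset0.
    rewrite S0 cardfs0 mul0r big_nat big1// => n /andP[n1 _].
    by rewrite kcoef0 ?expr0n ?mule0// cardfs0 eq_sym -lt0n.
  rewrite (bigD1_seq #|` S|%fset) ?iota_uniq ?mem_index_iota ?cardfs_gt0 ?S0 ?SN//=.
  rewrite big1 ?adde0 ?cF// => n nS.
  by rewrite kcoef0 ?expr0n ?mule0// eq_sym.
rewrite big_seq (eq_bigr _ E) -big_seq exchange_big /=.
apply: le_trans (nneseries_lim_ge N _); last first.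
  move=> n n1 _; apply: mule_ge0; rewrite ?lee_fin//.
  by apply: esum_ge0 => i _; rewrite lee_fin sqr_ge0.
rewrite big_nat [leRHS]big_nat; apply: lee_sum => n /andP[n1 nN].
rewrite -ge0_sume_distrr; last by move=> S _; rewrite lee_fin sqr_ge0.
rewrite natrM EFinM -muleA; apply: lee_wpmul2l; first by rewrite lee_fin.
exact: sum_kcoef_le (fs n n1).
Qed.

Lemma esum_dcoef c k :
  \esum_(S in [set: {fset nat}]) (dcoef c k S ^+ 2)%:E =
  \esum_(S in [set: {fset nat}]) (if k \in S then c S ^+ 2 else 0)%:E.
Proof.
pose A := [set S : {fset nat} | k \notin S].
pose A' := [set S : {fset nat} | k \in S].
transitivity (\esum_(S in A) (c (k |` S)%fset ^+ 2)%:E).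
  rewrite [RHS]esum_mkcond; apply: eq_esum => S _.
  rewrite /dcoef; case: ifPn => kS.
    by rewrite memNset ?expr0n// /A /= kS.
  by rewrite mem_set.
transitivity (\esum_(S in A') (c S ^+ 2)%:E); last first.
  rewrite [LHS]esum_mkcond; apply: eq_esum => S _.
  have [kS|kS] := boolP (k \in S); first by rewrite mem_set.
  by rewrite memNset// /A' /= (negbTE kS).
apply/esym; apply: (@reindex_esum _ _ _ A A' (fun S => (k |` S)%fset)); split.
- by move=> S _; rewrite /A' /= fset1U1.
- move=> S S' /set_mem kS /set_mem kS' e.
  by rewrite -(fsetU1K kS) e fsetU1K.
- by move=> S kS; exists (S `\ k)%fset; rewrite /A /= ?fsetD11 ?fsetD1K.
Qed.

Lemma sum_nrm_gradient c (U : nat -> T -> R) :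
  (forall k, inH (U k)) -> (forall k S, coef (U k) S = dcoef c k S) ->
  (\sum_(k <oo) (nrm P (U k) ^+ 2)%:E = energy c)%E.
Proof.
move=> hU cU; rewrite nneseries_esumT; last by move=> k; rewrite lee_fin sqr_ge0.
transitivity (\esum_(k in [set: nat]) \esum_(S in [set: {fset nat}])
    (if k \in S then c S ^+ 2 else 0)%:E).
  apply: eq_esum => k _; rewrite (parseval hp hX1 hXN1 hXind (hU k)) -esum_dcoef.
  by apply: eq_esum => S _; rewrite cU.
rewrite exchange_esum; last by move=> k S; rewrite lee_fin; case: ifP; rewrite ?sqr_ge0.
by apply: eq_esum => S _; rewrite esum_cst_fset// sqr_ge0.
Qed.

End energy.

Section gradient_series.
Context {d} {T : measurableType d} {R : realType} (P : probability T R).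
Local Notation L := (Lfun P 2%:E).
Variables U G : nat -> T -> R.
Hypothesis UL : forall k, U k \in L.
Hypothesis GL : forall k, G k \in L.
Hypothesis GU : forall k, nrm P (G k) <= nrm P (U k).
Hypothesis Ufin : (\sum_(k <oo) (nrm P (U k) ^+ 2)%:E < +oo)%E.

Let prod_meas k : measurable_fun setT (fun w => U k w * G k w).
Proof. by apply: measurable_funM; exact: L_measurable. Qed.

Let sum_meas n : measurable_fun setT (fun w => \sum_(0 <= k < n) U k w * G k w).
Proof. by apply: measurable_sum => k; exact: prod_meas. Qed.

Lemma nneseries_integral_prod :
  (\sum_(k <oo) \int[P]_w `|U k w * G k w|%:E < +oo)%E.
Proof.
apply: le_lt_trans Ufin; apply: lee_nneseries => [k _ _|k _].
  by apply: integral_ge0 => w _; rewrite lee_fin.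
have := ip_abs_le (UL k) (GL k); rewrite -lee_fin /Rintegral fineK; last first.
  apply: integrable_fin_num => //; apply: integrable_norm => //.
  exact: L_integrable_mul.
move=> h; apply: le_trans h _.
by rewrite lee_fin expr2; apply: ler_pM => //; exact: nrm_ge0.
Qed.

Lemma measurable_dot_l2 :
  measurable_fun setT (fun w => dot_l2 (fun k => U k w) (fun k => G k w)).
Proof. exact: measurable_fun_limn. Qed.

Let absprod k w : \bar R := `|U k w * G k w|%:E.
Let absprod_meas k : measurable_fun setT (absprod k).
Proof. by apply/measurable_EFinP; exact: measurableT_comp. Qed.

Lemma ae_cvg_dot_l2 : {ae P, forall w,
  \sum_(0 <= k < n) U k w * G k w @[n --> \oo] -->
  dot_l2 (fun k => U k w) (fun k => G k w)}.
Proof.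
have := ae_nneseries_lty absprod_meas (fun k w => normr_ge0 _) nneseries_integral_prod.
apply: filterS => w h; apply: normed_cvg.
by apply: (@nneseries_lty_cvg _ (fun k => `|U k w * G k w|)) => // k; exact: normr_ge0.
Qed.

(** Dominated convergence, with [1] plus the series of [|U k * G k|] as a common majorant. That
    series is integrable by Cauchy-Schwarz, since [nrm (G k) <= nrm (U k)] and the squared norms of
    the [U k] are summable. *)
Lemma cvg_dot_l2 :
  \int[P]_w (\sum_(0 <= k < n) U k w * G k w) @[n --> \oo] -->
  \int[P]_w dot_l2 (fun k => U k w) (fun k => G k w) /\
  P.-integrable setT (fun w => (dot_l2 (fun k => U k w) (fun k => G k w))%:E) /\
  (\int[P]_w `|1 - \sum_(0 <= k < n) U k w * G k w| @[n --> \oo] -->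
  \int[P]_w `|1 - dot_l2 (fun k => U k w) (fun k => G k w)|).
Proof.
have a0 k w : (0 <= absprod k w)%E by rewrite lee_fin.
pose g w := (1 + \sum_(k <oo) absprod k w)%E.
have ig : P.-integrable setT g.
  apply: integrableD => //; first exact: finite_measure_integrable_cst.
  apply/integrableP; split.
    by apply: ge0_emeasurable_sum => // k w _ _; exact: a0.
  under eq_integral do rewrite gee0_abs ?nneseries_ge0//.
  by rewrite integral_nneseries//; exact: nneseries_integral_prod.
have sg n w : (`|\sum_(0 <= k < n) U k w * G k w|%:E <= \sum_(k <oo) absprod k w)%E.
  apply: le_trans (nneseries_lim_ge n _) => //.
  by rewrite sumEFin lee_fin; exact: ler_norm_sum.
have h0 : P.-integrable setT (fun w => (dot_l2 (fun k => U k w) (fun k => G k w))%:E) /\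
  ((\int[P]_w (\sum_(0 <= k < n) U k w * G k w)%:E)%E @[n --> \oo] -->
  (\int[P]_w (dot_l2 (fun k => U k w) (fun k => G k w))%:E)%E).
  have [] := @dominated_convergence _ T R P setT measurableT
    (fun n w => (\sum_(0 <= k < n) U k w * G k w)%:E)
    (fun w => (dot_l2 (fun k => U k w) (fun k => G k w))%:E) g => //.
  - by move=> n; apply/measurable_EFinP; exact: sum_meas.
  - by apply/measurable_EFinP; exact: measurable_dot_l2.
  - by apply: filterS ae_cvg_dot_l2 => w h _; apply: cvg_EFin; [exact: nearW|exact: h].
  - apply: nearW => w n _; rewrite abse_EFin; apply: le_trans (sg n w) _.
    by rewrite leeDr.
have [h1 h2] := h0.
have h3 : P.-integrable setT (fun w => `|1 - dot_l2 (fun k => U k w) (fun k => G k w)|%:E) /\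
  ((\int[P]_w `|1 - \sum_(0 <= k < n) U k w * G k w|%:E)%E @[n --> \oo] -->
  (\int[P]_w `|1 - dot_l2 (fun k => U k w) (fun k => G k w)|%:E)%E).
  have [] := @dominated_convergence _ T R P setT measurableT
    (fun n w => `|1 - \sum_(0 <= k < n) U k w * G k w|%:E)
    (fun w => `|1 - dot_l2 (fun k => U k w) (fun k => G k w)|%:E) g => //.
  - move=> n; apply/measurable_EFinP; apply: measurableT_comp => //.
    exact: measurable_funB.
  - apply/measurable_EFinP; apply: measurableT_comp => //.
    by apply: measurable_funB => //; exact: measurable_dot_l2.
  - apply: filterS ae_cvg_dot_l2 => w h _; apply: cvg_EFin; first exact: nearW.
    by apply: cvg_norm; apply: cvgB => //; exact: cvg_cst.
  - apply: nearW => w n _; rewrite abse_EFin normr_id.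
    apply: (@le_trans _ _ (1 + `|\sum_(0 <= k < n) U k w * G k w|)%:E).
      by rewrite lee_fin; apply: le_trans (ler_normB _ _) _; rewrite normr1.
    by rewrite EFinD leeD2l.
split; first by apply: fine_cvg; rewrite fineK//; exact: integrable_fin_num.
split=> //; apply: fine_cvg; rewrite fineK; first exact: h3.2.
exact: integrable_fin_num h3.1.
Qed.

End gradient_series.

(** * The Malliavin-Stein bound *)

Lemma integrable_sum_prod {d} {T : measurableType d} {R : realType} (P : probability T R)
    (A B : nat -> T -> R) N :
  (forall k, A k \in Lfun P 2%:E) -> (forall k, B k \in Lfun P 2%:E) ->
  P.-integrable setT (EFin \o (fun w => \sum_(0 <= k < N) A k w * B k w)) /\
  \int[P]_w (\sum_(0 <= k < N) A k w * B k w) = \sum_(0 <= k < N) ip P (A k) (B k).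
Proof.
move=> AL BL; elim: N => [|N [iN eN]].
  split; last by rewrite big_geq//; under eq_Rintegral do rewrite big_geq//; rewrite Rintegral_cst// mul0r.
  apply: eq_integrable (integrable0 P setT) => // w _.
  by rewrite /= big_geq.
have iAB := L_integrable_mul (AL N) (BL N).
have E : (fun w => \sum_(0 <= k < N.+1) A k w * B k w) =
    (fun w => \sum_(0 <= k < N) A k w * B k w + A N w * B N w).
  by apply/funext => w; rewrite big_nat_recr.
rewrite E; split; first exact: integrableD iN iAB.
by rewrite (RintegralD measurableT iN iAB) eN [RHS]big_nat_recr.
Qed.

Section malliavin_stein.
Context {d} {T : measurableType d} {R : realType} {P : probability T R}.
Variables (p : nat -> R) (X : nat -> {RV P >-> R}).
Hypothesis hp : forall k, 0 < p k < 1.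
Hypothesis hX1 : forall k, P (X k @^-1` [set 1]) = (p k)%:E.
Hypothesis hXN1 : forall k, P (X k @^-1` [set -1]) = (1 - p k)%:E.
Hypothesis hXind : mutually_independent X.
Local Notation L := (Lfun P 2%:E).
Local Notation coef := (coef p X).
Local Notation inH := (inH p X).
Local Notation Y := (Y p X).
Local Notation mulY_L := (mulY_L hp hX1 hXN1).
Variables (F : T -> R) (U G : nat -> T -> R).
Hypothesis hF : inH F.
Hypothesis F0 : coef F fset0 = 0.
Hypothesis hU : forall k, inH (U k).
Hypothesis cU : forall k S, coef (U k) S = dcoef (coef F) k S.
Hypothesis hG : forall k, inH (G k).
Hypothesis cG : forall k S, coef (G k) S = (#|` S|%fset).+1%:R^-1 * dcoef (coef F) k S.
Hypothesis hE : (energy (coef F) < +oo)%E.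

Lemma nrm_G_le k : nrm P (G k) <= nrm P (U k).
Proof.
rewrite -(@ler_pXn2r _ 2)// ?nnegrE ?nrm_ge0// -lee_fin.
rewrite (parseval hp hX1 hXN1 hXind (hG k)) (parseval hp hX1 hXN1 hXind (hU k)).
apply: le_esum => S _; rewrite lee_fin cU cG exprMn ler_piMl ?sqr_ge0//.
by rewrite exprn_ile1// invf_le1 ?ltr0n// ler1n.
Qed.

Lemma nrm_U_fin : (\sum_(k <oo) (nrm P (U k) ^+ 2)%:E < +oo)%E.
Proof. by rewrite (sum_nrm_gradient hp hX1 hXN1 hXind hU cU). Qed.

Let UL k : U k \in L := inH_L (hU k).
Let GL k : G k \in L := inH_L (hG k).

Lemma U0 k S : k \in S -> coef (U k) S = 0.
Proof. by move=> kS; rewrite cU /dcoef kS. Qed.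

Lemma G0 k S : k \in S -> coef (G k) S = 0.
Proof. by move=> kS; rewrite cG /dcoef kS mulr0. Qed.

(** [a] keeps the coefficients of [F] at the sets without [k]; by [coef_mulY], [Y k * U k] carries
    exactly the others. *)
Lemma split_coordinate k : exists a, [/\ inH a, forall S, k \in S -> coef a S = 0 &
  F = (fun w => a w + Y k w * U k w) %[ae P]].
Proof.
pose c S := if k \in S then 0 else coef F S.
have cfin : l2coefs c.
  apply: l2coefs_le (l2coefs_coef hp hX1 hXN1 hXind hF) => S.
  by rewrite /c; case: ifP; rewrite ?normr0.
have [a ha ca] := inH_exists hp hX1 hXN1 hXind cfin.
exists a; split=> // [S kS|]; first by rewrite ca /c kS.
have hYU : inH (fun w => Y k w * U k w) by exact: (inH_mulY hp hX1 hXN1 hXind (hU k) (@U0 k)).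
apply: (inH_eq hp hX1 hXN1 hXind hF); first exact: (inH_add hp hX1 hXN1).
move=> S; rewrite (coefD hp hX1 hXN1 _ (inH_L ha) (inH_L hYU)).
rewrite (coef_mulY hp hX1 hXN1 _ (hU k) (@U0 k)) ca cU /c /dcoef.
by case: ifP => kS; rewrite ?addr0// fsetD11 fsetD1K// add0r.
Qed.

Lemma YG_sum_l2cvg : l2cvg P (fun N w => \sum_(0 <= k < N) Y k w * G k w) \oo F.
Proof.
have hYG k : inH (fun w => Y k w * G k w) by exact: (inH_mulY hp hX1 hXN1 hXind (hG k) (@G0 k)).
have hs N : inH (fun w => \sum_(0 <= k < N) Y k w * G k w) by exact: (inH_sum hp hX1 hXN1).
pose r N (S : {fset nat}) : R := \sum_(0 <= k < N) (k \in S)%:R.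
have cs N S : coef (fun w => \sum_(0 <= k < N) Y k w * G k w) S =
    r N S / #|` S|%fset%:R * coef F S.
  rewrite (coef_sum hp hX1 hXN1); last by move=> k _; exact: inH_L (hYG k).
  rewrite /r !mulr_suml; apply: eq_bigr => k _.
  rewrite (coef_mulY hp hX1 hXN1 _ (hG k) (@G0 k)) cG /dcoef.
  case: ifP => kS; last by rewrite !mul0r.
  by rewrite fsetD11 fsetD1K// mul1r (cardfsD1 k S) kS add1n.
have rE N S : r N S = (size [seq k <- iota 0 N | k \in S])%:R.
  rewrite /r -natr_sum size_filter -sum1_count [in RHS]big_mkcond /index_iota subn0.
  by congr (_%:R); apply: eq_bigr => k _; case: (k \in S).
have uf N (S : {fset nat}) : uniq [seq k <- iota 0 N | k \in S].
  by rewrite filter_uniq// iota_uniq.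
have rle N S : r N S <= #|` S|%fset%:R.
  by rewrite rE ler_nat; apply: uniq_leq_size => // k; rewrite mem_filter => /andP[].
have rS N S : (forall j, j \in S -> (j < N)%N) -> r N S = #|` S|%fset%:R.
  move=> SN; rewrite rE; congr (_%:R); apply/perm_size/uniq_perm => // k.
  rewrite mem_filter mem_iota add0n /=; apply: andb_idr; exact: SN.
apply: (l2cvg_coef hp hX1 hXN1 hXind (l2coefs_coef hp hX1 hXN1 hXind hF)) => //.
- move=> N S; rewrite cs -{2}(mul1r (coef F S)) -mulrBl normrM ler_piMl//.
  have r0 : 0 <= r N S / #|` S|%fset%:R by rewrite divr_ge0// sumr_ge0.
  have r1 : r N S / #|` S|%fset%:R <= 1.
    have [->|n0] := eqVneq (#|` S|%fset) 0%N; first by rewrite invr0 mulr0.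
    by rewrite ler_pdivrMr ?mul1r ?rle// ltr0n lt0n.
  by rewrite ler_norml; apply/andP; split; lra.
- move=> S; apply: filterS (near_box S) => N /in_boxP SN.
  rewrite cs rS//; have [->|S0] := eqVneq S fset0; first by rewrite F0 mulr0.
  by rewrite divff ?mul1r// pnatr_eq0 cardfs_eq0.
Qed.

Section stein_bound.
Variables (g dg : R -> R) (K : R).
Hypothesis gdg : forall x : R, is_derive x 1 g (dg x).
Hypothesis dgK : forall x, `|dg x| <= K.
Hypothesis dg2 : forall x y, `|dg x - dg y| <= 2 * `|x - y|.

Let gK x y : `|g x - g y| <= K * `|x - y|.
Proof. exact: derive_bounded_lipschitz. Qed.
Let K0 : 0 <= K. Proof. exact: le_trans (dgK 0). Qed.
Let FL : F \in L := inH_L hF.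
Let gFL : (fun w => g (F w)) \in L := L_lipschitz K0 gK FL.

(** Whatever the sign, [y] is one of the two points at which [g] is evaluated, and Taylor's formula
    is applied from it to the other. Their distance is [|u| / sd k], so [sd k] times its square is
    [u ^+ 2 / sd k]. *)
Lemma stein_remainder k (a u y : R) (c : bool) : y = a + yval p k c * u ->
  `|sd p k * (g (a + yval p k true * u) - g (a + yval p k false * u)) - dg y * u|
    <= (sd p k)^-1 * u ^+ 2.
Proof.
have s0 := sd_gt0 hp k; have yB := yvalB p k.
set b := a + yval p k true * u; set e := a + yval p k false * u.
have be : b - e = (sd p k)^-1 * u by rewrite -yB /b /e; ring.
have ue : u = sd p k * (b - e) by rewrite be mulVKf// gt_eqF.
have R2 : (b - e) ^+ 2 * sd p k = (sd p k)^-1 * u ^+ 2.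
  by rewrite be; field; rewrite gt_eqF.
move=> yE; rewrite -R2 [X in dg y * X]ue.
have -> : sd p k * (g b - g e) - dg y * (sd p k * (b - e)) =
  (g b - g e - dg y * (b - e)) * sd p k by ring.
rewrite normrM (gtr0_norm s0) ler_pM2r//.
case: c yE => yE; rewrite yE.
  have := lipschitz_derive_taylor gdg dg2 b e; rewrite -(normrN (g e - _ - _)) -(sqrrN (e - b)).
  rewrite -/b; suff -> : - (g e - g b - dg b * (e - b)) = g b - g e - dg b * (b - e).
    by rewrite opprB.
  by ring.
exact: (lipschitz_derive_taylor gdg dg2 e b).
Qed.

Lemma stein_bound :
  (`|\int[P]_w dg (F w) - ip P F (fun w => g (F w))|%:E <=
   K%:E * \int[P]_w (`|1 - dot_l2 (fun k => U k w) (fun k => G k w)|)%R%:E +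
   \int[P]_w \sum_(k <oo) ((sd p k)^-1 * `|G k w| * U k w ^+ 2)%R%:E)%E.
Proof.
pose q k w : \bar R := ((sd p k)^-1 * `|G k w| * U k w ^+ 2)%R%:E.
have q0 k w : (0 <= q k w)%E.
  rewrite lee_fin; apply: mulr_ge0; last exact: sqr_ge0.
  by apply: mulr_ge0 => //; rewrite invr_ge0 ltW// sd_gt0.
have mq k : measurable_fun setT (q k).
  apply/measurable_EFinP; apply: measurable_funM.
    by apply: measurable_funM => //; apply: measurableT_comp => //; exact: L_measurable.
  by apply: measurable_funX; exact: L_measurable.
have msq : measurable_fun setT (fun w => \sum_(k <oo) q k w)%E.
  by apply: ge0_emeasurable_sum => // k w _ _; exact: q0.
have sq0 w : (0 <= \sum_(k <oo) q k w)%E by apply: nneseries_ge0 => k _ _; exact: q0.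
have [_ [idot cdot]] := cvg_dot_l2 UL GL nrm_G_le nrm_U_fin.
set A1 := (\int[P]_w (`|1 - dot_l2 _ _|)%R%:E)%E.
set a1 := \int[P]_w `|1 - dot_l2 _ _| in cdot.
have A1E : A1 = a1%:E.
  rewrite /a1 /Rintegral fineK//; apply: integrable_fin_num => //.
  apply: (@integrable_norm _ _ _ P setT (fun w => 1 - dot_l2 (fun k => U k w) (fun k => G k w))).
  have := integrableB measurableT (finite_measure_integrable_cst P 1 measurableT) idot.
  by apply: eq_integrable.
rewrite A1E -EFinM; set A2 := (\int[P]_w _)%E.
have A20 : (0 <= A2)%E by apply: integral_ge0 => w _; exact: sq0.
(* If the second term is infinite the bound is trivial; otherwise every quantity is a real
   number. *)
have [->|A2oo] := eqVneq A2 +oo%E; first by rewrite addey// leey.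
have A2E : A2 = (fine A2)%:E by rewrite fineK// ge0_fin_numE// lt_neqAle A2oo leey.
rewrite A2E -EFinD lee_fin.
have [a ha] := choice split_coordinate.
pose s k := stein_gradient p g k (a k) (U k).
have aL k : a k \in L by case: (ha k) => h _ _; exact: inH_L h.
have sL k : s k \in L by exact: (stein_gradient_L p K0 gK k (aL k) (UL k)).
have YGL k : (fun w => Y k w * G k w) \in L by exact: mulY_L.
have H1 k : ip P (fun w => Y k w * G k w) (fun w => g (F w)) = ip P (G k) (s k).
  have [ak a0 Fk] := ha k.
  rewrite -(stein_ip hp hX1 hXN1 hXind K0 gK (hG k) ak (hU k) (@G0 k) a0 (@U0 k)).
  have stL := stein_Y_L hp hX1 hXN1 K0 gK k (aL k) (UL k).
  apply: ae_eq_Rintegral.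
  - by apply: measurable_funM; [exact: L_measurable (YGL k)|exact: L_measurable gFL].
  - by apply: measurable_funM; [exact: L_measurable (GL k)|exact: L_measurable stL].
  - by apply: filterS Fk => w /(_ I) ->; rewrite /stein_Y; ring.
pose x N := \int[P]_w dg (F w) - \sum_(0 <= k < N) ip P (G k) (s k).
have cx : x N @[N --> \oo] --> \int[P]_w dg (F w) - ip P F (fun w => g (F w)).
  apply: cvgB; first exact: cvg_cst.
  have -> : (fun N => \sum_(0 <= k < N) ip P (G k) (s k)) =
      (fun N => ip P (fun w => \sum_(0 <= k < N) Y k w * G k w) (fun w => g (F w))).
    apply/funext => N; rewrite ip_suml//; by apply: eq_bigr => k _; rewrite H1.
  apply: l2cvg_ip => //; last 2 first.
  - exact: YG_sum_l2cvg.
  - move=> e e0; apply: nearW => N; rewrite nrm_sub_self//.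
  - by move=> N; exact: L_sum.
have dgL : (fun w => dg (F w)) \in L by exact: (L_lipschitz _ dg2 FL).
(* The remainders of the first [N] coordinates are bounded at once by the full series, so only the
   first term of this bound still depends on [N]; its limit is given by [cvg_dot_l2]. *)
have H3 N : `|x N| <= K * (\int[P]_w `|1 - \sum_(0 <= k < N) U k w * G k w|) + fine A2.
  pose v w := \sum_(0 <= k < N) G k w * s k w.
  have [iv ev] := integrable_sum_prod N GL sL.
  have idg : P.-integrable setT (EFin \o (fun w => dg (F w))) by exact: L_integrable.
  have xE : x N = \int[P]_w (dg (F w) - v w).
    by rewrite (RintegralB measurableT idg iv) /x ev.
  have ih : P.-integrable setT (EFin \o (fun w => dg (F w) - v w)).
    exact: (integrableB measurableT idg iv).
  have i1 : P.-integrable setT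
      (EFin \o (fun w => `|1 - \sum_(0 <= k < N) U k w * G k w|)).
    apply: (@integrable_norm _ _ _ P setT (fun w => 1 - \sum_(0 <= k < N) U k w * G k w)).
    have [i2 _] := integrable_sum_prod N UL GL.
    have := integrableB measurableT (finite_measure_integrable_cst P 1 measurableT) i2.
    by apply: eq_integrable.
  rewrite -lee_fin xE EFinD -A2E EFinM /Rintegral -abse_EFin !fineK; last 2 first.
  - exact: integrable_fin_num i1.
  - exact: integrable_fin_num ih.
  apply: le_trans (le_abse_integral _ measurableT _) _.
    by apply/measurable_EFinP; move/integrableP : ih => [/measurable_EFinP].
  rewrite -(ge0_integralZl_EFin _ measurableT)//; last first.
    by move/integrableP : i1 => [].
  rewrite -ge0_integralD//; last 3 first.
  - by move=> w _; rewrite -EFinM lee_fin mulr_ge0.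
  - by apply: measurable_funeM; move/integrableP : i1 => [].
  - by move=> w _; exact: sq0.
  apply: ae_ge0_le_integral => //.
  - by apply: measurableT_comp => //; move/integrableP : ih => [].
  - by move=> w _; apply: adde_ge0; [rewrite -EFinM lee_fin mulr_ge0|exact: sq0].
  - by apply: emeasurable_funD => //; apply: measurable_funeM; move/integrableP : i1 => [].
  have aeF : {ae P, forall w k, F w = a k w + Y k w * U k w}.
    apply/ae_foralln => k; case: (ha k) => _ _; apply: filterS => w; exact.
  apply: filterS2 aeF (ae_Y hp hX1 hXN1) => w Fw Yw _.
  have rem k : `|s k w - dg (F w) * U k w| <= (sd p k)^-1 * U k w ^+ 2.
    by apply: (stein_remainder (c := signs X w k)); rewrite -Yw; exact: Fw.
  rewrite abse_EFin.
  have -> : dg (F w) - v w = dg (F w) * (1 - \sum_(0 <= k < N) U k w * G k w)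
      - \sum_(0 <= k < N) G k w * (s k w - dg (F w) * U k w).
    rewrite /v mulrBr mulr1 mulr_sumr -addrA -opprD -big_split /=; congr (_ - _).
    by apply: eq_bigr => k _; ring.
  apply: (@le_trans _ _ (K * `|1 - \sum_(0 <= k < N) U k w * G k w| +
     \sum_(0 <= k < N) (sd p k)^-1 * `|G k w| * U k w ^+ 2)%:E).
    rewrite lee_fin; apply: le_trans (ler_normB _ _) _; apply: lerD.
      by rewrite normrM ler_wpM2r.
    apply: le_trans (ler_norm_sum _ _ _) _; apply: ler_sum => k _.
    rewrite normrM; apply: le_trans (ler_wpM2l (normr_ge0 _) (rem k)) _.
    by rewrite mulrCA mulrA.
  rewrite EFinD EFinM leeD2l// -sumEFin.
  by apply: nneseries_lim_ge => k _ _; exact: q0.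
have cr : K * (\int[P]_w `|1 - \sum_(0 <= k < N) U k w * G k w|) + fine A2
    @[N --> \oo] --> K * a1 + fine A2.
  apply: cvgD; last exact: cvg_cst.
  by apply: cvgM; [exact: cvg_cst|exact: cdot].
by apply: (ler_cvg_to (cvg_norm cx) cr); exact: nearW.
Qed.

End stein_bound.

End malliavin_stein.

(** * From Stein's equation to the Wasserstein distance *)

Section wasserstein_bound.
Context {d} {T : measurableType d} {R : realType} {P : probability T R}.
Variables (p : nat -> R) (X : nat -> {RV P >-> R}).
Hypothesis hp : forall k, 0 < p k < 1.
Hypothesis hX1 : forall k, P (X k @^-1` [set 1]) = (p k)%:E.
Hypothesis hXN1 : forall k, P (X k @^-1` [set -1]) = (1 - p k)%:E.
Hypothesis hXind : mutually_independent X.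
Local Notation L := (Lfun P 2%:E).
Local Notation coef := (coef p X).
Local Notation inH := (inH p X).
Variables (F : T -> R) (U G : nat -> T -> R).
Hypothesis hF : inH F.
Hypothesis F0 : coef F fset0 = 0.
Hypothesis hU : forall k, inH (U k).
Hypothesis cU : forall k S, coef (U k) S = dcoef (coef F) k S.
Hypothesis hG : forall k, inH (G k).
Hypothesis cG : forall k S, coef (G k) S = (#|` S|%fset).+1%:R^-1 * dcoef (coef F) k S.
Hypothesis hE : (energy (coef F) < +oo)%E.
Context {d'} {T' : measurableType d'} {P' : probability T' R}.
Variable (Z : {RV P' >-> R}).
Hypothesis hZ : forall A : set R, measurable A ->
  distribution P' Z A = normal_prob 0 1 A.

Lemma wasserstein_bound : (wasserstein P F P' Z <=
   (Num.sqrt (2 / pi))%:E *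
     \int[P]_w (`|1 - dot_l2 (fun k => U k w) (fun k => G k w)|)%R%:E +
   \int[P]_w \sum_(k <oo) ((sd p k)^-1 * `|G k w| * U k w ^+ 2)%R%:E)%E.
Proof.
apply: ge_ereal_sup => _ /= [h hlip <-].
have hl x y : `|h x - h y| <= `|x - y|.
  by have := hlip (x, y) (conj I I); rewrite /= mul1r.
have hc : measurable_fun setT h.
  by apply: continuous_measurable_fun; exact: lipschitz1_continuous.
have FL : F \in L := inH_L hF.
have dgb := stein_dsol_bound hl.
have dg2 := stein_dsol_lipschitz hl.
have dgL : (fun w => stein_dsol h (F w)) \in L by exact: (L_lipschitz _ dg2 FL).
have gK := derive_bounded_lipschitz (is_derive_stein_sol hl) dgb.
have gL : (fun w => stein_sol h (F w)) \in L by exact: (L_lipschitz _ gK FL).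
have i1 := L_integrable dgL; have i2 := L_integrable_mul FL gL.
have -> : ('E_P[h \o F] = (gmean h + (\int[P]_w stein_dsol h (F w) -
    ip P F (fun w => stein_sol h (F w))))%:E)%E.
  have hE' : (h \o F) = (fun w => gmean h +
      (stein_dsol h (F w) - F w * stein_sol h (F w))).
    by apply/funext => w; rewrite /stein_dsol /=; ring.
  have i3 := integrableB measurableT i1 i2.
  have i4 := finite_measure_integrable_cst P (gmean h) measurableT.
  have hFi : P.-integrable setT (EFin \o (h \o F)).
    by apply: eq_integrable (integrableD measurableT i4 i3) => // w _; rewrite hE'.
  rewrite unlock -[LHS]fineK; last exact: integrable_fin_num hFi.
  congr EFin; rewrite -[LHS]/(\int[P]_w (h \o F) w) hE'.
  rewrite (RintegralD measurableT i4 i3) (RintegralB measurableT i1 i2).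
  by rewrite Rintegral_cst//= probability_setT mulr1.
have -> : ('E_P'[h \o Z] = (gmean h)%:E)%E.
  rewrite (normal_expectation hZ hc) /gmean /Rintegral fineK//.
  exact: integrable_fin_num (integrable_lipschitz_phi hl).
rewrite -EFinB abse_EFin [X in `|X|](_ : _ =
  \int[P]_w stein_dsol h (F w) - ip P F (fun w => stein_sol h (F w))); last by ring.
exact: (stein_bound hp hX1 hXN1 hXind hF F0 hU cU hG cG hE (is_derive_stein_sol hl) dgb dg2).
Qed.

End wasserstein_bound.

(** * A single chaos *)

(** Recovers a Cauchy-Schwarz inequality from its weighted arithmetic-geometric form, by the choice
    [t = sqrt b / sqrt a]. It lets the inequality over both the probability space and the index [k]
    be proved term by term. *)
Lemma le_sqrt_mul_of_AMGM {R : rcfType} (x a b : R) : 0 <= a -> 0 <= b ->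
  (forall t, 0 < t -> 2 * x <= t * a + t^-1 * b) -> x <= Num.sqrt a * Num.sqrt b.
Proof.
move=> a0 b0 H; have [x0|x0] := leP x 0; first by rewrite (le_trans x0)// mulr_ge0.
(* If [a] or [b] is 0 the optimal [t] degenerates; a [t] is then taken for which the surviving term
   is [x * c / (c + 1)], less than [2 * x]. *)
have absurd c : 0 <= c -> ~ 2 * x <= x / (c + 1) * c.
  move=> c0; have c1 : 0 < c + 1 by rewrite ltr_pwDr.
  rewrite mulrAC ler_pdivlMr//; nra.
move: a0; rewrite le_eqVlt => /predU1P[a0|a0].
  have t0 : 0 < (b + 1) / x by rewrite divr_gt0// ltr_pwDr.
  by have := H _ t0; rewrite -a0 mulr0 add0r invf_div => /(absurd _ b0).
move: b0; rewrite le_eqVlt => /predU1P[b0|b0].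
  have t0 : 0 < x / (a + 1) by rewrite divr_gt0// ltr_pwDr// ltW.
  by have := H _ t0; rewrite -b0 mulr0 addr0 => /(absurd _ (ltW a0)).
have sa : 0 < Num.sqrt a by rewrite sqrtr_gt0.
have sb : 0 < Num.sqrt b by rewrite sqrtr_gt0.
set t := Num.sqrt b / Num.sqrt a; have t0 : 0 < t by exact: divr_gt0.
have := H t t0; rewrite -[X in t * X](sqr_sqrtr (ltW a0)) -[X in t^-1 * X](sqr_sqrtr (ltW b0)).
have -> : t * Num.sqrt a ^+ 2 + t^-1 * Num.sqrt b ^+ 2 = 2 * (Num.sqrt a * Num.sqrt b).
  by rewrite /t invf_div; field; rewrite !gt_eqF.
by rewrite ler_pM2l.
Qed.

Section single_chaos.
Context {d} {T : measurableType d} {R : realType} {P : probability T R}.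
Variables (p : nat -> R) (X : nat -> {RV P >-> R}).
Hypothesis hp : forall k, 0 < p k < 1.
Hypothesis hX1 : forall k, P (X k @^-1` [set 1]) = (p k)%:E.
Hypothesis hXN1 : forall k, P (X k @^-1` [set -1]) = (1 - p k)%:E.
Hypothesis hXind : mutually_independent X.
Local Notation L := (Lfun P 2%:E).
Local Notation coef := (coef p X).
Local Notation inH := (inH p X).
Variables (F : T -> R) (U G : nat -> T -> R).
Hypothesis hF : inH F.
Hypothesis hU : forall k, inH (U k).
Hypothesis cU : forall k S, coef (U k) S = dcoef (coef F) k S.
Hypothesis hG : forall k, inH (G k).
Hypothesis cG : forall k S, coef (G k) S = (#|` S|%fset).+1%:R^-1 * dcoef (coef F) k S.
Variable m : nat.
Hypothesis m0 : (0 < m)%N.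
Hypothesis cm : forall S : {fset nat}, #|` S|%fset != m -> coef F S = 0.

Let UL k : U k \in L := inH_L (hU k).
Let FL : F \in L := inH_L hF.
Let V w := normsq_l2 (fun k => U k w).

(** Only sets of [m] elements carry coefficients, so the weight is constant. Parseval for
    [sqrt m * F] brings this constant inside the sum. *)
Lemma chaos_energy : (energy (coef F) = (m%:R * nrm P F ^+ 2)%:E)%E.
Proof.
have hmF := inH_scale hp hX1 hXN1 (Num.sqrt m%:R) hF.
have := parseval hp hX1 hXN1 hXind hmF.
rewrite nrmZ// exprMn ger0_norm ?sqrtr_ge0// sqr_sqrtr// => ->; apply: eq_esum => S _.
rewrite (coefZ hp hX1 hXN1)// exprMn sqr_sqrtr//.
by have [->//|/cm ->] := eqVneq (#|` S|%fset) m; rewrite expr0n !mulr0.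
Qed.

Let Ufin : (\sum_(k <oo) (nrm P (U k) ^+ 2)%:E < +oo)%E.
Proof. by rewrite (sum_nrm_gradient hp hX1 hXN1 hXind hU cU) chaos_energy ltry. Qed.

Lemma chaos_G k : G k = (fun w => m%:R^-1 * U k w) %[ae P].
Proof.
have hmU := inH_scale hp hX1 hXN1 m%:R^-1 (hU k).
apply: (inH_eq hp hX1 hXN1 hXind (hG k) hmU) => S.
rewrite cG (coefZ hp hX1 hXN1)// cU /dcoef; case: ifPn => kS; first by rewrite !mulr0.
have [Sm|/cm ->] := eqVneq (#|` (k |` S)|%fset) m; last by rewrite !mulr0.
by rewrite -Sm cardfsU1 kS.
Qed.

Let ae_G : {ae P, forall w k, G k w = m%:R^-1 * U k w}.
Proof.
by apply/ae_foralln => k; apply: filterS (chaos_G k) => w; exact.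
Qed.

Lemma chaos_dot_l2 :
  {ae P, forall w, dot_l2 (fun k => U k w) (fun k => G k w) = m%:R^-1 * V w}.
Proof.
apply: filterS2 ae_G (ae_cvg_dot_l2 UL UL (fun k => lexx _) Ufin) => w Gw cV.
rewrite /dot_l2; apply/cvg_lim => //.
have -> : series (fun k => U k w * G k w) =
    (fun n => m%:R^-1 * \sum_(0 <= k < n) U k w * U k w).
  apply/funext => n; rewrite /series /= mulr_sumr; apply: eq_bigr => k _.
  by rewrite Gw mulrCA.
by apply: cvgM; [exact: cvg_cst|exact: cV].
Qed.

Lemma chaos_normsq : P.-integrable setT (EFin \o V) /\
  \int[P]_w V w = m%:R * nrm P F ^+ 2.
Proof.
have [cV [iV _]] := cvg_dot_l2 UL UL (fun k => lexx _) Ufin.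
split=> //.
have cV' : \int[P]_w (\sum_(0 <= k < n) U k w * U k w) @[n --> \oo] --> m%:R * nrm P F ^+ 2.
  have -> : (fun n => \int[P]_w (\sum_(0 <= k < n) U k w * U k w)) =
      (fun n => fine (\sum_(0 <= k < n) (nrm P (U k) ^+ 2)%:E)%E).
    apply/funext => n; rewrite (integrable_sum_prod n UL UL).2 sumEFin /=.
    by apply: eq_bigr => k _; rewrite nrm_sq.
  apply: fine_cvg; rewrite -chaos_energy -(sum_nrm_gradient hp hX1 hXN1 hXind hU cU).
  by apply: is_cvg_nneseries => k _ _; rewrite lee_fin sqr_ge0.
exact: (cvg_unique _ cV cV').
Qed.

Lemma expectation_sqr : ('E_P[fun w => (F w ^+ 2)%R] = (nrm P F ^+ 2)%:E)%E.
Proof. by rewrite unlock nrm_sqE. Qed.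

Lemma chaos_first_term :
  (\int[P]_w (`|1 - dot_l2 (fun k => U k w) (fun k => G k w)|)%R%:E <=
   `|1 - 'E_P[fun w => (F w ^+ 2)%R]| + (m%:R^-1)%:E * sqrte 'V_P[V])%E.
Proof.
have [iV EV] := chaos_normsq.
have mV : measurable_fun setT V by move/integrableP : iV => [/measurable_EFinP].
have mR : (0 : R) < m%:R^-1 by rewrite invr_gt0 ltr0n.
rewrite expectation_sqr -EFinB abse_EFin.
set e := nrm P F ^+ 2.
have fE : fine 'E_P[V]%E = m%:R * e by rewrite unlock; exact: EV.
have VE : ('V_P[V] = \int[P]_w ((V w - m%:R * e) ^+ 2)%R%:E)%E.
  rewrite /variance covariance.unlock fE expectation.unlock.
  by apply: eq_integral => w _; rewrite expr2.
(* [V] is known to be integrable but perhaps not square integrable; an infinite variance makes the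
   bound trivial. *)
have [Voo|Voo] := eqVneq ('V_P[V])%E +oo%E.
  by rewrite Voo /= gt0_muley ?lte_fin// addey// leey.
have dL : (fun w => V w - m%:R * e) \in L.
  apply: L_lt_pinfty; first by apply: measurable_funB.
  by rewrite -VE lt_neqAle Voo leey.
rewrite VE -nrm_sqE//= sqrtr_sqr (ger0_norm (nrm_ge0 _ _)).
have mnV : measurable_fun setT (fun w => `|V w - m%:R * e|%:E).
  by apply/measurable_EFinP; apply: measurableT_comp => //; exact: measurable_funB.
have mnV' : measurable_fun setT (fun w => (m%:R^-1)%:E * `|V w - m%:R * e|%:E)%E.
  exact: measurable_funeM.
have nV0 w : (0 <= (m%:R^-1)%:E * `|V w - m%:R * e|%:E)%E.
  by rewrite -EFinM lee_fin mulr_ge0// ltW.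
apply: (@le_trans _ _ (\int[P]_w (`|1 - e|%:E + (m%:R^-1)%:E * `|V w - m%:R * e|%:E))%E).
  apply: ae_ge0_le_integral => //.
  - apply/measurable_EFinP; apply: measurableT_comp => //.
    apply: measurable_funB => //.
    exact: measurable_dot_l2 UL (fun k => inH_L (hG k)).
  - by move=> w _; exact: adde_ge0.
  - exact: emeasurable_funD.
  apply: filterS chaos_dot_l2 => w -> _; rewrite -EFinM -EFinD lee_fin.
  (* [V] is centred at its mean [m * e]; the L^1 norm of the centred part is then bounded by its L^2
     norm, the square root of the variance. *)
  have -> : 1 - m%:R^-1 * V w = (1 - e) - m%:R^-1 * (V w - m%:R * e).
    by field; rewrite pnatr_eq0 -lt0n.
  by apply: le_trans (ler_normB _ _) _; rewrite normrM (gtr0_norm mR).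
rewrite ge0_integralD//.
have := @integral_cst _ _ _ P setT measurableT `|1 - e|%:E.
rewrite /= probability_setT mule1 => ->. rewrite leeD2l//.
rewrite ge0_integralZl_EFin//.
apply: lee_wpmul2l; first by rewrite lee_fin ltW.
exact: integral_abs_le_nrm.
Qed.

Lemma chaos_second_term :
  (\int[P]_w \sum_(k <oo) ((sd p k)^-1 * `|G k w| * U k w ^+ 2)%R%:E <=
   sqrte ('E_P[fun w => (F w ^+ 2)%R] * (m%:R^-1)%:E) *
   sqrte (\sum_(k <oo) ((sd p k ^+ 2)^-1)%:E * 'E_P[fun w => (`|U k w| ^+ 4)%R]))%E.
Proof.
have mR : (0 : R) < m%:R^-1 by rewrite invr_gt0 ltr0n.
have mU k : measurable_fun setT (U k) := L_measurable (UL k).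
rewrite expectation_sqr -EFinM /=; set e := nrm P F ^+ 2.
have e0 : 0 <= e by exact: sqr_ge0.
pose b k : \bar R := (((sd p k ^+ 2)^-1)%:E * \int[P]_w ((U k w) ^+ 4)%R%:E)%E.
have iU40 k : (0 <= \int[P]_w ((U k w) ^+ 4)%R%:E)%E.
  by apply: integral_ge0 => w _; rewrite lee_fin exprn_even_ge0.
have b0 k : (0 <= b k)%E by rewrite mule_ge0// lee_fin invr_ge0 sqr_ge0.
set B := (\sum_(k <oo) _)%E.
have BE : B = (\sum_(k <oo) b k)%E.
  apply: eq_eseriesr => k _; rewrite expectation.unlock; congr (_ * _)%E.
  apply: eq_integral => w _; congr EFin.
  by rewrite -[4%N]/(2 * 2)%N !exprM real_normK// num_real.
have B0 : (0 <= B)%E by rewrite BE; apply: nneseries_ge0.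
have mU2 k : measurable_fun setT (fun w => (U k w ^+ 2)%:E).
  by apply/measurable_EFinP; exact: measurable_funX.
have mU4 k : measurable_fun setT (fun w => (U k w ^+ 4)%:E).
  by apply/measurable_EFinP; exact: measurable_funX.
pose A := (\int[P]_w \sum_(k <oo) ((sd p k)^-1 * `|G k w| * U k w ^+ 2)%R%:E)%E.
pose q k w : \bar R := ((sd p k)^-1 * `|G k w| * U k w ^+ 2)%R%:E.
have q0 k w : (0 <= q k w)%E.
  rewrite lee_fin; apply: mulr_ge0; last exact: sqr_ge0.
  by apply: mulr_ge0 => //; rewrite invr_ge0 ltW// sd_gt0.
have mq k : measurable_fun setT (q k).
  apply/measurable_EFinP; apply: measurable_funM; last exact: measurable_funX.
  apply: measurable_funM => //; apply: measurableT_comp => //.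
  exact: L_measurable (inH_L (hG k)).
rewrite -/A; have AE : A = (\sum_(k <oo) \int[P]_w q k w)%E by apply: integral_nneseries => // k w _; exact: q0.
(* AM-GM: [2 |U|^3 / sd <= t U^2 + U^4 / (t sd^2)] *)
have key t : 0 < t -> ((2 * m%:R)%:E * A <= (t * (m%:R * e))%:E + t^-1%:E * B)%E.
  move=> t0; have ti0 : 0 < t^-1 by rewrite invr_gt0.
  have EE : energy (coef F) = (m%:R * e)%:E := chaos_energy.
  rewrite (EFinM t) -EE -(sum_nrm_gradient hp hX1 hXN1 hXind hU cU) BE AE.
  have nU k : (0 <= (nrm P (U k) ^+ 2)%:E)%E by rewrite lee_fin sqr_ge0.
  rewrite -!nneseriesZl//; last by move=> k _; apply: integral_ge0 => w _; exact: q0.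
  rewrite -nneseriesD; last 2 first.
  - by move=> k _ _; rewrite mule_ge0// lee_fin ltW.
  - by move=> k _ _; rewrite mule_ge0// lee_fin ltW.
  apply: lee_nneseries => [k _ _|k _].
    by apply: mule_ge0; [rewrite lee_fin|apply: integral_ge0 => w _; exact: q0].
  have s0 := sd_gt0 hp k.
  have u20 w : (0 <= t%:E * (U k w ^+ 2)%:E)%E.
    by rewrite -EFinM lee_fin; apply: mulr_ge0; [exact: ltW|exact: sqr_ge0].
  have c0 : 0 <= t^-1 * (sd p k ^+ 2)^-1.
    by rewrite mulr_ge0 ?ltW// invr_gt0 exprn_gt0.
  have u40 w : (0 <= (t^-1 * (sd p k ^+ 2)^-1)%:E * (U k w ^+ 4)%:E)%E.
    by rewrite -EFinM lee_fin mulr_ge0// exprn_even_ge0.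
  rewrite nrm_sqE// /b muleA -EFinM; have m2 : 0 <= 2 * m%:R :> R by [].
  rewrite -(ge0_integralZl_EFin P measurableT (fun w _ => q0 k w) (mq k) m2).
  rewrite -(ge0_integralZl_EFin P measurableT _ (mU2 k) (ltW t0)); last first.
    by move=> w _; rewrite lee_fin sqr_ge0.
  rewrite -(ge0_integralZl_EFin P measurableT _ (mU4 k) c0); last first.
    by move=> w _; rewrite lee_fin exprn_even_ge0.
  rewrite -ge0_integralD//; last 2 first.
  - exact: measurable_funeM.
  - exact: measurable_funeM.
  apply: ae_ge0_le_integral => //.
  - by move=> w _; rewrite mule_ge0// lee_fin.
  - exact: measurable_funeM.
  - by move=> w _; exact: adde_ge0.
  - by apply: emeasurable_funD; exact: measurable_funeM.
  apply: filterS ae_G => w Gw _; rewrite /q -!EFinM -EFinD lee_fin Gw.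
  rewrite normrM (gtr0_norm mR).
  have -> : U k w ^+ 2 = `|U k w| ^+ 2 by rewrite real_normK// num_real.
  have -> : U k w ^+ 4 = `|U k w| ^+ 4.
    by rewrite -[4%N]/(2 * 2)%N !exprM real_normK// num_real.
  rewrite -subr_ge0; set u := `|U k w|.
  rewrite (_ : _ - _ = t^-1 * (u * (t - (sd p k)^-1 * u)) ^+ 2).
    by rewrite mulr_ge0 ?sqr_ge0// ltW.
  by field; rewrite !gt_eqF// ltr0n.
(* Rules out the product of 0 and [+oo], which is 0 in the extended reals and would not bound the
   left side: if [F] is almost surely 0, so is every [U k]. *)
have fact0 : e = 0 -> B = 0%E.
  move=> e00; rewrite BE; apply: eseries0 => k _ _.
  have nU0 : nrm P (U k) = 0.
    apply/eqP; rewrite -sqrf_eq0 eq_le sqr_ge0 andbT -lee_fin.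
    apply: (@le_trans _ _ (\sum_(j <oo) (nrm P (U j) ^+ 2)%:E)%E); last first.
      by rewrite (sum_nrm_gradient hp hX1 hXN1 hXind hU cU) chaos_energy -/e e00 mulr0.
    apply: le_trans (nneseries_lim_ge k.+1 _).
      by rewrite big_nat_recr//= leeDr// sume_ge0// => j _; rewrite lee_fin sqr_ge0.
    by move=> j _ _; rewrite lee_fin sqr_ge0.
  rewrite /b (_ : (\int[P]_w _)%E = 0%E) ?mule0//.
  rewrite -(@integral0 _ _ _ P setT); apply: ae_eq_integral => //.
  by apply: filterS (nrm_eq0 (UL k) nU0) => w /(_ I) -> _; rewrite expr0n.
have [Boo|Boo] := eqVneq B +oo%E.
  have [/fact0 B00|en0] := eqVneq e 0; first by move: Boo; rewrite B00.
  rewrite Boo [sqrte +oo]/= gt0_muley ?leey// lte_fin sqrtr_gt0 mulr_gt0//.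
  by rewrite lt0r en0.
have Bfin : B \is a fin_num by rewrite ge0_fin_numE// lt_neqAle Boo leey.
have A0 : (0 <= A)%E.
  by apply: integral_ge0 => w _; apply: nneseries_ge0 => k _ _; exact: q0.
have mm : (0 : R) < 2 * m%:R by rewrite mulr_gt0// ltr0n.
(* Finiteness comes from the inequality [key] itself at [t = 1], whose right side is finite. *)
have Afin : A \is a fin_num.
  rewrite ge0_fin_numE// lt_neqAle leey andbT; apply/eqP => Aoo.
  have := key 1 ltr01; rewrite Aoo gt0_muley ?lte_fin// -(fineK Bfin) -EFinM -EFinD.
  by rewrite leye_eq.
rewrite -(fineK Afin) -(fineK Bfin) /= -EFinM lee_fin.
have b1 : 0 <= fine B by exact: fine_ge0.
have me : 0 <= m%:R * e by rewrite mulr_ge0.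
have h := @le_sqrt_mul_of_AMGM _ (m%:R * fine A) _ _ me b1.
(* The optimization over [t] bounds [m * A] by [sqrt (m * e) * sqrt B]; this rewriting accounts for
   the factor [m]. *)
have -> : e / m%:R = m%:R^-1 ^+ 2 * (m%:R * e) by field; rewrite pnatr_eq0 -lt0n.
rewrite sqrtrM ?sqr_ge0// sqrtr_sqr (gtr0_norm mR) -mulrA -ler_pdivrMl// invrK.
apply: h => t t0; have h := key t t0.
rewrite -(fineK Afin) -(fineK Bfin) -!EFinM -EFinD lee_fin in h.
by rewrite mulrA.
Qed.

End single_chaos.

Theorem theorem3p1 (R : realType)
  (d : measure_display) (T : measurableType d) (P : probability T R)
  (p : nat -> R) (X : nat -> {RV P >-> R})
  (hp : forall k, 0 < p k < 1)
  (hX1 : forall k, P (X k @^-1` [set 1]) = (p k)%:E)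
  (hXN1 : forall k, P (X k @^-1` [set -1]) = (1 - p k)%:E)
  (hXind : mutually_independent X)
  (d' : measure_display) (T' : measurableType d') (P' : probability T' R)
  (Z : {RV P' >-> R})
  (hZ : forall A : set R, measurable A ->
    distribution P' Z A = normal_prob 0 1 A)
  (F : T -> R)
  (hF : domD p X F)
  (hF0 : ('E_P[F] = 0)%E) :
  let DF (k : nat) (w : T) : R := D p X F k w in
  let DLF (k : nat) (w : T) : R := D p X (Linv p X F) k w in
  let A1 : \bar R := ('E_P[fun w =>
    (`|1 - dot_l2 (fun k => DF k w) (fun k => - DLF k w)|)%R])%E in
  let A2 : \bar R := (\int[P]_w \sum_(k <oo)
    ((Num.sqrt (p k * (1 - p k)))^-1 * `|DLF k w| * `|DF k w| ^+ 2)%R%:E)%E in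
  (wasserstein P F P' Z <= (Num.sqrt (2 / pi))%R%:E * A1 + A2)%E
  /\
  (forall m : nat, (0 < m)%N -> chaos p X m F ->
    (A1 <= `|1 - 'E_P[fun w => (F w ^+ 2)%R]|
           + (m%:R^-1)%R%:E *
             sqrte 'V_P[fun w => normsq_l2 (fun k => DF k w)])%E
    /\
    (A2 <= sqrte ('E_P[fun w => (F w ^+ 2)%R] * (m%:R^-1)%R%:E)
           * sqrte (\sum_(k <oo) ((p k * (1 - p k))^-1)%R%:E
                      * 'E_P[fun w => (`|DF k w| ^+ 4)%R]))%E).
Proof.
move=> DF DLF A1 A2.
have hE := domD_energy hp hX1 hXN1 hXind hF.
have hdec : exists f, chaos_decomposition p X F f by case: hF => _ [f]; exists f.
have FH := decomposed_inH hp hX1 hXN1 hXind hdec.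
have F0 : coef p X F fset0 = 0 by rewrite -coef_expectation hF0.
pose U k := D p X F k.
pose G k w := - DLF k w.
have hU k : inH p X (U k) := (D_spec hp hX1 hXN1 hXind hdec k).1.
have cU k S : coef p X (U k) S = dcoef (coef p X F) k S.
  exact: (D_spec hp hX1 hXN1 hXind hdec k).2.
have [hDL cDL] := all_and2 (fun k => DLinv_spec hp hX1 hXN1 hXind k hdec).
have GE k : G k = fun w => -1 * D p X (Linv p X F) k w.
  by apply/funext => w; rewrite mulN1r.
have hG k : inH p X (G k) by rewrite (GE k); exact: (inH_scale hp hX1 hXN1 (-1) (hDL k)).
have cG k S : coef p X (G k) S = (#|` S|%fset).+1%:R^-1 * dcoef (coef p X F) k S.
  rewrite (GE k) (coefZ hp hX1 hXN1 _ _ (inH_L (hDL k))) cDL /dcoef.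
  by case: ifP => _; rewrite ?mulr0// mulN1r opprK.
have A1E : A1 = (\int[P]_w (`|1 - dot_l2 (fun k => U k w) (fun k => G k w)|)%R%:E)%E.
  by rewrite /A1 unlock.
have A2E : A2 = (\int[P]_w \sum_(k <oo) ((sd p k)^-1 * `|G k w| * U k w ^+ 2)%R%:E)%E.
  apply: eq_integral => w _; apply: eq_eseriesr => k _; congr EFin.
  by rewrite normrN real_normK ?num_real.
rewrite A1E A2E; split.
  exact: (wasserstein_bound hp hX1 hXN1 hXind FH F0 hU cU hG cG hE hZ).
move=> m m0 [_ [g gs Fg]].
have cm (S : {fset nat}) : #|` S|%fset != m -> coef p X F S = 0.
  have [hJ cJ] := J_spec hp hX1 hXN1 hXind gs.
  move=> Sm; rewrite (ae_eq_coef hp hX1 hXN1 S (inH_L FH) (inH_L hJ) Fg) cJ kcoef0//.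
split; first exact: (chaos_first_term hp hX1 hXN1 hXind FH hU cU hG cG m0 cm).
apply: le_trans (chaos_second_term hp hX1 hXN1 hXind FH hU cU hG cG m0 cm) _.
by under eq_eseriesr do rewrite sd_sq//.
Qed.
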